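(* Let $K$ be a commutative hypergroup such that $P_b(K)\cdot P_b(K)\subset P_b(K)$, and let $p$ be either an even positive integer or $p=\infty$. For every relatively compact neighbourhood $U$ of the identity $e$ there is a constant $C_U>0$ such that the following holds. If $f\in (L^1,\ell^\infty)(K)$ is of positive type and satisfies $f\,\mathbf 1_U\in L^p(K)$, then $$f\in (L^p,\ell^\infty)(K)\quad\text{and}\quad \|f\|_{p,\infty,U}\le C_U^{1/p}\,\|f\,\mathbf 1_U\|_p$$ (where $C_U^{1/p}=1$ if $p=\infty$). Consequently, if $f\in(L^1,\ell^\infty)(K)$ is of positive type and $f\mathbf 1_U\in L^p(K)$ for some relatively compact neighbourhood $U$ of $e$, then $f\in(L^p,\ell^\infty)(K)$. In particular this holds for $f\in L^1(K)$ satisfying the same conditions.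
   Context: A hypergroup (in the sense of Jewett) is a locally compact Hausdorff space $K$ together with a bilinear associative convolution $*$ on the space $M^b(K)$ of bounded Radon measures such that: $\varepsilon_x*\varepsilon_y$ ($\varepsilon_x$ the unit mass at $x$) is a probability measure with compact support; $(x,y)\mapsto\varepsilon_x*\varepsilon_y$ is continuous for the weak topology on probability measures; $(x,y)\mapsto\operatorname{supp}(\varepsilon_x*\varepsilon_y)$ is continuous into the space of nonempty compact subsets with the Michael topology; there is an identity $e$ with $\varepsilon_e*\varepsilon_x=\varepsilon_x*\varepsilon_e=\varepsilon_x$; there is a homeomorphic involution $x\mapsto x^-$ with $(\varepsilon_x*\varepsilon_y)^-=\varepsilon_{y^-}*\varepsilon_{x^-}$; and $e\in\operatorname{supp}(\varepsilon_x*\varepsilon_y)$ iff $x=y^-$. It is commutative if $\varepsilon_x*\varepsilon_y=\varepsilon_y*\varepsilon_x$. Write $f(x*y)=\int f\,d(\varepsilon_x*\varepsilon_y)$ and $\tau_xf(y)=f(x*y)$. $\omega_K$ denotes a Haar measure: $\int \tau_xf\,d\omega_K=\int f\,d\omega_K$ for all $x\in K$, $f\in C_c(K)$. $L^p(K)=L^p(K,\omega_K)$, with $L^\infty$ norm the essential supremum modulo locally null sets. Convolution of functions: $(f*g)(x)=\int f(x*y)g(y^-)\,d\omega_K(y)$. A function $f$ on $K$ is positive definite if it is measurable, locally bounded, and $\sum_{i,j=1}^n c_i\overline{c_j}f(x_i*x_j^-)\ge0$ for all $n\in\mathbb N$, $c_i\in\mathbb C$, $x_i\in K$. $P_b(K)$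 is the set of bounded continuous positive definite functions; $P_b(K)\cdot P_b(K)$ is the set of pointwise products. A locally integrable function $f$ on (commutative, hence unimodular) $K$ is of positive type if $\int f\cdot(g*g^{\sim})\,d\omega_K\ge0$ for every $g\in C_c(K)$, where $g^\sim(x)=\overline{g(x^-)}$. For a relatively compact neighbourhood $U$ of $e$ (taken to be Borel) and $p\in[1,\infty)$, $\|f\|_{p,\infty,U}=\sup_{x\in K}\|f\,(\tau_x\mathbf 1_U)^{1/p}\|_p$; for $p=\infty$, $\|f\|_{\infty,\infty,U}=\sup_{x\in K}\|f\mathbf 1_{U_x}\|_\infty$ with $U_x=\{y:\tau_x\mathbf 1_U(y)>0\}$. $(L^p,\ell^\infty)(K)$ is the space of measurable $f$ with $\|f\|_{p,\infty,U}<\infty$ for some relatively compact neighbourhood $U$ of $e$ (the space does not depend on $U$). *)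

(* Defs.v *)
From HB Require Import structures.
From mathcomp Require Import all_boot all_order all_algebra.
From mathcomp Require Import all_classical all_reals all_analysis.
From mathcomp Require Import complex.

Set Implicit Arguments.
Unset Strict Implicit.
Unset Printing Implicit Defensive.

Import Order.TTheory GRing.Theory Num.Theory.
Import numFieldNormedType.Exports.

Local Open Scope classical_set_scope.
Local Open Scope ring_scope.
Local Open Scope complex_scope.

Local Notation Re := complex.Re.
Local Notation Im := complex.Im.
Local Notation normc := ComplexField.Normc.normc.

(* The library's measurable types are pointed, hence [ptopologicalType]; the
   distinguished point plays no role. *)
Notation borel K := (g_sigma_algebraType (@open K)).

Section Radon.
Context {R : realType} {K : ptopologicalType}.

Definition radon (mu : {measure set (borel K) -> \bar R}) : Prop :=
  [/\ forall C : set K, compact C -> (mu C < +oo)%E,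
      forall A : set (borel K), measurable A ->
        mu A = ereal_inf [set mu U | U in [set U : set K | open U /\ A `<=` U]]
    & forall U : set K, open U ->
        mu U = ereal_sup [set mu C | C in [set C : set K | compact C /\ C `<=` U]]].

Definition msupp (mu : {measure set (borel K) -> \bar R}) : set K :=
  [set x | forall U : set K, open U -> U x -> (0 < mu U)%E].

(* Complex measures are functions [set K -> R[i]] of which only the values on
   Borel sets matter: [meas_eq] is their equality. *)
Definition meas_eq (mu nu : set K -> R[i]) : Prop :=
  forall A : set (borel K), measurable A -> mu A = nu A.

Definition cmeas (mu : set K -> \bar R) : set K -> R[i] :=
  fun A => (fine (mu A))%:C.

(* M^b(K), as the complex linear span of the finite positive Radon measures. *)
Definition bounded_radon (mu : set K -> R[i]) : Prop :=
  exists m1 m2 m3 m4 : {finite_measure set (borel K) -> \bar R},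
    [/\ radon m1, radon m2, radon m3, radon m4 &
        meas_eq mu (fun A => (fine (m1 A) - fine (m2 A)) +i*
                             (fine (m3 A) - fine (m4 A)))].

Definition compact_support {V : nmodType} (f : K -> V) : Prop :=
  compact (closure [set x | f x != 0]).

Definition ccontinuous (f : K -> R[i]) : Prop :=
  continuous (fun x => Re (f x)) /\ continuous (fun x => Im (f x)).

Definition Cc (f : K -> R[i]) : Prop := ccontinuous f /\ compact_support f.

(* Borel measurability, so that f can be integrated against every eps_x * eps_y. *)
Definition cmeasurable (f : K -> R[i]) : Prop :=
  measurable_fun [set: borel K] (fun x : borel K => Re (f x)) /\
  measurable_fun [set: borel K] (fun x : borel K => Im (f x)).

Definition cint (mu : {measure set (borel K) -> \bar R}) (f : K -> R[i]) : R[i] :=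
  (\int[mu]_x Re (f x)) +i* (\int[mu]_x Im (f x)).

End Radon.

(* [hpt x y] is the measure eps_x * eps_y, and [hconv] the convolution of
   M^b(K).  Following Jewett, the convolution of arbitrary bounded measures is
   the canonical extension of that of point masses, i.e.
   mu * nu = \int\int eps_x * eps_y dmu(x) dnu(y) as a weak integral
   ([hconv_int]); bilinearity alone would not tie the two together. *)
Record hypergroup (R : realType) (K : ptopologicalType) := Hypergroup {
  he : K ;
  hinv : K -> K ;
  hconv : (set K -> R[i]) -> (set K -> R[i]) -> set K -> R[i] ;
  hpt : K -> K -> probability (borel K) R ;
  h_hausdorff : hausdorff_space K ;
  h_locally_compact : locally_compact [set: K] ;
  hconv_radon : forall mu nu, bounded_radon mu -> bounded_radon nu ->
    bounded_radon (hconv mu nu) ;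
  hconv_eq : forall mu mu' nu nu',
    bounded_radon mu -> bounded_radon nu ->
    meas_eq mu mu' -> meas_eq nu nu' ->
    meas_eq (hconv mu nu) (hconv mu' nu') ;
  hconv_linearl : forall (a : R[i]) mu mu' nu,
    bounded_radon mu -> bounded_radon mu' -> bounded_radon nu ->
    meas_eq (hconv (fun A => a * mu A + mu' A) nu)
            (fun A => a * hconv mu nu A + hconv mu' nu A) ;
  hconv_linearr : forall (a : R[i]) mu nu nu',
    bounded_radon mu -> bounded_radon nu -> bounded_radon nu' ->
    meas_eq (hconv mu (fun A => a * nu A + nu' A))
            (fun A => a * hconv mu nu A + hconv mu nu' A) ;
  hconvA : forall mu nu rho,
    bounded_radon mu -> bounded_radon nu -> bounded_radon rho ->
    meas_eq (hconv mu (hconv nu rho)) (hconv (hconv mu nu) rho) ;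
  hpt_radon : forall x y, radon (hpt x y) ;
  hpt_conv : forall x y,
    meas_eq (hconv (cmeas (@dirac _ (borel K) x R))
                   (cmeas (@dirac _ (borel K) y R)))
            (cmeas (hpt x y)) ;
  hconv_int : forall m n : {finite_measure set (borel K) -> \bar R},
    radon m -> radon n ->
    exists l : {finite_measure set (borel K) -> \bar R},
      [/\ radon l, meas_eq (hconv (cmeas m) (cmeas n)) (cmeas l) &
          forall f : K -> R, continuous f -> compact_support f ->
            \int[l]_z f z = \int[m]_x \int[n]_y \int[hpt x y]_z f z] ;
  hpt_compact : forall x y, compact (msupp (hpt x y)) ;
  hpt_continuous : forall f : K -> R, continuous f ->
    (exists M : R, forall x, `|f x| <= M) ->
    continuous (fun z : K * K => \int[hpt z.1 z.2]_t f t) ;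
  (* The sets {A | A meets U and A is contained in V}, with U and V open, form
     a subbase of the Michael topology. *)
  hsupp_continuous : forall U V : set K, open U -> open V ->
    open [set z : K * K | msupp (hpt z.1 z.2) `&` U !=set0 /\
                          msupp (hpt z.1 z.2) `<=` V] ;
  hconv1 : forall x, meas_eq (cmeas (hpt x he)) (cmeas (@dirac _ (borel K) x R)) ;
  h1conv : forall x, meas_eq (cmeas (hpt he x)) (cmeas (@dirac _ (borel K) x R)) ;
  hinvK : involutive hinv ;
  hinv_continuous : continuous hinv ;
  hpt_inv : forall x y (A : set (borel K)), measurable A ->
    hpt x y (hinv @^-1` A) = hpt (hinv y) (hinv x) A ;
  h_supp_e : forall x y, msupp (hpt x y) he <-> x = hinv y
}.

Section Functions.
Context {R : realType} {K : ptopologicalType}.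
Variable H : hypergroup R K.
Variable omega : {measure set (borel K) -> \bar R}.
Implicit Types (f g : K -> R[i]) (U : set K) (p : \bar R).

Definition hcommutative : Prop :=
  forall x y, meas_eq (cmeas (hpt H x y)) (cmeas (hpt H y x)).

(* f(x * y) = (tau_x f)(y) *)
Definition translate f (x y : K) : R[i] := cint (hpt H x y) f.

(* (tau_x 1_U)(y), as a real number *)
Definition translate_indic U (x y : K) : R := \int[hpt H x y]_z \1_U z.

Definition haar : Prop :=
  [/\ radon omega, omega [set: K] != 0%E &
      forall (x : K) f, Cc f -> cint omega (translate f x) = cint omega f].

Definition fconv f g (x : K) : R[i] :=
  cint omega (fun y => translate f x y * g (hinv H y)).

Definition tilde f (x : K) : R[i] := (f (hinv H x))^*.

Definition positive_definite f : Prop :=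
  [/\ cmeasurable f,
      forall x : K, exists M : R, \forall y \near x, normc (f y) <= M &
      forall (n : nat) (c : 'I_n -> R[i]) (x : 'I_n -> K),
        0 <= \sum_(i < n) \sum_(j < n)
               c i * (c j)^* * translate f (x i) (hinv H (x j))].

Definition Pb f : Prop :=
  [/\ ccontinuous f, exists M : R, forall x, normc (f x) <= M &
      positive_definite f].

Definition loc_integrable f : Prop :=
  cmeasurable f /\
  forall C : set K, compact C ->
    omega.-integrable C (fun x : borel K => (normc (f x))%:E).

(* In R[i], [0 <= z] means that z is real and nonnegative. *)
Definition positive_type f : Prop :=
  loc_integrable f /\
  forall g, Cc g -> 0 <= cint omega (fun x => f x * fconv g (tilde g) x).

Definition locally_null (A : set (borel K)) : Prop :=
  forall C : set K, compact C -> omega (A `&` C) = 0%E.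

(* The library's ['N_+oo] is modulo null sets rather than locally null ones.
   Only p in [1, +oo] is meaningful, here and below. *)
Definition Lpnorm p f : \bar R :=
  match p with
  | r%:E => 'N[omega]_(r%:E)[(fun x : borel K => (normc (f x))%:E)]
  | _ => ereal_inf (EFin @` [set c : R | 0 <= c /\
                              locally_null [set x | c < normc (f x)]])
  end.

Definition Lp p f : Prop := cmeasurable f /\ (Lpnorm p f < +oo)%E.

Definition rc_nbhd U : Prop :=
  [/\ nbhs (he H) U, measurable (U : set (borel K)) & precompact U].

Definition amalgam_weight p U (x y : K) : R :=
  match p with
  | r%:E => translate_indic U x y `^ r^-1
  | _ => \1_[set z | 0 < translate_indic U x z] y
  end.

Definition amalgam_norm p U f : \bar R :=
  ereal_sup (range (fun x : K =>
    Lpnorm p (fun y => f y * (amalgam_weight p U x y)%:C))).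

(* (L^p, l^oo)(K) *)
Definition amalgam p f : Prop :=
  cmeasurable f /\ exists2 U, rc_nbhd U & (amalgam_norm p U f < +oo)%E.

Definition restr U f : K -> R[i] := fun x => f x * \1_U x.

End Functions.

Definition even_or_infty {R : realType} (p : \bar R) : Prop :=
  (exists n : nat, [/\ (0 < n)%N, ~~ odd n & p = n%:R%:E]) \/ p = +oo%E.

(* C^{1/p}, with the convention C^{1/oo} = 1 *)
Definition root_const {R : realType} (p : \bar R) (C : R) : R :=
  match p with r%:E => C `^ r^-1 | _ => 1 end.

(* Main.v *)
Require Import Defs.
From HB Require Import structures.
From mathcomp Require Import all_boot all_order all_algebra.
From mathcomp Require Import all_classical all_reals all_analysis.
From mathcomp Require Import complex.
From mathcomp Require Import measurable_realfun ring lra.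
Import Order.TTheory GRing.Theory Num.Theory.
Import numFieldNormedType.Exports.
Local Open Scope classical_set_scope.
Local Open Scope ring_scope.

(* Let k = u * u be a symmetric kernel of mass one, supported near e.  If f is of
   positive type and lies in (L^1, l^oo), then F = f * k is bounded, continuous
   and positive definite; by hypothesis so is phi = |F|^p = (F conj(F))^(p/2).
   For phi >= 0 in P_b and h = v * v one has int phi tau_x tau_z h <= 4 int phi h
   for all x and z.  Finitely many translates of h dominate 1_U, whence
   int phi tau_x 1_U <= C int phi h, and Jensen's inequality bounds int phi h by
   a constant times int_U |f|^p when h and k are supported close enough to e.
   Now let k shrink to e: F converges to f in L^1 on compact sets, which carries
   the bound over to the truncations of |f|, then to |f|.
   For p = oo, |F| <= F(e) <= ess sup_U |f|, and F converges to f. *)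

(** * Compactness and Urysohn functions *)

(** Positive definiteness is a pointwise condition and the hypothesis on [Pb] concerns continuous
    functions, whereas [f] is merely measurable and is tested only under integrals; hence the detour
    through [F]. Two kernels are needed: [h] is fixed by [U] alone and yields the constant, while
    [k] shrinks at a rate that depends on [f]. Since convexity costs nothing, the same constant
    serves every even p. Away from [U] nothing is known about |f|^p, so no limit can be taken in
    L^p. The truncated powers min(|f|, N)^p are Lipschitz in |f|, and for them L^1 convergence on
    compact sets suffices. On a hypergroup eps_x * eps_(x^-) need not be the unit mass at e, so the
    classical inequalities for positive definite functions contain an extra term. Both |F| <= F(e)
    and the factor 4 come from bounding that term by a supremum and absorbing it. No countability is
    assumed of K, so omega need not be sigma-finite; double integrals are taken of continuous
    kernels over compact sets. *)

Section topology.
Set Implicit Arguments.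
Unset Strict Implicit.
Unset Printing Implicit Defensive.

(** Compactness as an induction principle. If [P C] failed, the sets [C] minus [A] with [P A] would
    generate a proper filter, and the local hypothesis at a cluster point contradicts it. *)
Lemma compact_set_ind (T : topologicalType) (C : set T) (P : set T -> Prop) :
  compact C -> P set0 ->
  (forall A B, P A -> P B -> P (A `|` B)) ->
  (forall A B, A `<=` B -> P B -> P A) ->
  (forall x, C x -> exists2 U, nbhs x U & P U) -> P C.
Proof.
move=> cC P0 PU PS Ploc; apply: contrapT => nPC.
pose F : set_system T := [set S | exists2 A, P A & C `\` A `<=` S].
have FF : ProperFilter F.
  split.
    move=> [A PA CA]; apply: nPC; apply: PS PA => x Cx.
    by apply: contrapT => nAx; exact: (CA x).
  split; first by exists set0.
    move=> S S' [A PA AS] [B PB BS']; exists (A `|` B); first exact: PU.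
    by move=> x [Cx /not_orP[nA nB]]; split; [exact: AS|exact: BS'].
  by move=> S S' SS' [A PA AS]; exists A => // x /AS /SS'.
have FC : F C by exists set0 => // x [].
have [x [Cx clx]] := cC F FF FC.
have [U nU PU'] := Ploc x Cx.
have FU : F (~` U) by exists U => // y [].
by have [y [nUy Uy]] := clx _ _ FU nU.
Qed.

(** The tube lemma. *)
Lemma nbhs_compact_uniform (X Y : topologicalType) (D : set Y)
    (P : X -> Y -> Prop) (x0 : X) : compact D ->
  (forall y, D y -> \forall z \near (x0, y), P z.1 z.2) ->
  \forall x \near x0, forall y, D y -> P x y.
Proof.
move=> cD HP.
have := (compact_near_coveringP D).1 cD X (nbhs x0) (fun x y => P x y) _.
apply => y Dy; have [[A B] [/= nA nB] AB] := HP y Dy.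
by exists (B, A) => //= -[a b] [/= Ba Ab]; exact: (AB (b, a)).
Qed.

Lemma nbhs_uniform_dist (R : realType) (X Y : topologicalType) (D : set Y)
    (G : X * Y -> R) (x0 : X) (e : R) : 0 < e -> compact D -> continuous G ->
  \forall x \near x0, forall y, D y -> `|G (x, y) - G (x0, y)| <= e.
Proof.
move=> e0 cD cG.
apply: nbhs_compact_uniform => // y Dy.
have e20 : 0 < e / 2 by rewrite divr_gt0.
have /cvgrPdist_lt/(_ _ e20) H1 := cG (x0, y).
have [[A B] [/= nA nB] AB] := H1.
exists (A, B) => //= -[a b] [/= Aa Bb].
have := AB (a, b) (conj Aa Bb); have := AB (x0, b) (conj (nbhs_singleton nA) Bb).
rewrite /= => h1 h2.
rewrite -(subrKA (G (x0, y))) (splitr e) (le_trans (ler_normD _ _))//.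
by rewrite lerD// ltW// distrC.
Qed.

Lemma nbhs_open_ex (T : topologicalType) (x : T) (A : set T) :
  nbhs x A -> exists U, [/\ open U, U x & U `<=` A].
Proof. by rewrite nbhsE => -[U [oU Ux] UA]; exists U. Qed.

Variables (R : realType) (K : topologicalType).
Hypotheses (hK : hausdorff_space K) (lcK : locally_compact [set: K]).

Lemma compact_nbhd_in (x : K) (O : set K) : nbhs x O ->
  exists D, [/\ compact D, nbhs x D & D `<=` O].
Proof.
move=> nO.
have crs := @locally_compact_completely_regular K R lcK hK.
have reg := @completely_regular_regular R K crs.
have [V nV VO] := reg x O nO.
have [W nW] := lcK (I : [set: K] x).
rewrite withinET in nW; move=> [pW _].
exists (closure (V `&` W)); split.
- apply: (subclosed_compact _ pW); first exact: closed_closure.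
  have /closure_id {2}-> := compact_closed hK pW.
  by apply: closureS => y [].
- by apply: filterS (filterI nV nW); exact: subset_closure.
- by apply: subset_trans VO; apply: closureS => y [].
Qed.

Lemma urysohn_point (x : K) (O : set K) : nbhs x O ->
  exists v : K -> R, [/\ continuous v, forall y, 0 <= v y, v x = 1 &
    forall y, v y != 0 -> O y].
Proof.
move=> /nbhs_open_ex[U [oU Ux UO]].
have crs := @locally_compact_completely_regular K R lcK hK.
have /(uniform_separatorP (R:=R)) [f [cf f01 fx fB]] := crs x (~` U) (open_closedC oU) (fun h => h Ux).
exists (fun y => 1 - f y); split.
- by move=> y; apply: cvgB; [exact: cvg_cst|exact: cf].
- move=> y; have : `[0, 1]%classic (f y) by apply: f01; exists y.
  by rewrite /= in_itv/= subr_ge0 => /andP[].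
- have : [set 0] (f x) by apply: fx; exists x.
  by move=> /= ->; rewrite subr0.
- move=> y /eqP h; apply: UO; apply: contrapT => nU; apply: h.
  have /= -> : [set 1] (f y) by apply: fB; exists y.
  by rewrite subrr.
Qed.

(** The support condition is vanishing outside some compact set, which passes to sums and products
    without closures; [Ccr_compact_support] recovers [compact_support]. *)
Definition Ccr (f : K -> R) :=
  continuous f /\ exists2 C, compact C & forall x, f x != 0 -> C x.

Lemma urysohn_compact (C O : set K) : compact C -> open O -> C `<=` O ->
  exists v : K -> R, [/\ continuous v, forall y, 0 <= v y <= 1,
    forall y, C y -> v y = 1 &
    exists D, [/\ compact D, D `<=` O & forall y, v y != 0 -> D y]].
Proof.
move=> cC oO CO.
(* Asking only for [1 <= v] on the compact set makes the condition stable under sums; the minimum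
   with 1 restores the upper bound. *)
suff [v [cv v0 v1 [D [cD DO vD]]]] : exists v : K -> R, [/\ continuous v,
   forall y, 0 <= v y, forall y, C y -> 1 <= v y &
    exists D, [/\ compact D, D `<=` O & forall y, v y != 0 -> D y]].
  exists (fun y => Num.min (v y) 1); split.
  - by move=> y; apply: (@continuous_min _ _ v (cst 1) y); [exact: cv|exact: cvg_cst].
  - by move=> y; rewrite ge_min lexx orbT le_min v0 ler01.
  - by move=> y /v1 h; apply/min_idPr.
  - exists D; split => // y h; apply: vD; apply: contra_neq h => ->.
    by apply/min_idPl.
apply: (@compact_set_ind _ _ (fun A => exists v : K -> R, [/\ continuous v,
   forall y, 0 <= v y, forall y, A y -> 1 <= v y &
   exists D, [/\ compact D, D `<=` O & forall y, v y != 0 -> D y]]) cC).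
- exists (fun=> 0); split => //.
    by move=> y; exact: cvg_cst.
  by exists set0; split => //; [exact: compact0|move=> y; rewrite eqxx].
- move=> A B [v [cv v0 v1 [D [cD DO vD]]]] [w [cw w0 w1 [E [cE EO wE]]]].
  exists (fun y => v y + w y); split.
  + by move=> y; apply: cvgD; [exact: cv|exact: cw].
  + by move=> y; rewrite addr_ge0.
  + move=> y [/v1|/w1] h; first by rewrite (le_trans h)// lerDl.
    by rewrite (le_trans h)// lerDr.
  + exists (D `|` E); split; first exact: compactU.
      by move=> y [/DO|/EO].
    move=> y; have [->|/vD] := eqVneq (v y) 0; last by left.
    by rewrite add0r => /wE; right.
- move=> A B AB [v [cv v0 v1 HD]]; exists v; split => // y /AB; exact: v1.
- move=> x /CO Ox.
  have [D [cD nD DO]] := compact_nbhd_in (open_nbhs_nbhs (conj oO Ox)).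
  have [v [cv v0 vx vD]] := urysohn_point nD.
  exists [set y | 2^-1 < v y].
    have : v y @[y --> x] --> v x by exact: cv.
    rewrite vx => /cvgr_gt; apply; rewrite invf_lt1//; exact: ltr1n.
  exists (fun y => 2 * v y); split.
  + by move=> y; apply: cvgM; [exact: cvg_cst|exact: cv].
  + by move=> y; rewrite mulr_ge0.
  + by move=> y /= /ltW h; rewrite mulrC -ler_pdivrMr// mul1r.
  + exists D; split => // y h; apply: vD; apply: contra_neq h => ->.
    by rewrite mulr0.
Qed.
End topology.

(** * Integration of continuous functions on compact sets *)

Section borel_integration.
Set Implicit Arguments.
Unset Strict Implicit.
Unset Printing Implicit Defensive.

Section general.
Context d {T : measurableType d} {R : realType}.
Variable mu : {measure set T -> \bar R}.

Lemma Rintegral_dist D (f g h : T -> R) : measurable D ->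
  mu.-integrable D (EFin \o f) -> mu.-integrable D (EFin \o g) ->
  mu.-integrable D (EFin \o h) ->
  (forall x, D x -> `|f x - g x| <= h x) ->
  `|\int[mu]_(x in D) f x - \int[mu]_(x in D) g x| <= \int[mu]_(x in D) h x.
Proof.
move=> mD fi gi hi fgh.
rewrite -RintegralB//; apply: le_trans (le_normr_Rintegral mD _) _.
  by have := integrableB mD fi gi.
apply: le_Rintegral => //.
by have := integrable_norm (integrableB mD fi gi : mu.-integrable D (EFin \o (fun x => f x - g x))).
Qed.

Lemma finite_integrable_cst D (c : R) : measurable D -> (mu D < +oo)%E ->
  mu.-integrable D (EFin \o (fun=> c)).
Proof.
move=> mD fD; apply: measurable_bounded_integrable => //.
exists `|c|; split; first exact: num_real.
by move=> x cx y _ /=; exact: ltW.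
Qed.

Lemma RintegrableZ D (c : R) (f : T -> R) : measurable D ->
  mu.-integrable D (EFin \o f) -> mu.-integrable D (EFin \o (fun x => c * f x)).
Proof. by move=> mD fi; exact: (integrableZl mD c fi). Qed.

Lemma RintegrableD D (f g : T -> R) : measurable D ->
  mu.-integrable D (EFin \o f) -> mu.-integrable D (EFin \o g) ->
  mu.-integrable D (EFin \o (fun x => f x + g x)).
Proof. by move=> mD fi gi; exact: (integrableD mD fi gi). Qed.

Lemma RintegrableB D (f g : T -> R) : measurable D ->
  mu.-integrable D (EFin \o f) -> mu.-integrable D (EFin \o g) ->
  mu.-integrable D (EFin \o (fun x => f x - g x)).
Proof. by move=> mD fi gi; exact: (integrableB mD fi gi). Qed.

End general.

Context {R : realType} {K : ptopologicalType}.
Hypothesis hK : hausdorff_space K.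
Implicit Types (mu : {measure set (borel K) -> \bar R}) (f g : K -> R).

Lemma borel_open (U : set K) : open U -> measurable (U : set (borel K)).
Proof. by move=> oU; exact: sub_sigma_algebra. Qed.

Lemma borel_closed (U : set K) : closed U -> measurable (U : set (borel K)).
Proof.
by move=> cU; rewrite -(setCK U); apply: measurableC; apply: borel_open; exact: closed_openC.
Qed.

Lemma borel_compact (U : set K) : compact U -> measurable (U : set (borel K)).
Proof. by move=> cU; apply: borel_closed; exact: compact_closed. Qed.

Lemma continuous_borel f : continuous f -> measurable_fun [set: borel K] (f : borel K -> R).
Proof.
move=> cf; apply: (measurability _ (RGenOInfty.measurableE R)).
move=> _ [_ [r ->] <-]; rewrite setTI; apply: borel_open.
rewrite set_itvE.
apply: open_comp; first by move=> x _; exact: cf.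
exact: open_gt.
Qed.

Lemma compact_continuous_bounded f (D : set K) : continuous f -> compact D ->
  exists2 M : R, 0 <= M & forall x, D x -> `|f x| <= M.
Proof.
move=> cf cD.
have /compact_bounded[M [_ HM]] : compact (f @` D).
  by apply: continuous_compact => //; exact: continuous_subspaceT.
exists (`|M| + 1); first by rewrite addr_ge0.
move=> x Dx; apply: (HM (`|M| + 1)); last by exists x.
by rewrite (le_lt_trans (ler_norm _))// ltrDl.
Qed.

Lemma integrableM_continuous mu (A D : set K) f (a : K -> R) : measurable (A : set (borel K)) ->
  A `<=` D -> compact D -> continuous f -> mu.-integrable A (EFin \o a) ->
  mu.-integrable A (EFin \o (fun x => f x * a x)).
Proof.
move=> mA AD cD cf ai.
have [M M0 fM] := compact_continuous_bounded cf cD.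
have := @integrableMr _ _ _ mu A mA f _ _ _ ai; apply.
  by apply: measurable_funS (continuous_borel cf).
exists M; split; first exact: num_real.
by move=> x /ltW Mx y /AD /fM h; exact: le_trans Mx.
Qed.

Lemma integrable_continuous mu (A D : set K) f : measurable (A : set (borel K)) ->
  A `<=` D -> compact D -> (mu D < +oo)%E -> continuous f ->
  mu.-integrable A (EFin \o f).
Proof.
move=> mA AD cD fD cf.
have : mu.-integrable A (EFin \o (fun x => f x * 1)).
  apply: (@integrableM_continuous mu A D f (fun=> 1)) => //.
  apply: finite_integrable_cst => //; apply: le_lt_trans fD.
  by apply: le_measure => //; rewrite inE//; exact: borel_compact.
by apply: eq_integrable => // x _; rewrite /= mulr1.
Qed.

Lemma continuous_pairl (G : K * K -> R) x : continuous G -> continuous (fun y => G (x, y)).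
Proof. by move=> cG y; apply: (@continuous_comp _ _ _ (fun z => (x, z)) G); [apply: cvg_pair => //; exact: cvg_cst|exact: cG]. Qed.

Lemma continuous_pairr (G : K * K -> R) x : continuous G -> continuous (fun y => G (y, x)).
Proof. by move=> cG y; apply: (@continuous_comp _ _ _ (fun z => (z, x)) G); [apply: cvg_pair => //; exact: cvg_cst|exact: cG]. Qed.

Lemma continuous_Rintegral_param mu (A D : set K) (G : K * K -> R) (a : K -> R) :
  measurable (A : set (borel K)) -> A `<=` D -> compact D -> continuous G ->
  mu.-integrable A (EFin \o a) ->
  continuous (fun x => \int[mu]_(y in A) (G (x, y) * a y)).
Proof.
move=> mA AD cD cG ai x0.
have aabs := integrable_norm ai.
pose N := \int[mu]_(y in A) `|a y|.
have N0 : 0 <= N by apply: Rintegral_ge0.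
apply/cvgrPdist_le => e e0.
(* The added 1 keeps the denominator positive when [N] is zero; the same device recurs below. *)
have e'0 : 0 < e / (N + 1) by rewrite divr_gt0// ltr_wpDl.
have := nbhs_uniform_dist x0 e'0 cD cG.
apply: filterS => x Hx.
have cGx z : continuous (fun y => G (z, y)) by exact: continuous_pairl.
apply: (@le_trans _ _ (\int[mu]_(y in A) (e / (N + 1) * `|a y|))).
  apply: Rintegral_dist => //.
  - exact: integrableM_continuous mA AD cD (cGx _) ai.
  - exact: integrableM_continuous mA AD cD (cGx _) ai.
  - exact: RintegrableZ.
  - move=> y Ay; rewrite -mulrBl normrM ler_wpM2r//.
    by rewrite distrC; apply: Hx; exact: AD.
rewrite RintegralZl// -/N.
rewrite mulrAC ler_pdivrMr ?ltr_wpDl//.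
by rewrite ler_pM2l// lerDl.
Qed.

(* Fubini on a compact rectangle.  The library's theorem does not apply: without
   a countability hypothesis on K, a continuous function on K * K need not be
   measurable for the product of the Borel sigma-algebras. *)
Section fubini.
Variables (m1 m2 : {measure set (borel K) -> \bar R}) (C D : set K).
Variables (G : K * K -> R) (a : K -> R).
Hypotheses (cC : compact C) (cD : compact D) (cG : continuous G).
Hypotheses (m1C : (m1 C < +oo)%E) (ai : m2.-integrable D (EFin \o a)).

Let fubini_gap A := \int[m1]_(x in A) (\int[m2]_(y in D) (G (x, y) * a y)) -
  \int[m2]_(y in D) ((\int[m1]_(x in A) G (x, y)) * a y).

Let N := \int[m2]_(y in D) `|a y|.

Let mD : measurable (D : set (borel K)). Proof. exact: borel_compact. Qed.

Let fubini_fin A : measurable (A : set (borel K)) -> A `<=` C -> (m1 A < +oo)%E.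
Proof.
move=> mA AC; apply: le_lt_trans m1C; apply: le_measure => //; rewrite inE//.
exact: borel_compact.
Qed.

Let fubini_inner A : measurable (A : set (borel K)) -> A `<=` C ->
  continuous (fun y => \int[m1]_(x in A) G (x, y)).
Proof.
move=> mA AC.
have cG' : continuous (fun z : K * K => G (z.2, z.1)).
  by move=> z; apply: (@continuous_comp _ _ _ (fun z : K * K => (z.2, z.1)) G);
    [apply: cvg_pair; [exact: cvg_snd|exact: cvg_fst]|exact: cG].
have := @continuous_Rintegral_param m1 A C _ (fun=> 1) mA AC cC cG' _.
have H := finite_integrable_cst (1 : R) mA (fubini_fin mA AC).
move=> /(_ H) H1 y; have := H1 y.
rewrite (_ : (fun x : K => _) = fun y => \int[m1]_(x in A) G (x, y))//.
by apply/funext => z; apply: eq_Rintegral => t _ /=; rewrite mulr1.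
Qed.

Let fubini_outer : continuous (fun x => \int[m2]_(y in D) (G (x, y) * a y)).
Proof. exact: (@continuous_Rintegral_param m2 D D G a). Qed.

Let fubini_iG x : m2.-integrable D (EFin \o (fun y => G (x, y) * a y)).
Proof. by apply: (@integrableM_continuous m2 D D) => //; exact: continuous_pairl. Qed.

Let fubini_iI A : measurable (A : set (borel K)) -> A `<=` C ->
  m2.-integrable D (EFin \o (fun y => (\int[m1]_(x in A) G (x, y)) * a y)).
Proof. by move=> mA AC; apply: (@integrableM_continuous m2 D D) => //; exact: fubini_inner. Qed.

(** Where [G (z, y)] stays within [e] of [G (x, y)] for all [y] in [D], freezing the first variable
    at [x] changes either iterated integral by at most [e * N * m1 A]. *)
Let fubini_local (e : R) (x : K) : 0 < e -> exists2 U : set K, nbhs x U &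
  forall A, measurable (A : set (borel K)) -> A `<=` C -> A `<=` U ->
  `|fubini_gap A| <= (e + e) * N * fine (m1 A).
Proof.
move=> e0; have HU := nbhs_uniform_dist x e0 cD cG.
eexists; first exact: HU.
move=> A mA AC AU.
have aN := integrable_norm ai.
pose I x := \int[m2]_(y in D) (G (x, y) * a y).
have A1 : `|\int[m1]_(x in A) I x - I x * fine (m1 A)| <= e * N * fine (m1 A).
  rewrite -!Rintegral_cst//; apply: Rintegral_dist => //.
  - by apply: (integrable_continuous mA AC) => //.
  - exact/finite_integrable_cst/fubini_fin.
  - exact/finite_integrable_cst/fubini_fin.
  move=> z /AU Hz; rewrite /I.
  apply: le_trans (_ : \int[m2]_(y in D) (e * `|a y|) <= _); last by rewrite RintegralZl.
  apply: Rintegral_dist => //; first exact: RintegrableZ.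
  by move=> y Dy; rewrite -mulrBl normrM ler_wpM2r// Hz.
have A2 : `|I x * fine (m1 A) - \int[m2]_(y in D) ((\int[m1]_(x in A) G (x, y)) * a y)|
    <= e * N * fine (m1 A).
  rewrite mulrC -RintegralZl// (mulrAC e) -RintegralZl//; apply: Rintegral_dist => //.
  - exact: RintegrableZ.
  - exact: fubini_iI.
  - exact: RintegrableZ.
  move=> y Dy; rewrite mulrA -mulrBl normrM ler_wpM2r//.
  rewrite mulrC distrC -!Rintegral_cst//; apply: Rintegral_dist => //.
  - by apply: (integrable_continuous mA AC) => //; exact: continuous_pairr.
  - exact/finite_integrable_cst/fubini_fin.
  - exact/finite_integrable_cst/fubini_fin.
  by move=> z /AU Hz; exact: Hz.
rewrite /fubini_gap -(subrKA (I x * fine (m1 A))).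
by rewrite !mulrDl (le_trans (ler_normD _ _))// lerD.
Qed.

Lemma fubini_compact : \int[m1]_(x in C) (\int[m2]_(y in D) (G (x, y) * a y)) =
  \int[m2]_(y in D) ((\int[m1]_(x in C) G (x, y)) * a y).
Proof.
apply/eqP; rewrite -subr_eq0 -normr_le0; apply/ler_addgt0Pl => e e0.
rewrite addr0.
have mC : measurable (C : set (borel K)) by exact: borel_compact.
have N0 : 0 <= N by rewrite /N; apply: Rintegral_ge0.
have k0 : 0 < N * fine (m1 C) + 1 by rewrite ltr_wpDl// mulr_ge0// fine_ge0.
pose e' := e / 2 / (N * fine (m1 C) + 1).
have e'0 : 0 < e' by rewrite !divr_gt0.
suff : `|fubini_gap C| <= (e' + e') * N * fine (m1 C).
  move=> /le_trans; apply; rewrite /e' -mulrDl -splitr -mulrA mulrAC.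
  by rewrite ler_pdivrMr// ler_pM2l// lerDl.
(* The bound is additive in the set, as is the gap. Quantifying over all measurable subsets lets a
   subset of a union be cut into two disjoint pieces, each covered by one of the two bounds. *)
pose P (U : set K) := forall A, measurable (A : set (borel K)) -> A `<=` C ->
  A `<=` U -> `|fubini_gap A| <= (e' + e') * N * fine (m1 A).
suff [V [mV CV]] : exists V, [/\ measurable (V : set (borel K)), C `<=` V & P V] by apply.
apply: (@compact_set_ind K C (fun U => exists V, [/\ measurable (V : set (borel K)),
  U `<=` V & P V])) => //.
- exists set0; split => // A _ _; rewrite subset0 => ->.
  rewrite /fubini_gap Rintegral_set0 measure0/= mulr0.
  under eq_Rintegral do rewrite Rintegral_set0 mul0r.
  by rewrite Rintegral_cst// mul0r subr0 normr0.
- move=> X Y [A [mA XA PA]] [B [mB YB PB]]; exists (A `|` B); split.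
  + exact: measurableU.
  + by move=> x [/XA|/YB]; [left|right].
  move=> U mU UC UAB.
  have mUA : measurable (U `&` A : set (borel K)) by exact: measurableI.
  have mUB : measurable (U `\` A : set (borel K)) by exact: measurableD.
  have UAC : U `&` A `<=` C by move=> x [/UC].
  have UBC : U `\` A `<=` C by move=> x [/UC].
  have := PA _ mUA UAC (fun x h => h.2).
  have UBB : U `\` A `<=` B by move=> x [/UAB[]].
  move=> hA; have hB := PB _ mUB UBC UBB.
  have dis : [disjoint U `&` A & U `\` A].
    by rewrite disj_set2E; apply/eqP; rewrite -subset0 => x [[_ ?] []].
  have Ueq : U = (U `&` A) `|` (U `\` A) by rewrite setUIDK.
  have split1 (m : {measure set (borel K) -> \bar R}) g : m.-integrable U (EFin \o g) ->
      \int[m]_(x in U) g x = \int[m]_(x in U `&` A) g x + \int[m]_(x in U `\` A) g x.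
    by move=> gi; rewrite {1}Ueq Rintegral_setU// -Ueq.
  have -> : fubini_gap U = fubini_gap (U `&` A) + fubini_gap (U `\` A).
    rewrite /fubini_gap split1; last exact: (integrable_continuous mU UC).
    have -> : \int[m2]_(y in D) (\int[m1]_(x in U) G (x, y) * a y) =
       \int[m2]_(y in D) (\int[m1]_(x in U `&` A) G (x, y) * a y) +
       \int[m2]_(y in D) (\int[m1]_(x in U `\` A) G (x, y) * a y).
      rewrite -RintegralD//; [|exact: fubini_iI|exact: fubini_iI].
      apply: eq_Rintegral => y _; rewrite -mulrDl split1//.
      by apply: (integrable_continuous mU UC) => //; exact: continuous_pairr.
    by rewrite opprD addrACA.
  have -> : fine (m1 U) = fine (m1 (U `&` A)) + fine (m1 (U `\` A)).
    rewrite {1}Ueq measureU//; last by apply/eqP; rewrite -disj_set2E.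
    by rewrite fineD// ge0_fin_numE//; exact: fubini_fin.
  by rewrite mulrDr (le_trans (ler_normD _ _))// lerD.
- by move=> A B AB [V [mV BV PV]]; exists V; split => //; exact: subset_trans BV.
- move=> x _; have [U nU HU] := fubini_local x e'0.
  have [V [oV Vx VU]] := nbhs_open_ex nU.
  exists V; first exact: open_nbhs_nbhs.
  exists V; split => //; first exact: borel_open.
  by move=> A mA AC AV; apply: HU => //; exact: subset_trans VU.
Qed.
End fubini.
End borel_integration.

(** * Radon measures *)

Section radon_measures.
Set Implicit Arguments.
Unset Strict Implicit.
Unset Printing Implicit Defensive.

Section support.
Context d {T : measurableType d} {R : realType}.
Variable mu : {measure set T -> \bar R}.

Lemma Rintegral_supported (D : set T) (f : T -> R) :
  (forall x, f x != 0 -> D x) -> \int[mu]_x f x = \int[mu]_(x in D) f x.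
Proof.
move=> fD; rewrite [RHS]Rintegral_mkcond; apply: eq_Rintegral => x _.
rewrite patchE; case: ifPn => // /negP nD; apply/eqP; apply/negPn/negP => h.
by apply: nD; rewrite inE; exact: fD.
Qed.

Lemma integrable_supported (D : set T) (f : T -> R) : measurable D ->
  (forall x, f x != 0 -> D x) -> mu.-integrable D (EFin \o f) ->
  mu.-integrable setT (EFin \o f).
Proof.
move=> mD fD /(integrable_mkcond _ mD).1; apply: eq_integrable => // x _.
rewrite patchE; case: ifPn => // /negP nD.
rewrite /=; have [-> //|/fD Dx] := eqVneq (f x) 0.
by exfalso; apply: nD; rewrite inE.
Qed.

Lemma integrable_conull (D : set T) (f : T -> R) : measurable D -> mu (~` D) = 0%E ->
  measurable_fun setT f -> mu.-integrable D (EFin \o f) -> mu.-integrable setT (EFin \o f).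
Proof.
move=> mD D0 mf fi; apply/(@negligible_integrable _ _ _ mu setT (~` D)) => //.
- exact: measurableC.
- exact/measurable_EFinP.
- by rewrite setTD setCK.
Qed.

Lemma Rintegral_conull (D : set T) (f : T -> R) : measurable D -> mu (~` D) = 0%E ->
  measurable_fun setT f -> mu.-integrable D (EFin \o f) ->
  \int[mu]_x f x = \int[mu]_(x in D) f x.
Proof.
move=> mD D0 mf fi; rewrite /Rintegral (@negligible_integral _ _ _ mu setT (~` D)) //.
- by rewrite setTD setCK.
- exact: measurableC.
- exact: (@integrable_conull D f).
Qed.

Lemma Rintegral_gt0 (U : set T) (f : T -> R) (c : R) : measurable U -> 0 < c ->
  (forall x, 0 <= f x) -> (forall x, U x -> c <= f x) -> (0 < mu U)%E ->
  mu.-integrable setT (EFin \o f) -> 0 < \int[mu]_x f x.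
Proof.
move=> mU c0 f0 fc U0 fi; apply: fine_gt0; apply/andP; split; last exact: integrable_lty.
have mf := measurable_int _ fi.
apply: (@lt_le_trans _ _ (c%:E * mu U)%E); first exact: mule_gt0.
rewrite -integral_cst//.
apply: le_trans (_ : \int[mu]_(x in U) (f x)%:E <= _)%E.
  apply: ge0_le_integral => //.
  - by move=> x _; rewrite lee_fin ltW.
  - by apply: measurable_funTS.
by apply: ge0_subset_integral => // x _; rewrite lee_fin.
Qed.
End support.

Context {R : realType} {K : ptopologicalType}.
Hypothesis hK : hausdorff_space K.
Implicit Types (mu : {measure set (borel K) -> \bar R}) (f g : K -> R).

Lemma radon_ltoo mu (C : set K) : radon mu -> compact C -> (mu C < +oo)%E.
Proof. by move=> [h _ _]; exact: h. Qed.

Lemma msupp_open mu : open (~` msupp mu).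
Proof.
rewrite openE => x /existsNP[U /not_implyP[oU /not_implyP[Ux nU]]].
rewrite /interior nbhsE; exists U => //.
by move=> y Uy hy; apply: nU; exact: hy.
Qed.

(** Inner regularity on the open complement reduces the claim to compact subsets, and finitely many
    open null sets cover each of those. *)
Lemma msupp_null mu : radon mu -> mu (~` msupp mu) = 0%E.
Proof.
move=> [_ _ inner]; rewrite inner; last exact: msupp_open.
apply/eqP; rewrite eq_le; apply/andP; split; last first.
  by apply: ereal_sup_ubound; exists set0 => //; split => //; exact: compact0.
apply: ge_ereal_sup => _ [C [cC CS] <-].
suff [V [oV CV V0]] : exists V : set K, [/\ open V, C `<=` V & mu V = 0%E].
  rewrite -V0; apply: le_measure => //; rewrite inE; last exact: borel_open.
  exact: borel_compact.
apply: (@compact_set_ind K C (fun A => exists V : set K, [/\ open V, A `<=` V & mu V = 0%E])) => //.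
- by exists set0; split => //; exact: open0.
- move=> A B [V [oV AV V0]] [W [oW BW W0]]; exists (V `|` W); split => //.
  + exact: openU.
  + exact: setUSS.
  + have VW : (mu V + mu W)%E = 0%E by rewrite V0 W0 adde0.
    by apply/eqP; rewrite -measure_le0 -VW; apply: measureU2; exact: borel_open.
- by move=> A B AB [V [oV BV V0]]; exists V; split => //; exact: subset_trans BV.
- move=> x /CS /existsNP[U /not_implyP[oU /not_implyP[Ux nU]]].
  exists U; first exact: open_nbhs_nbhs.
  exists U; split => //; apply/eqP; rewrite -measure_le0 leNgt; exact/negP.
Qed.

Lemma Ccr_integrable mu f : radon mu -> Ccr f -> mu.-integrable setT (EFin \o f).
Proof.
move=> rmu [cf [C cC fC]]; apply: (@integrable_supported _ _ _ mu C f) => //.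
  exact: borel_compact.
by apply: (integrable_continuous hK _ _ cC) => //; [exact: borel_compact|exact: radon_ltoo].
Qed.

Lemma Ccr_bounded f : Ccr f -> exists2 M : R, 0 <= M & forall x, `|f x| <= M.
Proof.
move=> [cf [C cC fC]]; have [M M0 fM] := compact_continuous_bounded cf cC.
exists M => // x; have [->|/fC] := eqVneq (f x) 0; first by rewrite normr0.
exact: fM.
Qed.

Lemma CcrD f g : Ccr f -> Ccr g -> Ccr (fun x => f x + g x).
Proof.
move=> [cf [C cC fC]] [cg [D cD gD]]; split.
  by move=> x; apply: cvgD; [exact: cf|exact: cg].
exists (C `|` D); first exact: compactU.
move=> x; have [->|/fC] := eqVneq (f x) 0; last by left.
by rewrite add0r => /gD; right.
Qed.

Lemma CcrM f g : Ccr f -> continuous g -> Ccr (fun x => g x * f x).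
Proof.
move=> [cf [C cC fC]] cg; split.
  by move=> x; apply: cvgM; [exact: cg|exact: cf].
exists C => // x; have [->|/fC //] := eqVneq (f x) 0.
by rewrite mulr0 eqxx.
Qed.

Lemma CcrZ c f : Ccr f -> Ccr (fun x => c * f x).
Proof. by move=> /CcrM; apply; exact: cst_continuous. Qed.

Lemma CcrB f g : Ccr f -> Ccr g -> Ccr (fun x => f x - g x).
Proof.
move=> cf /(CcrZ (-1)) cg; have := CcrD cf cg.
by under eq_fun do rewrite mulN1r.
Qed.
End radon_measures.

(** * Translation *)

Section hypergroup_calculus.
Set Implicit Arguments.
Unset Strict Implicit.
Unset Printing Implicit Defensive.
Context {R : realType} {K : ptopologicalType}.
Variable H : hypergroup R K.
Hypothesis Hcomm : hcommutative H.
Implicit Types (f g : K -> R) (x y z : K).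

Local Notation hK := (h_hausdorff H).
Local Notation lcK := (h_locally_compact H).
Local Notation P := (hpt H).
Local Notation S x y := (msupp (hpt H x y)).
Local Notation inv := (hinv H).
Local Notation e := (he H).

(* The paper's f(x * y), for a real-valued f. *)
Definition tau f x y : R := \int[P x y]_z f z.

Lemma fine_inj (a b : \bar R) : a \is a fin_num -> b \is a fin_num -> fine a = fine b -> a = b.
Proof. by case: a b => [a| |] [b| |] //= _ _ ->. Qed.

Lemma supp_compact x y : compact (S x y).
Proof. exact: hpt_compact. Qed.
Arguments supp_compact : clear implicits.

Lemma hpt_supp_null x y (D : set K) : S x y `<=` D -> measurable (D : set (borel K)) ->
  P x y (~` D) = 0%E.
Proof.
move=> SD mD; apply/eqP; rewrite -measure_le0 -(msupp_null hK (hpt_radon H x y)).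
apply: le_measure; rewrite ?inE; last exact: subsetC.
- exact: measurableC.
- by apply: borel_open; exact: msupp_open.
Qed.

Lemma hpt_ltoo x y (D : set K) : measurable (D : set (borel K)) -> (P x y D < +oo)%E.
Proof. by move=> mD; apply: le_lt_trans (probability_le1 _ _) _ => //; rewrite ltry. Qed.

Lemma hpt_fine1 x y (D : set K) : S x y `<=` D -> measurable (D : set (borel K)) ->
  P x y D = 1%E.
Proof.
move=> SD mD; have := hpt_supp_null SD mD; rewrite probability_setC//.
move=> h; have : P x y D \is a fin_num by rewrite ge0_fin_numE// hpt_ltoo.
move=> /fineK Pe; move: h; rewrite -Pe -EFinB => -[] /eqP; rewrite subr_eq0 => /eqP <- //.
Qed.

(** No bound on [f] is required, because the measure lives on its compact support. *)
Lemma hpt_integrable f x y : continuous f -> (P x y).-integrable setT (EFin \o f).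
Proof.
move=> cf; have cS := supp_compact x y.
apply: (@integrable_conull _ _ _ (P x y) (S x y) f).
- exact: (borel_compact hK).
- by apply: hpt_supp_null => //; exact: (borel_compact hK).
- exact: continuous_borel.
- by apply: (integrable_continuous hK _ _ cS) => //; [exact: (borel_compact hK)|apply: hpt_ltoo; exact: (borel_compact hK)].
Qed.

Lemma tau_supp f x y (D : set K) : continuous f -> compact D -> S x y `<=` D ->
  tau f x y = \int[P x y]_(z in D) f z.
Proof.
move=> cf cD SD; apply: Rintegral_conull.
- exact: (borel_compact hK).
- by apply: hpt_supp_null => //; exact: (borel_compact hK).
- exact: continuous_borel.
- by apply: (integrable_continuous hK _ _ cD) => //; [exact: (borel_compact hK)|apply: hpt_ltoo; exact: (borel_compact hK)].
Qed.

Lemma eq_tau f g x y : continuous f -> continuous g -> (forall z, S x y z -> f z = g z) ->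
  tau f x y = tau g x y.
Proof.
move=> cf cg fg; have cS := supp_compact x y.
rewrite !(@tau_supp _ x y (S x y))//; apply: eq_Rintegral => z /[!inE]; exact: fg.
Qed.

Lemma tauD f g x y : continuous f -> continuous g ->
  tau (fun z => f z + g z) x y = tau f x y + tau g x y.
Proof. by move=> cf cg; rewrite /tau RintegralD//; exact: hpt_integrable. Qed.

Lemma tauB f g x y : continuous f -> continuous g ->
  tau (fun z => f z - g z) x y = tau f x y - tau g x y.
Proof. by move=> cf cg; rewrite /tau RintegralB//; exact: hpt_integrable. Qed.

Lemma tauZ c f x y : continuous f -> tau (fun z => c * f z) x y = c * tau f x y.
Proof. by move=> cf; rewrite /tau RintegralZl//; exact: hpt_integrable. Qed.

Lemma tau_cst c x y : tau (fun=> c) x y = c.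
Proof. by rewrite /tau Rintegral_cst//= (hpt_fine1 (@subsetT _ _))// mulr1. Qed.

Lemma tau_ge0 f x y : (forall z, 0 <= f z) -> 0 <= tau f x y.
Proof. by move=> f0; apply: Rintegral_ge0. Qed.

Lemma tau_dist f g c x y : continuous f -> continuous g ->
  (forall z, S x y z -> `|f z - g z| <= c) -> `|tau f x y - tau g x y| <= c.
Proof.
move=> cf cg fgc; have cS := supp_compact x y.
have mS := borel_compact hK cS.
rewrite !(@tau_supp _ x y (S x y))//.
have -> : c = \int[P x y]_(z in S x y) c.
  by rewrite Rintegral_cst//= hpt_fine1// mulr1.
apply: Rintegral_dist => //.
- by apply: (integrable_continuous hK _ _ cS) => //; exact: hpt_ltoo.
- by apply: (integrable_continuous hK _ _ cS) => //; exact: hpt_ltoo.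
- by apply: finite_integrable_cst => //; exact: hpt_ltoo.
Qed.

Lemma le_tau f g x y : continuous f -> continuous g -> (forall z, f z <= g z) ->
  tau f x y <= tau g x y.
Proof. by move=> cf cg fg; apply: le_Rintegral => //; exact: hpt_integrable. Qed.

Lemma tau_le_cst f c x y : continuous f -> (forall z, f z <= c) -> tau f x y <= c.
Proof.
by move=> cf fc; rewrite -[leRHS](tau_cst c x y); apply: le_tau => //; exact: cst_continuous.
Qed.

Lemma hpt_comm x y (A : set (borel K)) : measurable A -> P x y A = P y x A.
Proof.
move=> mA; have [] := Hcomm x y mA.
have fin u v : P u v A \is a fin_num by rewrite ge0_fin_numE// hpt_ltoo.
by move=> h; apply: fine_inj h; exact: fin.
Qed.

Lemma tau_comm f x y : tau f x y = tau f y x.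
Proof.
rewrite /tau /Rintegral; congr fine; apply: eq_measure_integral => A mA _.
exact: hpt_comm.
Qed.

Lemma hpt_e_dirac x (A : set (borel K)) : measurable A -> P x e A = @dirac _ (borel K) x R A.
Proof.
move=> mA; have [] := hconv1 H x mA.
have fin : P x e A \is a fin_num by rewrite ge0_fin_numE// hpt_ltoo.
by move=> h; apply: fine_inj => //; rewrite diracE.
Qed.

Lemma tau_e f x : continuous f -> tau f x e = f x.
Proof.
move=> cf; rewrite /tau /Rintegral (@eq_measure_integral _ _ _ _ (@dirac _ (borel K) x R)).
  rewrite integral_dirac//; last by apply/measurable_EFinP; exact: continuous_borel.
  by rewrite diracT mul1e.
by move=> A mA _; exact: hpt_e_dirac.
Qed.

Lemma tau_inv f x y : continuous f -> tau (f \o inv) x y = tau f (inv y) (inv x).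
Proof.
move=> cf; have minv : measurable_fun [set: borel K] (inv : borel K -> borel K).
  apply: (measurability _ (erefl : (@open K).-sigma.-measurable = _)).
  move=> _ [U oU <-]; rewrite setTI; apply: borel_open.
  by apply: open_comp => // z _; exact: hinv_continuous.
rewrite /tau /Rintegral; congr fine.
have mf : measurable_fun [set: borel K] (EFin \o (f : borel K -> R)).
  by apply/measurable_EFinP; exact: continuous_borel.
have cfi : continuous (f \o inv).
  by move=> z; apply: continuous_comp; [exact: hinv_continuous|exact: cf].
have := @integral_pushforward _ _ (borel K) (borel K) R inv minv (P x y) setT
  (EFin \o f) mf (hpt_integrable x y cfi) measurableT.
rewrite preimage_setT => <-; apply: eq_measure_integral => A mA _.
exact: hpt_inv.
Qed.

(** Not an axiom: eps_e * eps_e is the unit mass at [e], so [e] lies in its support and the support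
    axiom applies. *)
Lemma inv_e : inv e = e.
Proof.
have /h_supp_e h : S e e e; last by rewrite -h.
move=> U oU Ue.
suff : (0 < @dirac _ (borel K) e R U)%E by rewrite -(hpt_e_dirac e (borel_open oU)).
by rewrite diracE mem_set.
Qed.

Lemma supp_invl x : S (inv x) x e.
Proof. exact/h_supp_e. Qed.

Lemma continuous_tau f : continuous f -> (exists M, forall x, `|f x| <= M) ->
  continuous (fun z : K * K => tau f z.1 z.2).
Proof. exact: hpt_continuous. Qed.

(** * Point masses and associativity *)

Lemma Ccr_compact_support f : Ccr f -> compact_support f.
Proof.
move=> [cf [C cC fC]]; apply: (subclosed_compact _ cC); first exact: closed_closure.
have /closure_id -> := compact_closed hK cC.
by apply: closureS => y; exact: fC.
Qed.

Lemma radon_mzero : radon (@mzero _ (borel K) R : {measure set (borel K) -> \bar R}).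
Proof.
split.
- by move=> C _; rewrite /mzero ltry.
- move=> A mA; apply/eqP; rewrite eq_le; apply/andP; split.
    by apply: le_ereal_inf_tmp => _ [U _ <-].
  by apply: ereal_inf_lbound; exists setT => //; split => //; exact: openT.
- move=> U oU; apply/eqP; rewrite eq_le; apply/andP; split.
    by apply: ereal_sup_ubound; exists set0 => //; split => //; exact: compact0.
  by apply: ge_ereal_sup => _ [C _ <-].
Qed.

Let borel_diracE x (A : set K) :
  (@dirac _ (borel K) x R : {measure set (borel K) -> \bar R}) A = (x \in A)%:R%:E.
Proof. exact: (@diracE _ (borel K) R x A). Qed.

Lemma Rintegral_dirac (f : K -> R) x : continuous f ->
  \int[(@dirac _ (borel K) x R : {measure set (borel K) -> \bar R})]_t f t = f x.
Proof.
move=> cf; have mf : measurable_fun [set: borel K] (EFin \o (f : borel K -> R)).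
  by apply/measurable_EFinP; exact: continuous_borel.
rewrite /Rintegral (@integral_dirac _ (borel K) x R setT measurableT _ mf).
by rewrite diracT mul1e.
Qed.
Arguments Rintegral_dirac [f] x _.

Lemma radon_dirac x : radon (@dirac _ (borel K) x R : {measure set (borel K) -> \bar R}).
Proof.
split.
- by move=> C _; rewrite borel_diracE ltry.
- move=> A mA; apply/eqP; rewrite eq_le; apply/andP; split.
    apply: le_ereal_inf_tmp => _ [U [oU AU] <-]; rewrite !borel_diracE lee_fin ler_nat.
    by case: (boolP (x \in A)) => // /set_mem/AU/mem_set ->.
  rewrite borel_diracE; case: (boolP (x \in A)) => xA.
    apply: le_trans (_ : (((@dirac _ (borel K) x R : {measure set (borel K) -> \bar R}) [set: K] <= _)%E)); last by rewrite borel_diracE in_setT.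
    by apply: ereal_inf_lbound; exists setT => //; split => //; exact: openT.
  apply: ereal_inf_lbound; exists (~` [set x]).
    split; first by apply: closed_openC; exact: (accessible_closed_set1 (hausdorff_accessible hK)).
    by move=> y Ay yx; move/negP: xA; apply; rewrite -yx; exact: mem_set.
  by rewrite borel_diracE memNset//; exact.
- move=> U oU; apply/eqP; rewrite eq_le; apply/andP; split.
    rewrite borel_diracE; case: (boolP (x \in U)) => xU.
      apply: ereal_sup_ubound; exists [set x]; last by rewrite borel_diracE mem_set.
      by split; [exact: compact_set1|move=> _ ->; exact: set_mem].
    apply: ereal_sup_ubound; exists set0; last by rewrite borel_diracE in_set0.
    by split => //; exact: compact0.
  apply: ge_ereal_sup => _ [C [cC CU] <-].
  rewrite !borel_diracE lee_fin ler_nat.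
  by case: (boolP (x \in C)) => // /set_mem/CU/mem_set ->.
Qed.

Lemma bounded_radon_cmeas (m : {finite_measure set (borel K) -> \bar R}) :
  radon m -> bounded_radon (cmeas m).
Proof.
move=> rm; pose z : {finite_measure set (borel K) -> \bar R} := @mzero _ (borel K) R.
exists m, z, z, z; split => //; try exact: radon_mzero.
by move=> A mA; rewrite /cmeas /z /mzero/= !subr0.
Qed.

Lemma continuous_tau1 f x : Ccr f -> continuous (tau f x).
Proof.
move=> cf; have [M M0 fM] := Ccr_bounded cf.
have cG : continuous (fun z : K * K => tau f z.1 z.2).
  by apply: continuous_tau; [case: cf|exists M].
exact: (continuous_pairl cG).
Qed.

Lemma continuous_tau2 f y z : Ccr f -> continuous (fun x => tau (tau f x) y z).
Proof.
move=> cf; have [M M0 fM] := Ccr_bounded cf.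
pose G (w : K * K) := tau f w.1 w.2.
have ct : continuous G.
  by apply: continuous_tau; [case: cf|exists M].
have cS := supp_compact y z; have mS := borel_compact hK cS.
have -> : (fun x => tau (tau f x) y z) =
    fun x => \int[P y z]_(t in S y z) (G (x, t) * (fun=> 1) t).
  apply/funext => x; rewrite (@tau_supp _ y z (S y z))//; last exact: continuous_tau1.
  by apply: eq_Rintegral => t _; rewrite mulr1.
have i1 : (P y z).-integrable (S y z) (EFin \o (fun=> 1)).
  by apply: finite_integrable_cst => //; exact: hpt_ltoo.
exact: (continuous_Rintegral_param mS (@subset_refl _ _) cS ct i1).
Qed.

(** The associativity axiom concerns the abstract convolution of bounded measures. [hconv_int]
    represents the two bracketings of eps_x * eps_y * eps_z by measures [l1] and [l2], which
    therefore agree on Borel sets; integrating [f] against them gives the two sides, up to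
    commutativity on the right. *)
Lemma tau_assoc f x y z : Ccr f -> tau (tau f x) y z = tau (tau f z) x y.
Proof.
move=> cf; have [cf1 _] := cf; have sf := Ccr_compact_support cf.
pose dx u : {finite_measure set (borel K) -> \bar R} := @dirac _ (borel K) u R.
pose Q u v : {finite_measure set (borel K) -> \bar R} := P u v.
have rd u : radon (dx u) by exact: radon_dirac.
have rQ u v : radon (Q u v) by exact: hpt_radon.
have [l1 [rl1 l1E /(_ f cf1 sf) l1I]] := hconv_int H (rd x) (rQ y z).
have [l2 [rl2 l2E /(_ f cf1 sf) l2I]] := hconv_int H (rQ x y) (rd z).
have bd u : bounded_radon (cmeas (dx u)) by exact: bounded_radon_cmeas.
have bQ u v : bounded_radon (cmeas (Q u v)) by exact: bounded_radon_cmeas.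
have bdd u v : bounded_radon (hconv H (cmeas (dx u)) (cmeas (dx v))) by exact: hconv_radon.
have refl (mu : set K -> R[i]) : meas_eq mu mu by move=> ?.
have l12 (A : set (borel K)) : measurable A -> l1 A = l2 A.
  move=> mA.
  have h : cmeas l1 A = cmeas l2 A.
    rewrite -l1E// -(hconv_eq H (bd x) (bdd y z) (refl _) (@hpt_conv _ _ H y z))//.
    rewrite (hconvA H (bd x) (bd y) (bd z))//.
    by rewrite (hconv_eq H (bdd x y) (bd z) (@hpt_conv _ _ H x y) (refl _))// l2E.
  have [h'] := h.
  by apply: fine_inj h'; exact: fin_num_measure.
have E : \int[l1]_t f t = \int[l2]_t f t.
  by rewrite /Rintegral (@eq_measure_integral _ _ _ _ l2)// => A mA _; exact: l12.
have E1 : \int[l1]_t f t = tau (tau f x) y z.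
  by rewrite l1I; exact: (Rintegral_dirac x (@continuous_tau2 f y z cf)).
have E2 : \int[l2]_t f t = tau (tau f z) x y.
  rewrite l2I; apply: eq_Rintegral => t _.
  by rewrite tau_comm; exact: (Rintegral_dirac z (@continuous_tau1 f t cf)).
by rewrite -E1 E E2.
Qed.

(** * Supports *)

Lemma tau_gt0 f x y z : continuous f -> (forall t, 0 <= f t) -> S x y z -> 0 < f z ->
  0 < tau f x y.
Proof.
move=> cf f0 Sz fz.
have oU : open [set t | f z / 2 < f t] by apply: (@open_comp _ _ f [set r | f z / 2 < r]); [move=> t _; exact: cf|exact: open_gt].
apply: (@Rintegral_gt0 _ (borel K) R (P x y) [set t | f z / 2 < f t] f (f z / 2)) => //.
- exact: borel_open.
- by rewrite divr_gt0.
- by move=> t /= /ltW.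
- by apply: Sz => //=; rewrite ltr_pdivrMr// ltr_pMr// ltr1n.
- exact: hpt_integrable.
Qed.

Lemma Ccr_urysohn (x : K) (V : set K) : nbhs x V ->
  exists f, [/\ Ccr f, forall y, 0 <= f y, f x = 1 & forall y, f y != 0 -> V y].
Proof.
move=> /nbhs_open_ex[U [oU Ux UV]].
have [|v [cv v01 v1 [D [cD DU vD]]]] := urysohn_compact R hK lcK (@compact_set1 _ x) oU.
  by move=> _ ->.
exists v; split => //.
- by split => //; exists D.
- by move=> y; case/andP: (v01 y).
- exact: v1.
- by move=> y /vD/DU/UV.
Qed.

Lemma compact_in_interior (C : set K) : compact C ->
  exists2 D, compact D & C `<=` D°.
Proof.
move=> cC; apply: (@compact_set_ind K C (fun A => exists2 D, compact D & A `<=` D°) cC).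
- by exists set0 => //; exact: compact0.
- move=> A B [D cD AD] [E cE BE]; exists (D `|` E); first exact: compactU.
  by move=> x [/AD|/BE]; apply: filterS => y; [left|right].
- by move=> A B AB [D cD BD]; exists D => //; exact: subset_trans BD.
- move=> x _; have [D [cD nD _]] := compact_nbhd_in R hK lcK (@filterT _ (nbhs x) _).
  by exists D° ; [exact: open_nbhs_nbhs (conj (@open_interior _ _) nD)|exists D].
Qed.

Lemma supp_nonempty x y : exists z, S x y z.
Proof.
apply: contrapT => /forallNP nS.
have S0 : S x y = set0 by rewrite -subset0 => z /nS.
have := hpt_fine1 (x:=x) (y:=y) (D:=set0); rewrite S0 => /(_ (@subset_refl _ _) measurable0).
by rewrite measure0 => /eqP; rewrite eq_sym onee_eq0.
Qed.

(** The upper half of continuity in the Michael topology. The other clause, with [setT] as the open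
    set to be met, holds because supports are nonempty. *)
Lemma supp_usc x y (W : set K) : open W -> S x y `<=` W ->
  \forall z \near (x, y), S z.1 z.2 `<=` W.
Proof.
move=> oW SW; have [z Sz] := supp_nonempty x y.
have := @hsupp_continuous R K H setT W openT oW; rewrite openE => /(_ (x, y)) h.
have : nbhs (x, y) [set z0 | S z0.1 z0.2 `&` setT !=set0 /\ S z0.1 z0.2 `<=` W].
  by apply: h; split => //; exists z; split.
by apply: filterS => t [].
Qed.

Lemma supp_compact_union (C D : set K) : compact C -> compact D ->
  exists2 E, compact E & forall x y, C x -> D y -> S x y `<=` E.
Proof.
move=> cC cD; have cCD := compact_setX cC cD.
suff [E cE HE] : exists2 E : set K, compact E & forall z : K * K, (C `*` D) z -> S z.1 z.2 `<=` E.
  by exists E => // x y Cx Dy; exact: (HE (x, y)).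
apply: (@compact_set_ind _ _ (fun A : set (K * K) => exists2 E : set K, compact E & forall z : K * K, A z -> S z.1 z.2 `<=` E) cCD).
- by exists set0 => //; exact: compact0.
- move=> A B [E cE AE] [F cF BF]; exists (E `|` F); first exact: compactU.
  by move=> z [/AE|/BF] h t /h; [left|right].
- by move=> A B AB [E cE BE]; exists E => // z /AB; exact: BE.
- move=> [x y] _; have [E cE SE] := compact_in_interior (supp_compact x y).
  eexists; first exact: (supp_usc (@open_interior _ E) SE).
  by exists E => // z /= h t /h /interior_subset.
Qed.

Lemma supp_invM x y z : S x y z -> S (inv y) (inv x) (inv z).
Proof.
move=> Sz U oU Uz.
suff : (0 < P x y (inv @^-1` U))%E by rewrite (hpt_inv H x y (borel_open oU)).
apply: Sz => //.
by apply: open_comp => // t _; exact: hinv_continuous.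
Qed.

(** The point [e] lies in [S x t] only for t = x^-, which [S y z] omits. Hence each [S x t] with [t]
    in [S y z] misses [e], and by compactness they all miss one neighbourhood of it. *)
Lemma tau_null_e x y z : ~ S y z (inv x) -> exists2 V, nbhs e V &
  forall f, Ccr f -> (forall t, f t != 0 -> V t) -> tau (tau f x) y z = 0.
Proof.
move=> nS.
have [V nV HV] : exists2 V, nbhs e V & forall t, S y z t -> S x t `<=` ~` V.
  apply: (@compact_set_ind K (S y z) (fun A => exists2 V, nbhs e V & forall t, A t -> S x t `<=` ~` V)).
  - exact: supp_compact.
  - by exists setT => //; exact: filterT.
  - move=> A B [V nV AV] [W nW BW]; exists (V `&` W); first exact: filterI.
    by move=> t [/AV|/BW] h u /h nVu [].
  - by move=> A B AB [V nV BV]; exists V => // t /AB; exact: BV.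
  - move=> t Syt; have ne : ~ S x t e.
      by move=> /h_supp_e xt; apply: nS; rewrite xt hinvK.
    have cS := compact_closed hK (supp_compact x t).
    have nnS : nbhs e (~` S x t) by apply: open_nbhs_nbhs; split => //; exact: closed_openC.
    have [D [cD nD DS]] := compact_nbhd_in R hK lcK nnS.
    have oD : open (~` D) by apply: closed_openC; exact: (compact_closed hK).
    have SD : S x t `<=` ~` D by move=> u Su /DS.
    have [[A B] [/= nA nB] AB] := supp_usc oD SD.
    exists B => //; exists D => // u Bu.
    by apply: (AB (x, u)); split => //=; exact: nbhs_singleton.
exists V => // f cf fV; have [cf1 _] := cf.
rewrite -[RHS](tau_cst 0 y z); apply: eq_tau.
- exact: continuous_tau1.
- exact: cst_continuous.
- move=> t Syt; rewrite -[RHS](tau_cst 0 x t); apply: eq_tau => //; first exact: cst_continuous.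
  move=> u Su; apply/eqP/negPn/negP => /fV Vu; exact: (HV t Syt u Su).
Qed.

(** Both memberships say that [e] is in the support of t^- * r^- * s. If the second failed, a bump
    function at [e] would integrate to zero over that triple product, while the other bracketing
    gives a positive value. *)
Lemma supp_swap r s t : S (inv r) s t -> S r t s.
Proof.
move=> St; apply: contrapT => nS.
have [|V nV HV] := @tau_null_e s (inv t) (inv r).
  by move=> /supp_invM; rewrite !hinvK.
have [f [cf f0 fe fV]] := Ccr_urysohn nV.
have := HV f cf fV; rewrite -tau_assoc//; apply/eqP; rewrite gt_eqF//.
apply: (@tau_gt0 _ _ _ t) => //.
- exact: continuous_tau1.
- by move=> u; exact: tau_ge0.
- apply: (@tau_gt0 _ _ _ e) => //; first by case: cf.
  + exact: supp_invl.
  + by rewrite fe.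
Qed.

Lemma tau_neq0 f x y : continuous f -> tau f x y != 0 -> exists2 z, S x y z & f z != 0.
Proof.
move=> cf h; apply: contrapT => nz; move/eqP: h; apply.
rewrite -[RHS](tau_cst 0 x y); apply: eq_tau => //; first exact: cst_continuous.
by move=> z Sz; apply/eqP/negPn/negP => fz; apply: nz; exists z.
Qed.

(** A point [z] of [S x y] in the support of [f] puts [y] in [S (inv x) z] by [supp_swap], so [E]
    only has to contain the products of C^- with that support. *)
Lemma tau_support f (C : set K) : Ccr f -> compact C ->
  exists2 E, compact E & forall x y, C x -> tau f x y != 0 -> E y.
Proof.
move=> [cf [D cD fD]] cC.
have ciC : compact (inv @` C).
  by apply: continuous_compact => //; apply: continuous_subspaceT; exact: hinv_continuous.
have [E cE SE] := supp_compact_union ciC cD.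
exists E => // x y Cx /tau_neq0[//|z Sz /fD Dz].
have iCx : [set inv x | x in C] (inv x) by exists x.
apply: (SE (inv x) z iCx Dz).
by apply: supp_swap; rewrite hinvK.
Qed.

Lemma Ccr_tau f x : Ccr f -> Ccr (tau f x).
Proof.
move=> cf; split; first exact: continuous_tau1.
have [E cE HE] := tau_support cf (@compact_set1 _ x).
by exists E => // y; exact: HE.
Qed.

Lemma Ccr_inv f : Ccr f -> Ccr (f \o inv).
Proof.
move=> [cf [C cC fC]]; split.
  by move=> z; apply: continuous_comp; [exact: hinv_continuous|exact: cf].
exists (inv @` C).
  by apply: continuous_compact => //; apply: continuous_subspaceT; exact: hinv_continuous.
by move=> x /= /fC Cx; exists (inv x) => //; rewrite hinvK.
Qed.

(** * Haar measure and kernels *)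

Lemma tau_sym3 f x y z : Ccr f -> tau (tau f x) y z = tau (tau f y) x z.
Proof. by move=> cf; rewrite tau_comm tau_assoc// tau_comm tau_assoc// tau_comm. Qed.

Lemma supp_e x z : S x e z -> z = x.
Proof.
move=> Sz; apply: contrapT => zx.
have oU : open (~` [set x]).
  by apply: closed_openC; exact: (accessible_closed_set1 (hausdorff_accessible hK)).
have := Sz _ oU zx; have := hpt_e_dirac x (borel_open oU).
by move=> /= -> ; rewrite /dirac indicE memNset ?ltxx//; exact.
Qed.

Variable omega : {measure set (borel K) -> \bar R}.
Hypothesis Homega : haar H omega.

Lemma omega_radon : radon omega. Proof. by case: Homega. Qed.

Lemma omega_ltoo (C : set K) : compact C -> (omega C < +oo)%E.
Proof. exact: (radon_ltoo omega_radon). Qed.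

Lemma omega_int f : Ccr f -> omega.-integrable setT (EFin \o f).
Proof. by apply: (Ccr_integrable hK); exact: omega_radon. Qed.

Lemma haar_tau f x : Ccr f -> \int[omega]_y tau f x y = \int[omega]_y f y.
Proof.
move=> cf; have [_ _ inv] := Homega.
pose F := fun t : K => (f t)%:C%C.
have cF : Cc F.
  split; first by split; [case: cf|exact: cst_continuous].
  rewrite /compact_support (_ : [set t | F t != 0] = [set t | f t != 0]).
    exact: Ccr_compact_support.
  by apply/seteqP; split => t /=; rewrite /F (inj_eq (@complexI R)).
by have [] := inv x F cF.
Qed.

(** For any [y], the translate [tau f (inv y)] is positive at [y] and has the same integral as [f].
    If that integral were not positive, no point could lie in the support of [omega], and [omega]
    would vanish. *)
Lemma omega_gt0 f : Ccr f -> (forall x, 0 <= f x) -> 0 < f e -> 0 < \int[omega]_x f x.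
Proof.
move=> cf f0 fe; rewrite ltNge; apply/negP => If.
have [_ + _] := Homega; rewrite -setC0 (_ : set0 = msupp omega).
  by rewrite (msupp_null hK omega_radon) eqxx.
apply/esym; rewrite -subset0 => y My.
have cg : Ccr (tau f (inv y)) by exact: Ccr_tau.
have g0 t : 0 <= tau f (inv y) t by exact: tau_ge0.
have gy : 0 < tau f (inv y) y.
  by apply: (@tau_gt0 f (inv y) y e) => //; [case: cf|exact: supp_invl].
have oU : open [set t | tau f (inv y) y / 2 < tau f (inv y) t].
  by apply: (@open_comp _ _ (tau f (inv y)) [set r | tau f (inv y) y / 2 < r]);
    [move=> t _; case: cg => + _; exact|exact: open_gt].
have : 0 < \int[omega]_t tau f (inv y) t.
  apply: (@Rintegral_gt0 _ (borel K) R omega [set t | tau f (inv y) y / 2 < tau f (inv y) t] _ (tau f (inv y) y / 2)) => //.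
  - exact: borel_open.
  - by rewrite divr_gt0.
  - by move=> t /= /ltW.
  - by apply: My => //=; rewrite ltr_pdivrMr// ltr_pMr// ltr1n.
  - exact: omega_int.
by rewrite haar_tau// ltNge If.
Qed.

(** Members of an approximate identity. Symmetry makes u(x^- * y) a symmetric function of x and y,
    so that its mass can be computed in either variable. *)
Definition kernel_in (V : set K) (u : K -> R) :=
  [/\ Ccr u, forall x, 0 <= u x, forall x, u (inv x) = u x,
      \int[omega]_x u x = 1 & forall x, u x != 0 -> V x].

Lemma kernel_inS (V W : set K) u : V `<=` W -> kernel_in V u -> kernel_in W u.
Proof. by move=> VW [? ? ? ? uV]; split => // x /uV; exact: VW. Qed.

Lemma kernel_ex (V : set K) : nbhs e V -> exists2 u, kernel_in V u & 0 < u e.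
Proof.
move=> nV; have nV' : nbhs e (inv @^-1` V).
  by have := @hinv_continuous _ _ H e; apply; rewrite /= inv_e.
have [f [cf f0 fe fV]] := Ccr_urysohn (filterI nV nV').
pose u0 x := f x + f (inv x).
have cu0 : Ccr u0 by apply: CcrD => //; exact: Ccr_inv.
have u00 x : 0 <= u0 x by rewrite addr_ge0.
have u0e : 0 < u0 e by rewrite /u0 inv_e fe addr_gt0.
have I0 := omega_gt0 cu0 u00 u0e.
exists (fun x => (\int[omega]_x u0 x)^-1 * u0 x); last by rewrite mulr_gt0 ?invr_gt0.
split.
- exact: CcrZ.
- by move=> x; rewrite mulr_ge0// invr_ge0 ltW.
- by move=> x; rewrite /u0 hinvK addrC.
- rewrite RintegralZl//; last exact: omega_int.
  by rewrite mulVf// gt_eqF.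
- move=> x; rewrite mulf_eq0 invr_eq0 (gt_eqF I0)/= /u0.
  have [->|/fV[]//] := eqVneq (f x) 0.
  by rewrite add0r => /fV[]; rewrite /= hinvK.
Qed.

(** If u(r^- * s) is nonzero, [supp_swap] places [s] in [S r t] for some [t] in [V]. As [t] tends to
    [e] this support shrinks to [r], uniformly for [r] in [C]. *)
Lemma kernel_approx (v : K -> R) (C : set K) (eps : R) : continuous v -> compact C -> 0 < eps ->
  exists2 V, nbhs e V & forall u, kernel_in V u -> forall r, C r -> forall s,
    tau u (inv r) s != 0 -> `|v s - v r| <= eps.
Proof.
move=> cv cC eps0.
have : \forall t \near e, forall r, C r -> forall s, S r t s -> `|v s - v r| <= eps.
  apply: nbhs_compact_uniform => // r Cr.
  have e2 : 0 < eps / 2 by rewrite divr_gt0.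
  have oW : open [set s | `|v s - v r| < eps / 2].
    apply: (@open_comp _ _ (fun s => `|v s - v r|) [set z | z < eps / 2]); last exact: open_lt.
    by move=> s _; apply: cvg_norm; apply: cvgB; [exact: cv|exact: cvg_cst].
  have SW : S r e `<=` [set s | `|v s - v r| < eps / 2].
    by move=> s /supp_e ->/=; rewrite subrr normr0.
  have := supp_usc oW SW.
  have nr : nbhs r [set s | `|v s - v r| < eps / 2].
    by apply: open_nbhs_nbhs; split => //=; rewrite subrr normr0.
  move=> [[A B] [/= nA nB] AB].
  exists (B, A `&` [set s | `|v s - v r| < eps / 2]) => /=; first by split => //; exact: filterI.
  move=> [t r'] [/= Bt [Ar' vr']] s Ss.
  have vs : `|v s - v r| < eps / 2 by exact: (AB (r', t) (conj Ar' Bt)).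
  rewrite -(subrKA (v r)) (splitr eps) (le_trans (ler_normD _ _))// lerD//; first exact: ltW.
  by rewrite distrC ltW.
move=> nV; eexists; first exact: nV.
move=> u [cu u0 _ _ uV] r Cr s /tau_neq0[|t /supp_swap Srt /uV/= ut]; first by case: cu.
exact: ut.
Qed.

Lemma kernel_approx_int (v : K -> R) (C : set K) (eps : R) : continuous v -> compact C -> 0 < eps ->
  exists2 V, nbhs e V & forall u, kernel_in V u -> forall r, C r ->
    `|\int[omega]_s (tau u (inv r) s * v s) - v r| <= eps.
Proof.
move=> cv cC eps0; have [V nV HV] := kernel_approx cv cC eps0.
exists V => // u ku r Cr; have [cu u0 _ u1 _] := ku.
have ct : Ccr (tau u (inv r)) by exact: Ccr_tau.
have t1 c : c = \int[omega]_s (c * tau u (inv r) s).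
  by rewrite RintegralZl ?haar_tau ?u1 ?mulr1//; exact: omega_int.
rewrite (t1 (v r)) [leRHS]t1; apply: Rintegral_dist => //.
- by apply: omega_int; under eq_fun do rewrite mulrC; exact: CcrM.
- by apply: RintegrableZ => //; exact: omega_int.
- by apply: RintegrableZ => //; exact: omega_int.
move=> s _; rewrite mulrC -mulrBl normrM [X in _ * X]ger0_norm; last exact: tau_ge0.
have [->|h] := eqVneq (tau u (inv r) s) 0; first by rewrite !mulr0.
by rewrite ler_wpM2r ?tau_ge0//; exact: (HV u ku r Cr).
Qed.

Lemma translateE (f : K -> R[i]) x y :
  translate H f x y = (tau (fun t => complex.Re (f t)) x y +i* tau (fun t => complex.Im (f t)) x y)%C.
Proof. by []. Qed.

Opaque tau.

Lemma hpt_fubini (G : K * K -> R) (a : K -> R) (D : set K) x y : compact D -> continuous G ->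
  omega.-integrable D (EFin \o a) ->
  tau (fun r => \int[omega]_(s in D) (G (r, s) * a s)) x y =
  \int[omega]_(s in D) (tau (fun r => G (r, s)) x y * a s).
Proof.
move=> cD cG ai; have cS := supp_compact x y; have mD := borel_compact hK cD.
rewrite (@tau_supp _ x y (S x y))//; last first.
  exact: (continuous_Rintegral_param mD (@subset_refl _ _) cD cG ai).
rewrite (fubini_compact hK cS cD cG _ ai); last by apply: hpt_ltoo; exact: (borel_compact hK).
apply: eq_Rintegral => s _; congr (_ * _); rewrite (@tau_supp _ x y (S x y))//.
exact: continuous_pairr.
Qed.

Lemma Ccr_integrable_on (D : set K) f : compact D -> continuous f ->
  omega.-integrable D (EFin \o f).
Proof.
move=> cD cf; apply: (integrable_continuous hK _ (@subset_refl _ D) cD) => //.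
  exact: (borel_compact hK).
exact: omega_ltoo.
Qed.

Lemma continuous_tau_pair f : Ccr f -> continuous (fun z : K * K => tau f z.1 z.2).
Proof.
move=> cf; have [M M0 fM] := Ccr_bounded cf.
by apply: continuous_tau; [case: cf|exists M].
Qed.

Lemma continuous_tau_invl f : Ccr f -> continuous (fun z : K * K => tau f (inv z.1) z.2).
Proof.
move=> cf z; apply: (@continuous_comp _ _ _ (fun z : K * K => (inv z.1, z.2)) (fun z : K * K => tau f z.1 z.2)).
  apply: cvg_pair; last exact: cvg_snd.
  by apply: continuous_comp; [exact: cvg_fst|exact: hinv_continuous].
exact: continuous_tau_pair.
Qed.

Lemma tau2_inv f x y z : Ccr f ->
  tau (tau (f \o inv) x) y z = tau (tau f (inv x)) (inv y) (inv z).
Proof.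
move=> cf; rewrite (_ : tau (f \o inv) x = tau f (inv x) \o inv).
  by rewrite tau_inv 1?tau_comm//; exact: continuous_tau1.
by apply/funext => t; rewrite /= tau_inv 1?tau_comm//; case: cf.
Qed.

(** * Adjointness of translation *)

Section adjoint.
Variables (v w : K -> R) (a : K) (D E : set K).
Hypotheses (cv : Ccr v) (cw : Ccr w) (cD : compact D) (cE : compact E).
Hypotheses (vE : forall x, v x != 0 -> E x) (wD : forall x, w x != 0 -> D x).

Let vR u r : \int[omega]_s (tau u (inv r) s * v s) = \int[omega]_(s in E) (tau u (inv r) s * v s).
Proof. by apply: Rintegral_supported => s; rewrite mulf_eq0 negb_or => /andP[_ /vE]. Qed.

Lemma continuous_tau_conv u : Ccr u -> continuous (fun r => \int[omega]_s (tau u (inv r) s * v s)).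
Proof.
move=> cu; rewrite (funext (vR u)).
have iv : omega.-integrable E (EFin \o v) by apply: Ccr_integrable_on => //; case: cv.
exact: (continuous_Rintegral_param (borel_compact hK cE) (@subset_refl _ E) cE (continuous_tau_invl cu) iv).
Qed.

Lemma tau_conv u x y : Ccr u -> tau (fun r => \int[omega]_s (tau u (inv r) s * v s)) x y =
  \int[omega]_(s in E) (tau (tau u (inv y)) (inv x) s * v s).
Proof.
move=> cu; rewrite (funext (vR u)).
rewrite (hpt_fubini (G := fun z : K * K => tau u (inv z.1) z.2))//.
- apply: eq_Rintegral => s _; congr (_ * _) => /=.
  rewrite (_ : (fun r => tau u (inv r) s) = tau u s \o inv); last first.
    by apply/funext => r; exact: tau_comm.
  by rewrite tau_inv; [exact: esym (tau_assoc _ _ _ cu)|exact: continuous_tau1].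
- exact: continuous_tau_invl.
- by apply: Ccr_integrable_on => //; case: cv.
Qed.
End adjoint.

(* Both sides are limits, as the kernel u shrinks to e, of the double integral
   of w(y) v(s) u(a^- * y^- * s). *)
Lemma adjoint_Ccr v w a : Ccr v -> Ccr w ->
  \int[omega]_y (tau v a y * w y) = \int[omega]_y (v y * tau w (inv a) y).
Proof.
move=> cv cw; have [cv1 [E cE vE]] := cv; have [cw1 [D cD wD]] := cw.
have mD := borel_compact hK cD; have mE := borel_compact hK cE.
have [C1 cC1 HC1] := supp_compact_union (@compact_set1 _ a) cD.
have [C2 cC2 HC2] := supp_compact_union (@compact_set1 _ (inv a)) cE.
rewrite (@Rintegral_supported _ _ _ omega D); last first.
  by move=> y; rewrite mulf_eq0 negb_or => /andP[_ /wD].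
rewrite [RHS](@Rintegral_supported _ _ _ omega E); last first.
  by move=> y; rewrite mulf_eq0 negb_or => /andP[/vE].
have iw := integrable_norm (Ccr_integrable_on cD cw1).
have iv := integrable_norm (Ccr_integrable_on cE cv1).
pose N := \int[omega]_(y in D) `|w y| + \int[omega]_(y in E) `|v y|.
have N0 : 0 <= N by rewrite addr_ge0//; apply: Rintegral_ge0.
apply/eqP; rewrite -subr_eq0 -normr_le0; apply/ler_addgt0Pl => eps eps0; rewrite addr0.
pose eps' := eps / (N + 1).
have eps'0 : 0 < eps' by rewrite divr_gt0// ltr_wpDl.
have [V1 nV1 HV1] := kernel_approx_int cv1 cC1 eps'0.
have [V2 nV2 HV2] := kernel_approx_int cw1 cC2 eps'0.
have [u ku _] := kernel_ex (filterI nV1 nV2).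
have {}HV1 := HV1 u (kernel_inS (@subIsetl _ _ _) ku).
have {}HV2 := HV2 u (kernel_inS (@subIsetr _ _ _) ku).
have [cu u0 usym u1 _] := ku.
pose A (z : K * K) := tau (tau u (inv a)) (inv z.1) z.2.
have cA : continuous A by apply: continuous_tau_invl; exact: Ccr_tau.
have cwA : continuous (fun z : K * K => w z.1 * A z).
  move=> z; apply: cvgM; last exact: cA.
  by apply: continuous_comp; [exact: cvg_fst|exact: cw1].
(* [Phi] is close to [tau v a] on [D], and [Psi] below is close to [tau w (inv a)] on [E]; Fubini
   equates the two pairings. *)
pose Phi y := \int[omega]_(s in E) (A (y, s) * v s).
have cPhi : continuous Phi.
  exact: (continuous_Rintegral_param mE (@subset_refl _ E) cE cA (Ccr_integrable_on cE cv1)).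
have PhiE y : Phi y = tau (fun r => \int[omega]_s (tau u (inv r) s * v s)) a y.
  rewrite (tau_conv cv cE vE)//; apply: eq_Rintegral => s _; congr (_ * _).
  by rewrite /A/= tau_sym3.
have XJ : `|\int[omega]_(y in D) (tau v a y * w y) - \int[omega]_(y in D) (Phi y * w y)|
   <= eps' * \int[omega]_(y in D) `|w y|.
  rewrite -RintegralZl//; apply: Rintegral_dist => //.
  - by apply: Ccr_integrable_on => // y; apply: cvgM; [exact: continuous_tau1|exact: cw1].
  - by apply: Ccr_integrable_on => // y; apply: cvgM; [exact: cPhi|exact: cw1].
  - exact: RintegrableZ.
  move=> y Dy; rewrite -mulrBl normrM ler_wpM2r// distrC PhiE.
  apply: (tau_dist (continuous_tau_conv cv cE vE cu) cv1) => z Sz.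
  by apply: HV1; exact: (HC1 a y).
pose Psi s := \int[omega]_(y in D) (w y * A (y, s)).
have JE : \int[omega]_(y in D) (Phi y * w y) = \int[omega]_(s in E) (Psi s * v s).
  have := fubini_compact hK cD cE cwA (omega_ltoo cD) (Ccr_integrable_on cE cv1).
  move=> <-; apply: eq_Rintegral => y _; rewrite /Phi mulrC -RintegralZl//.
    by apply: eq_Rintegral => s _; rewrite mulrA.
  apply: Ccr_integrable_on => // s; apply: cvgM; last exact: cv1.
  by have := continuous_pairl (x := y) cA; apply.
have PsiE s : Psi s = tau (fun r => \int[omega]_y (tau u (inv r) y * w y)) (inv a) s.
  have usE : u \o inv = u by apply/funext => t; exact: usym.
  rewrite (tau_conv cw cD wD)//; apply: eq_Rintegral => y _; rewrite mulrC; congr (_ * _).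
  by rewrite /A/= -[in RHS]usE tau2_inv// !hinvK tau_comm -tau_sym3// tau_comm.
have cPsi : continuous Psi.
  have cA' : continuous (fun z : K * K => A (z.2, z.1)).
    move=> z; apply: (@continuous_comp _ _ _ (fun z : K * K => (z.2, z.1)) A); last exact: cA.
    by apply: cvg_pair; [exact: cvg_snd|exact: cvg_fst].
  have := continuous_Rintegral_param mD (@subset_refl _ D) cD cA' (Ccr_integrable_on cD cw1).
  rewrite (_ : (fun s => _) = Psi)//; apply/funext => s; apply: eq_Rintegral => y _.
  exact: mulrC.
have YJ : `|\int[omega]_(s in E) (Psi s * v s) - \int[omega]_(s in E) (v s * tau w (inv a) s)|
   <= eps' * \int[omega]_(s in E) `|v s|.
  rewrite -RintegralZl//; apply: Rintegral_dist => //.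
  - by apply: Ccr_integrable_on => // s; apply: cvgM; [exact: cPsi|exact: cv1].
  - by apply: Ccr_integrable_on => // y; apply: cvgM; [exact: cv1|exact: continuous_tau1].
  - exact: RintegrableZ.
  move=> s Es; rewrite [v s * _]mulrC -mulrBl normrM ler_wpM2r// PsiE.
  apply: (tau_dist (continuous_tau_conv cw cD wD cu) cw1) => z Sz.
  by apply: HV2; exact: (HC2 (inv a) s).
rewrite -(subrKA (\int[omega]_(y in D) (Phi y * w y))) (le_trans (ler_normD _ _))//.
apply: le_trans (_ : eps' * N <= _); first by rewrite mulrDr lerD// JE.
by rewrite /eps' mulrAC ler_pdivrMr ?ltr_wpDl// ler_pM2l// lerDl.
Qed.

(** * Convolution of functions with compact support *)

(** Both sides see [v] only on a compact set, so [v] may be cut off outside it. *)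
Lemma adjoint_continuous v w a : continuous v -> Ccr w ->
  \int[omega]_y (tau v a y * w y) = \int[omega]_y (v y * tau w (inv a) y).
Proof.
move=> cv cw; have [cw1 [D cD wD]] := cw.
have [E cE HE] := supp_compact_union (@compact_set1 _ a) cD.
have [_ [F cF HF]] := Ccr_tau (inv a) cw.
have [chi [cchi _ chi1 [L [cL _ chiL]]]] :=
  urysohn_compact R hK lcK (compactU cE cF) openT (@subsetT _ _).
have cchiv : Ccr (fun y => v y * chi y) by apply: CcrM => //; split => //; exists L.
have chivE y : (E `|` F) y -> v y * chi y = v y by move=> /chi1 ->; rewrite mulr1.
have := adjoint_Ccr a cchiv cw.
have -> : \int[omega]_y (tau (fun y => v y * chi y) a y * w y) = \int[omega]_y (tau v a y * w y).
  apply: eq_Rintegral => y _; have [->|/wD Dy] := eqVneq (w y) 0; first by rewrite !mulr0.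
  congr (_ * _); apply: eq_tau => //; first by case: cchiv.
  by move=> z Sz; apply: chivE; left; exact: (HE a y).
move=> ->; apply: eq_Rintegral => y _.
have [->|/HF Fy] := eqVneq (tau w (inv a) y) 0; first by rewrite !mulr0.
by rewrite chivE//; right.
Qed.

(** For real functions this is g1 * g2~: the reflection in [fconv] cancels the one in [tilde]. *)
Definition star (g1 g2 : K -> R) x := \int[omega]_y (tau g1 x y * g2 y).

Lemma star_on g1 g2 (C : set K) x : (forall y, g2 y != 0 -> C y) ->
  star g1 g2 x = \int[omega]_(y in C) (tau g1 x y * g2 y).
Proof.
by move=> g2C; apply: Rintegral_supported => y; rewrite mulf_eq0 negb_or => /andP[_ /g2C].
Qed.

Lemma star_neq0 g1 g2 x : star g1 g2 x != 0 -> exists y, tau g1 x y != 0 /\ g2 y != 0.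
Proof.
move=> h; apply: contrapT => /forallNP ny; move/eqP: h; apply.
rewrite /star (_ : (fun y => _) = fun=> 0); first by rewrite Rintegral_cst// mul0r.
apply/funext => y; apply/eqP; rewrite mulf_eq0; apply/negPn/negP; rewrite negb_or => /andP[h1 h2].
by apply: (ny y).
Qed.

Lemma Ccr_star g1 g2 : Ccr g1 -> Ccr g2 -> Ccr (star g1 g2).
Proof.
move=> cg1 cg2; have [cg21 [C cC gC]] := cg2.
split.
  rewrite (funext (fun x => star_on g1 x gC)).
  exact: (continuous_Rintegral_param (borel_compact hK cC) (@subset_refl _ C) cC (continuous_tau_pair cg1) (Ccr_integrable_on cC cg21)).
have [E cE HE] := tau_support cg1 cC.
exists E => // x /star_neq0[y [h1 /gC Cy]].
by apply: (HE y) => //; rewrite tau_comm.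
Qed.

Lemma tau_star g1 g2 z x : Ccr g1 -> Ccr g2 -> tau (star g1 g2) z x = star (tau g1 z) g2 x.
Proof.
move=> cg1 cg2; have [cg21 [C cC gC]] := cg2.
rewrite (funext (fun x => star_on g1 x gC)).
rewrite (hpt_fubini z x cC (continuous_tau_pair cg1) (Ccr_integrable_on cC cg21)).
rewrite (star_on _ _ gC); apply: eq_Rintegral => s _; congr (_ * _) => /=.
rewrite (_ : (fun r => tau g1 r s) = tau g1 s); last by apply/funext => r; exact: tau_comm.
by rewrite -tau_assoc.
Qed.

(** By adjointness the translation of the second factor moves out with its argument inverted. This
    is how a test function built from translates of [u] produces the arguments x_i * x_j^- of a
    positive definite sum. *)
Lemma star_tau2 g1 g2 a b x : Ccr g1 -> Ccr g2 ->
  star (tau g1 a) (tau g2 b) x = tau (tau (star g1 g2) a) (inv b) x.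
Proof.
move=> cg1 cg2; have cta : Ccr (tau g1 a) by exact: Ccr_tau.
have -> : tau (star g1 g2) a = star (tau g1 a) g2 by apply/funext => z; rewrite tau_star.
rewrite tau_star// /star -[in LHS](hinvK H b) -adjoint_Ccr//; last exact: Ccr_tau.
by apply: eq_Rintegral => y _; rewrite tau_sym3.
Qed.

Lemma Rintegral_star g1 g2 : Ccr g1 -> Ccr g2 ->
  \int[omega]_x star g1 g2 x = \int[omega]_x g1 x * \int[omega]_x g2 x.
Proof.
move=> cg1 cg2; have [cg21 [C cC gC]] := cg2.
have [E cE HE] := tau_support cg1 cC.
rewrite (@Rintegral_supported _ _ _ omega E); last first.
  move=> x /star_neq0[y [h1 /gC Cy]].
  by apply: (HE y) => //; rewrite tau_comm.
transitivity (\int[omega]_(x in E) \int[omega]_(y in C) (tau g1 x y * g2 y)).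
  by apply: eq_Rintegral => x _; exact: star_on.
rewrite (fubini_compact hK cE cC (continuous_tau_pair cg1) (omega_ltoo cE) (Ccr_integrable_on cC cg21)).
rewrite [in RHS](@Rintegral_supported _ _ _ omega C g2)//.
rewrite -(RintegralZl _ (borel_compact hK cC) (Ccr_integrable_on cC cg21)).
apply: eq_Rintegral => y /[!inE] Cy; congr (_ * _).
transitivity (\int[omega]_x tau g1 y x); last exact: haar_tau.
rewrite [RHS](@Rintegral_supported _ _ _ omega E); last by move=> x; exact: HE.
by apply: eq_Rintegral => x _; exact: tau_comm.
Qed.

Lemma supp_comm x y : S x y `<=` S y x.
Proof.
move=> z Sz U oU Uz; have p : (0 < P x y U)%E := Sz U oU Uz.
by rewrite (hpt_comm x y (borel_open oU)) in p.
Qed.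

Lemma supp_small (V : set K) : nbhs e V ->
  exists2 W, nbhs e W & forall a b, W a -> W b -> S a b `<=` V.
Proof.
move=> /nbhs_open_ex[U [oU Ue UV]].
have SU : S e e `<=` U by move=> z /supp_e ->.
have [[A B] [/= nA nB] AB] := supp_usc oU SU.
exists (A `&` B); first exact: filterI.
by move=> a b [Aa _] [_ Bb]; apply: subset_trans UV; exact: (AB (a, b)).
Qed.

(** Positive type controls [f] only against functions g * g~, so kernels must have that shape. At
    [e] the kernel equals the integral of u^2, which is positive. *)
Lemma kernel_star (V : set K) : nbhs e V -> exists u,
  [/\ kernel_in setT u, kernel_in V (star u u) & 0 < star u u e].
Proof.
move=> nV; have [W nW HW] := supp_small nV.
have [u ku ue] := kernel_ex nW; have [cu u0 usym u1 uW] := ku.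
exists u; split.
- exact: kernel_inS ku.
- split.
  + exact: Ccr_star.
  + by move=> x; apply: Rintegral_ge0 => y _; rewrite mulr_ge0// tau_ge0.
  + move=> x; rewrite /star adjoint_Ccr// hinvK.
    by apply: eq_Rintegral => y _; exact: mulrC.
  + by rewrite Rintegral_star// u1 mulr1.
  + move=> x /star_neq0[y [/tau_neq0[|t Sxy ut uy]]]; first by case: cu.
    apply: (HW (inv y) t); [|exact: uW|].
      by apply: uW; rewrite usym.
    by apply: supp_swap; rewrite hinvK; exact: supp_comm.
- have -> : star u u e = \int[omega]_y (u y * u y).
    apply: eq_Rintegral => y _; congr (_ * _); rewrite tau_comm tau_e//.
    by case: cu.
  apply: omega_gt0; first by apply: CcrM => //; case: cu.
  + by move=> x; rewrite mulr_ge0.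
  + by rewrite mulr_gt0.
Qed.

(** * Convolution of a locally integrable function *)

Definition locint (f : K -> R) := measurable_fun [set: borel K] (f : borel K -> R) /\
  forall C : set K, compact C -> omega.-integrable C (EFin \o f).

Lemma locint_continuous f : continuous f -> locint f.
Proof. by move=> cf; split; [exact: continuous_borel|move=> C cC; exact: Ccr_integrable_on]. Qed.

Lemma locint_integrable f g : locint f -> Ccr g ->
  omega.-integrable setT (EFin \o (fun y => g y * f y)).
Proof.
move=> [mf fi] [cg [C cC gC]]; have mC := borel_compact hK cC.
apply: (@integrable_supported _ _ _ omega C (fun y => g y * f y)) => //.
  by move=> x; rewrite mulf_eq0 negb_or => /andP[/gC].
exact: (integrableM_continuous mC (@subset_refl _ C) cC cg (fi C cC)).
Qed.

(* The paper's f * k, for a symmetric kernel k. *)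
Definition smooth k f x := \int[omega]_y (tau k (inv x) y * f y).

Lemma tau_inv_support k (C : set K) : Ccr k -> compact C ->
  exists2 E, compact E & forall x y, C x -> tau k (inv x) y != 0 -> E y.
Proof.
move=> ck cC; have ciC : compact (inv @` C).
  by apply: continuous_compact => //; apply: continuous_subspaceT; exact: hinv_continuous.
have [E cE HE] := tau_support ck ciC.
by exists E => // x y Cx; apply: HE; exists x.
Qed.

Lemma smooth_on k f (E : set K) x : (forall y, tau k (inv x) y != 0 -> E y) ->
  smooth k f x = \int[omega]_(y in E) (tau k (inv x) y * f y).
Proof.
by move=> HE; apply: Rintegral_supported => y; rewrite mulf_eq0 negb_or => /andP[/HE].
Qed.

Lemma smooth_continuous k f : Ccr k -> locint f -> continuous (smooth k f).
Proof.
move=> ck [mf fi] x0.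
have [N [cN nN _]] := compact_nbhd_in R hK lcK (@filterT _ (nbhs x0) _).
have [E cE HE] := tau_inv_support ck cN.
have cc := continuous_Rintegral_param (borel_compact hK cE) (@subset_refl _ E) cE (continuous_tau_invl ck) (fi E cE).
rewrite /continuous_at; have -> : smooth k f x0 = \int[omega]_(y in E) (tau k (inv x0) y * f y).
  by apply: smooth_on => y; apply: HE; exact: nbhs_singleton.
apply: cvg_trans (cc x0); apply: near_eq_cvg; apply: filterS nN => x Nx.
by apply/esym/smooth_on => y; exact: HE.
Qed.

Lemma tau_smooth k f x y : Ccr k -> locint f ->
  tau (smooth k f) x y = \int[omega]_t (tau (tau k (inv x)) (inv y) t * f t).
Proof.
move=> ck lf; have [mf fi] := lf; have cS := supp_compact x y.
have [E cE HE] := tau_inv_support ck cS.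
have cc := continuous_Rintegral_param (borel_compact hK cE) (@subset_refl _ E) cE (continuous_tau_invl ck) (fi E cE).
have swap t : tau (tau k (inv x)) (inv y) t = tau (fun r => tau k (inv r) t) x y.
  rewrite (_ : (fun r => _) = tau k t \o inv); last by apply/funext => r; exact: tau_comm.
  rewrite tau_inv; last exact: continuous_tau1.
  by rewrite tau_assoc// tau_comm tau_sym3// tau_comm tau_assoc// tau_comm.
have ctk t : continuous (fun r => tau k (inv r) t).
  exact: (continuous_pairr (G := fun z : K * K => tau k (inv z.1) z.2) (continuous_tau_invl ck)).
rewrite (eq_tau (g := fun r => \int[omega]_(t in E) (tau k (inv r) t * f t))).
- rewrite (hpt_fubini x y cE (continuous_tau_invl ck) (fi E cE)).
  rewrite [RHS](@Rintegral_supported _ _ _ omega E).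
    by apply: eq_Rintegral => t _; rewrite swap.
  move=> t; rewrite mulf_eq0 negb_or => /andP[+ _]; rewrite swap => /tau_neq0[|r Sr kr].
    exact: ctk.
  exact: (HE r t Sr kr).
- exact: smooth_continuous.
- exact: cc.
- by move=> r Sr; apply: smooth_on => t; exact: HE.
Qed.

(** * Smoothing a function of positive type *)

Section finite_sums.
Variable n : nat.

Lemma Rintegral_sum d (T : measurableType d) (mu : {measure set T -> \bar R}) (F : 'I_n -> T -> R) :
  (forall i, mu.-integrable setT (EFin \o F i)) ->
  \int[mu]_t (\sum_i F i t) = \sum_i \int[mu]_t F i t.
Proof.
move=> Fi; pose s := index_enum 'I_n; rewrite -/s.
have [//] : mu.-integrable setT (EFin \o (fun t => \sum_(i <- s) F i t)) /\
  \int[mu]_t (\sum_(i <- s) F i t) = \sum_(i <- s) \int[mu]_t F i t.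
elim: s => [|i s [IH1 IH2]].
  rewrite big_nil; under eq_fun do rewrite big_nil; split.
    exact: integrable0.
  by rewrite Rintegral_cst// mul0r.
rewrite big_cons -IH2 -RintegralD//; split.
  under eq_fun do rewrite big_cons; exact: RintegrableD.
by apply: eq_Rintegral => x _; rewrite big_cons.
Qed.

Lemma continuous_sum (r : 'I_n -> R) (g : 'I_n -> K -> R) (s : seq 'I_n) :
  (forall i, continuous (g i)) -> continuous (fun x => \sum_(i <- s) r i * g i x).
Proof.
move=> cg; elim: s => [|i s IH].
  by under eq_fun do rewrite big_nil; exact: cst_continuous.
under eq_fun do rewrite big_cons; move=> x; apply: cvgD; last exact: IH.
by apply: cvgM; [exact: cvg_cst|exact: cg].
Qed.

Lemma Ccr_sum (r : 'I_n -> R) (g : 'I_n -> K -> R) : (forall i, Ccr (g i)) ->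
  Ccr (fun x => \sum_i r i * g i x).
Proof.
move=> cg; rewrite /index_enum; elim: (Finite.enum _) => [|i s IH].
  under eq_fun do rewrite big_nil; split; first exact: cst_continuous.
  by exists set0 => [|x]; [exact: compact0|rewrite eqxx].
by under eq_fun do rewrite big_cons; apply: CcrD => //; exact: CcrZ.
Qed.

Lemma tau_sum (r : 'I_n -> R) (g : 'I_n -> K -> R) x y : (forall i, continuous (g i)) ->
  tau (fun t => \sum_i r i * g i t) x y = \sum_i r i * tau (g i) x y.
Proof.
move=> cg; rewrite /index_enum; elim: (Finite.enum _) => [|i s IH].
  by under eq_fun do rewrite big_nil; rewrite big_nil tau_cst.
under eq_fun do rewrite big_cons.
rewrite tauD ?tauZ ?big_cons ?IH//.
  by move=> z; apply: cvgM; [exact: cvg_cst|exact: cg].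
exact: continuous_sum.
Qed.

Lemma star_sum (r r' : 'I_n -> R) (g : 'I_n -> K -> R) x : (forall i, Ccr (g i)) ->
  star (fun t => \sum_i r i * g i t) (fun t => \sum_i r' i * g i t) x =
  \sum_i \sum_j (r i * r' j) * star (g i) (g j) x.
Proof.
move=> cg; have cg' i : continuous (g i) by case: (cg i).
have ti i j : omega.-integrable setT (EFin \o (fun y => tau (g i) x y * g j y)).
  by apply: omega_int; apply: CcrM => //; exact: continuous_tau1.
transitivity (\int[omega]_y \sum_i \sum_j (r i * r' j) * (tau (g i) x y * g j y)).
  apply: eq_Rintegral => y _; rewrite tau_sum// big_distrl; apply: eq_bigr => i _ /=.
  by rewrite big_distrr; apply: eq_bigr => j _ /=; rewrite mulrACA.
have tj i : omega.-integrable setT (EFin \o (fun y => \sum_j (r i * r' j) * (tau (g i) x y * g j y))).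
  by apply: omega_int; apply: Ccr_sum => j; apply: CcrM => //; exact: continuous_tau1.
rewrite Rintegral_sum//; apply: eq_bigr => i _; rewrite Rintegral_sum.
  by apply: eq_bigr => j _; rewrite RintegralZl.
by move=> j; exact: RintegrableZ.
Qed.

End finite_sums.

Lemma fconv_tilde (al be : K -> R) y : Ccr al -> Ccr be ->
  fconv H omega (fun t => (al t +i* be t)%C) (tilde H (fun t => (al t +i* be t)%C)) y =
  ((star al al y + star be be y) +i* (star be al y - star al be y))%C.
Proof.
move=> ca cb.
have it g1 g2 : Ccr g1 -> Ccr g2 -> omega.-integrable setT (EFin \o (fun t => tau g1 y t * g2 t)).
  by move=> c1 c2; apply: omega_int; apply: CcrM => //; exact: continuous_tau1.
rewrite /fconv /cint; congr (_ +i* _)%C.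
- rewrite /star -RintegralD//; [|exact: it|exact: it].
  by apply: eq_Rintegral => t _; rewrite translateE /tilde hinvK/= mulrN opprK.
- rewrite /star -RintegralB//; [|exact: it|exact: it].
  by apply: eq_Rintegral => t _; rewrite translateE /tilde hinvK/= mulrN addrC.
Qed.

(** Here A + iB is g * g~ for g = al + i be; the complex integral is split so that only real
    integrals remain to be computed. *)
Lemma positive_type_real (f : K -> R[i]) (al be A B : K -> R) : positive_type H omega f ->
  Ccr al -> Ccr be ->
  (forall y, star al al y + star be be y = A y) ->
  (forall y, star be al y - star al be y = B y) ->
  0 <= ((\int[omega]_y (complex.Re (f y) * A y - complex.Im (f y) * B y)) +i*
        (\int[omega]_y (complex.Re (f y) * B y + complex.Im (f y) * A y)))%C.
Proof.
move=> [_ pf] ca cb AE BE.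
pose g t := (al t +i* be t)%C.
have cg : Cc g.
  split; first by split; [case: ca|case: cb].
  have [_ [C cC aC]] := ca; have [_ [D cD bD]] := cb.
  apply: (subclosed_compact _ (compactU cC cD)); first exact: closed_closure.
  have /closure_id -> := compact_closed hK (compactU cC cD).
  apply: closureS => t /=; have [at0|/aC] := eqVneq (al t) 0; last by left.
  have [bt0|/bD] := eqVneq (be t) 0; last by right.
  by rewrite /g at0 bt0 eqxx.
have := pf g cg.
rewrite (_ : (fun y => _) = fun y => ((complex.Re (f y) * A y - complex.Im (f y) * B y) +i*
  (complex.Re (f y) * B y + complex.Im (f y) * A y))%C)//.
by apply/funext => y; rewrite fconv_tilde// AE BE; case: (f y) => a b.
Qed.

Definition csmooth k (f : K -> R[i]) x : R[i] :=
  (smooth k (fun t => complex.Re (f t)) x +i* smooth k (fun t => complex.Im (f t)) x)%C.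

Lemma loc_integrable_ReIm (f : K -> R[i]) : loc_integrable omega f ->
  locint (fun t => complex.Re (f t)) /\ locint (fun t => complex.Im (f t)).
Proof.
move=> [[mr mi] fi]; split; split => // C cC; have mC := borel_compact hK cC.
  apply: le_integrable (fi C cC) => //.
    by apply/measurable_EFinP; apply: measurable_funTS.
  move=> x _ /=; rewrite lee_fin; case: (f x) => a b /=.
  rewrite [leRHS]ger0_norm ?sqrtr_ge0//.
  by rewrite -sqrtr_sqr ler_sqrt ?addr_ge0 ?sqr_ge0// lerDl sqr_ge0.
apply: le_integrable (fi C cC) => //.
  by apply/measurable_EFinP; apply: measurable_funTS.
move=> x _ /=; rewrite lee_fin; case: (f x) => a b /=.
rewrite [leRHS]ger0_norm ?sqrtr_ge0//.
by rewrite -sqrtr_sqr ler_sqrt ?addr_ge0 ?sqr_ge0// lerDr sqr_ge0.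
Qed.

Lemma Re_sum (I : Type) (s : seq I) (F : I -> R[i]) :
  complex.Re (\sum_(i <- s) F i) = \sum_(i <- s) complex.Re (F i).
Proof. by elim: s => [|i s IH]; rewrite ?big_nil// !big_cons -IH; case: (F i); case: (\sum_(j <- s) F j). Qed.

Lemma Im_sum (I : Type) (s : seq I) (F : I -> R[i]) :
  complex.Im (\sum_(i <- s) F i) = \sum_(i <- s) complex.Im (F i).
Proof. by elim: s => [|i s IH]; rewrite ?big_nil// !big_cons -IH; case: (F i); case: (\sum_(j <- s) F j). Qed.

Section pd.
Variables (f : K -> R[i]) (u : K -> R).
Hypotheses (pf : positive_type H omega f) (cu : Ccr u).
Let fr t := complex.Re (f t).
Let fi t := complex.Im (f t).
Let k := star u u.

(** Test the positivity of [f] on the sum g of the c_i [tau u (inv (x i))]. By [star_tau2], g * g~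
    is the sum of c_i conj(c_j) times the translate of [k] by x_i^- and x_j; paired with [f], this
    translate gives the value of f * k at x_i * x_j^- by [tau_smooth]. *)
Lemma positive_type_csmooth n (c : 'I_n -> R[i]) (x : 'I_n -> K) :
  0 <= \sum_(i < n) \sum_(j < n) c i * (c j)^*%C * translate H (csmooth k f) (x i) (inv (x j)).
Proof.
have [lf _] := pf; have [lr li] := loc_integrable_ReIm lf.
have ck : Ccr k by exact: Ccr_star.
pose cr i := complex.Re (c i); pose ci i := complex.Im (c i).
pose g i := tau u (inv (x i)).
have cg i : Ccr (g i) by exact: Ccr_tau.
pose s i j := star (g i) (g j).
have cs i j : Ccr (s i j) by exact: Ccr_star.
pose al y := \sum_i cr i * g i y; pose be y := \sum_i ci i * g i y.
have ca : Ccr al by exact: Ccr_sum.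
have cb : Ccr be by exact: Ccr_sum.
(* [p i j] and [q i j] are the real and imaginary parts of c_i conj(c_j). *)
pose p i j := cr i * cr j + ci i * ci j.
pose q i j := ci i * cr j - cr i * ci j.
have AE y : star al al y + star be be y = \sum_i \sum_j p i j * s i j y.
  rewrite !star_sum// -big_split; apply: eq_bigr => i _ /=.
  by rewrite -big_split; apply: eq_bigr => j _ /=; rewrite -mulrDl.
have BE y : star be al y - star al be y = \sum_i \sum_j q i j * s i j y.
  rewrite !star_sum// -sumrB; apply: eq_bigr => i _ /=.
  by rewrite -sumrB; apply: eq_bigr => j _ /=; rewrite -mulrBl.
have il h i j : locint h -> omega.-integrable setT (EFin \o (fun y => s i j y * h y)).
  by move=> lh; exact: locint_integrable.
have i1 h (m : 'I_n -> 'I_n -> R) i : locint h ->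
    omega.-integrable setT (EFin \o (fun y => \sum_j m i j * (s i j y * h y))).
  move=> lh; rewrite (_ : (fun y => _) = fun y => (\sum_j m i j * s i j y) * h y).
    by apply: locint_integrable => //; exact: Ccr_sum.
  by apply/funext => y; rewrite big_distrl; apply: eq_bigr => j _ /=; rewrite mulrA.
have iS h (m : 'I_n -> 'I_n -> R) : locint h ->
    omega.-integrable setT (EFin \o (fun y => h y * \sum_i \sum_j m i j * s i j y)) /\
    \int[omega]_y (h y * \sum_i \sum_j m i j * s i j y) =
    \sum_i \sum_j m i j * \int[omega]_y (s i j y * h y).
  move=> lh.
  have E y : h y * (\sum_i \sum_j m i j * s i j y) = \sum_i \sum_j m i j * (s i j y * h y).
    rewrite big_distrr; apply: eq_bigr => i _ /=; rewrite big_distrr; apply: eq_bigr => j _ /=.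
    by rewrite mulrC mulrA.
  split.
    under eq_fun do rewrite mulrC; apply: locint_integrable => //.
    have := @Ccr_sum n (fun=> 1) (fun i y => \sum_j m i j * s i j y).
    under eq_fun do under eq_bigr do rewrite mul1r.
    by apply => i; exact: Ccr_sum.
  transitivity (\int[omega]_y \sum_i \sum_j m i j * (s i j y * h y)).
    by apply: eq_Rintegral => y _; rewrite E.
  rewrite Rintegral_sum; last by move=> i; exact: i1.
  apply: eq_bigr => i _; rewrite Rintegral_sum.
    by apply: eq_bigr => j _; rewrite RintegralZl//; exact: il.
  by move=> j; apply: RintegrableZ => //; exact: il.
have tE h i j : locint h -> tau (smooth k h) (x i) (inv (x j)) = \int[omega]_y (s i j y * h y).
  move=> lh; rewrite tau_smooth//; apply: eq_Rintegral => y _; congr (_ * _).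
  by rewrite /s /g star_tau2.
have -> : \sum_(i < n) \sum_(j < n) c i * (c j)^*%C * translate H (csmooth k f) (x i) (inv (x j)) =
  ((\sum_i \sum_j p i j * \int[omega]_y (s i j y * fr y) -
    \sum_i \sum_j q i j * \int[omega]_y (s i j y * fi y)) +i*
   (\sum_i \sum_j q i j * \int[omega]_y (s i j y * fr y) +
    \sum_i \sum_j p i j * \int[omega]_y (s i j y * fi y)))%C.
  apply/eqP; rewrite eq_complex /= Re_sum Im_sum; apply/andP; split; apply/eqP.
    rewrite -sumrB; apply: eq_bigr => i _; rewrite Re_sum -sumrB; apply: eq_bigr => j _.
    rewrite translateE !tE// /p /q /cr /ci; case: (c i) => a b; case: (c j) => a' b' /=.
    by rewrite mulrN opprK (addrC (a * - b')) mulrN.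
  rewrite -big_split; apply: eq_bigr => i _ /=; rewrite Im_sum -big_split; apply: eq_bigr => j _ /=.
  rewrite translateE !tE// /p /q /cr /ci; case: (c i) => a b; case: (c j) => a' b' /=.
  by rewrite !mulrN opprK [RHS]addrC (addrC (b * a')).
have := positive_type_real pf ca cb AE BE.
have [ip <-] := iS fr p lr; have [iq <-] := iS fi q li.
have [ip' <-] := iS fi p li; have [iq' <-] := iS fr q lr.
by rewrite RintegralB// RintegralD.
Qed.

End pd.

(** * Positive definite functions *)

Lemma continuous_csmooth k (f : K -> R[i]) : Ccr k -> loc_integrable omega f -> ccontinuous (csmooth k f).
Proof.
by move=> ck /loc_integrable_ReIm[lr li]; split; exact: smooth_continuous.
Qed.

Lemma Pb_csmooth (f : K -> R[i]) u (M : R) : positive_type H omega f -> Ccr u ->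
  (forall x, ComplexField.Normc.normc (csmooth (star u u) f x) <= M) -> Pb H (csmooth (star u u) f).
Proof.
move=> pf cu FM; have [lf _] := pf.
have [cr ci] := continuous_csmooth (Ccr_star cu cu) lf.
split => //; first by exists M.
split.
- by split; exact: continuous_borel.
- by move=> x; exists M; exact: nearW.
- exact: positive_type_csmooth.
Qed.

Lemma Pb_two_points (F : K -> R[i]) (z : R[i]) x : Pb H F ->
  0 <= F e + z^*%C * F (inv x) + z * F x + z * z^*%C * translate H F x (inv x).
Proof.
move=> [[cr ci] _ [_ _ pd]].
pose c (i : 'I_2) := if i == ord0 then 1 else z : R[i].
pose y (i : 'I_2) := if i == ord0 then e else x.
have := pd 2%N c y; rewrite !big_ord_recl !big_ord0 /c /y/= !addr0 inv_e.
have Te w : translate H F w e = F w by rewrite translateE !tau_e//; case: (F w).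
have eT w : translate H F e w = F w by rewrite translateE !(tau_comm _ e) !tau_e//; case: (F w).
have cE (w : R[i]) : Num.conj w = w^*%C by [].
by rewrite !Te eT !cE conjc1 !mul1r mulr1 !addrA.
Qed.

(** The two-point form involves F(x * x^-), which need not be F(e). Bounding it by any bound M of
    |F| gives 2 |F(x)| <= F(e) + M; with M the supremum of |F|, which is finite, M can be
    absorbed. *)
Lemma Pb_le (F : K -> R[i]) x : Pb H F ->
  ComplexField.Normc.normc (F x) <= complex.Re (F e).
Proof.
move=> pF; have [[cr ci] [M0 FM0] _] := pF.
pose N y : R := ComplexField.Normc.normc (F y).
have key (M : R) y : (forall t, N t <= M) -> N y + N y <= complex.Re (F e) + M.
  move=> NM.
  have t1M : complex.Re (translate H F y (inv y)) <= M.
    rewrite translateE /=; apply: tau_le_cst => // t.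
    apply: le_trans (NM t); rewrite /N; case: (F t) => a b /=.
    by rewrite (le_trans (ler_norm a))// -sqrtr_sqr ler_wsqrtr// lerDl sqr_ge0.
  have P2 (w : R[i]) := Pb_two_points w y pF.
  move: P2 t1M; rewrite /N.
  case: (F e) => a0 b0; case: (F y) => a b; case: (F (inv y)) => a' b'.
  case: (translate H F y (inv y)) => t1 t2 P2 /= t1M.
  have P (p q : R) : 0 = b0 + (p * b' - q * a') + (p * b + q * a) + (p ^+ 2 + q ^+ 2) * t2 /\
     0 <= a0 + (p * a' + q * b') + (p * a - q * b) + (p ^+ 2 + q ^+ 2) * t1.
    have := P2 (p +i* q)%C; rewrite lecE /= => /andP[/eqP h1 h2]; split.
      by rewrite -h1; ring.
    by apply: le_trans h2 _; rewrite le_eqVlt; apply/orP; left; apply/eqP; ring.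
  (* The form is real at z = 0, 1, -1 and i, which forces F(y^-) = conj(F(y)) and makes F(y * y^-)
     real. *)
  have [h0 _] := P 0 0; have [h1 _] := P 1 0; have [h2 _] := P (-1) 0; have [h3 _] := P 0 1.
  have t20 : t2 = 0 by lra.
  have b'E : b' = - b by lra.
  have a'E : a' = a by lra.
  set n := Num.sqrt _.
  have n2 : n ^+ 2 = a ^+ 2 + b ^+ 2 by rewrite sqr_sqrtr// addr_ge0// sqr_ge0.
  have [n0|nn0] := eqVneq n 0.
    rewrite n0 addr0; have [_] := P 0 0.
    have : 0 <= M by apply: le_trans (NM e); rewrite /N; case: (F e) => ? ? /=; exact: sqrtr_ge0.
    by lra.
  (* The optimal unimodular coefficient, z = - conj(F(y)) / |F(y)|. *)
  have [_] := P (- a / n) (b / n).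
  rewrite a'E b'E.
  have -> : (- a / n) ^+ 2 + (b / n) ^+ 2 = 1.
    rewrite !exprMn sqrrN -mulrDl -n2 -exprMn divff// expr1n.
    by [].
  have -> : a0 + (- a / n * a + b / n * - b) + (- a / n * a - b / n * b) + 1 * t1 =
     a0 - (n + n) + t1.
    have -> : n + n = (n ^+ 2 + n ^+ 2) / n by field.
    by rewrite n2; field.
  by lra.
pose A := range N.
have hA : has_sup A.
  split; first by exists (N e); exists e.
  by exists M0 => _ [y _ <-]; exact: FM0.
have NsA t : N t <= sup A by apply: ub_le_sup; [exact: hA.2|exists t].
have : sup A + sup A <= complex.Re (F e) + sup A.
  have sA : sup A <= (complex.Re (F e) + sup A) / 2.
    apply: ge_sup; first by case: hA.
    by move=> _ [y _ <-]; have := key _ y NsA; lra.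
  by lra.
by rewrite lerD2r; apply: le_trans; exact: NsA.
Qed.

(** Indexed by a list of weighted points, the form in which [discretize_on_compact] delivers
    them. *)
Lemma Pb_real_seq (phi : K -> R) (l : seq (R * K)) : Pb H (fun x => (phi x)%:C%C) ->
  0 <= \sum_(a <- l) \sum_(b <- l) a.1 * b.1 * tau phi a.2 (inv b.2).
Proof.
move=> [_ _ [_ _ pd]].
have := pd (size l) (fun i => (tnth (in_tuple l) i).1%:C%C) (fun i => (tnth (in_tuple l) i).2).
rewrite lecE Re_sum => /andP[_ /le_trans]; apply.
rewrite (big_tnth _ _ l) le_eqVlt; apply/orP; left; apply/eqP.
apply: eq_bigr => i _; rewrite Re_sum (big_tnth _ _ l); apply: eq_bigr => j _.
have cE (w : R[i]) : Num.conj w = w^*%C by [].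
rewrite translateE cE /= oppr0.
by rewrite !mul0r !mulr0 addr0 mul0r !subr0.
Qed.

(* One list of weighted points serves for both variables of G, as is needed to
   recognise a positive definite sum in [Pb_star_ge0]. *)
Lemma discretize_on_compact (g : K -> R) (G : K * K -> R) (C : set K) (eps : R) :
  compact C -> continuous g -> continuous G -> 0 < eps ->
  exists l : seq (R * K), [/\ forall a, a \in l -> C a.2,
    \sum_(a <- l) `|a.1| <= \int[omega]_(s in C) `|g s|,
    forall t, C t -> `|\int[omega]_(s in C) (G (s, t) * g s) - \sum_(a <- l) a.1 * G (a.2, t)|
       <= eps * \int[omega]_(s in C) `|g s| &
    forall t, C t -> `|\int[omega]_(s in C) (G (t, s) * g s) - \sum_(a <- l) a.1 * G (t, a.2)|
       <= eps * \int[omega]_(s in C) `|g s|].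
Proof.
move=> cC cg cG eps0; have mC := borel_compact hK cC.
have gi (A : set K) : measurable (A : set (borel K)) -> A `<=` C -> omega.-integrable A (EFin \o g).
  by move=> mA sAC; apply: (integrable_continuous hK mA sAC cC (omega_ltoo cC)).
have ngi A mA sAC := integrable_norm (@gi A mA sAC).
have Gi (A : set K) (h : K -> R) : measurable (A : set (borel K)) -> A `<=` C -> continuous h ->
    omega.-integrable A (EFin \o (fun s => h s * g s)).
  by move=> mA sAC ch; exact: (integrableM_continuous mA sAC cC ch (gi A mA sAC)).
have cl t : continuous (fun s => G (s, t)) by exact: (continuous_pairr (x := t) cG).
have cr t : continuous (fun s => G (t, s)) by exact: (continuous_pairl (x := t) cG).
pose Q (A : set K) (l : seq (R * K)) := [/\ forall a, a \in l -> C a.2,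
    \sum_(a <- l) `|a.1| <= \int[omega]_(s in A) `|g s|,
    forall t, C t -> `|\int[omega]_(s in A) (G (s, t) * g s) - \sum_(a <- l) a.1 * G (a.2, t)|
       <= eps * \int[omega]_(s in A) `|g s| &
    forall t, C t -> `|\int[omega]_(s in A) (G (t, s) * g s) - \sum_(a <- l) a.1 * G (t, a.2)|
       <= eps * \int[omega]_(s in A) `|g s|].
suff [V [mV CV HV]] : exists V, [/\ measurable (V : set (borel K)), C `<=` V &
    forall A, measurable (A : set (borel K)) -> A `<=` C -> A `<=` V -> exists l, Q A l].
  by have [l] := HV C mC (@subset_refl _ _) CV; exists l.
apply: (@compact_set_ind K C (fun U => exists V, [/\ measurable (V : set (borel K)), U `<=` V &
    forall A, measurable (A : set (borel K)) -> A `<=` C -> A `<=` V -> exists l, Q A l])) => //.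
- exists set0; split => // A mA sAC; rewrite subset0 => ->; exists [::]; split => //.
  + by rewrite big_nil Rintegral_set0.
  + by move=> t _; rewrite big_nil !Rintegral_set0 subrr normr0 mulr0.
  + by move=> t _; rewrite big_nil !Rintegral_set0 subrr normr0 mulr0.
- move=> X Y [A [mA XA PA]] [B [mB YB PB]]; exists (A `|` B); split.
  + exact: measurableU.
  + by move=> x [/XA|/YB]; [left|right].
  move=> U mU UC UAB.
  have mUA : measurable (U `&` A : set (borel K)) by exact: measurableI.
  have mUB : measurable (U `\` A : set (borel K)) by exact: measurableD.
  have UAC : U `&` A `<=` C by move=> x [/UC].
  have UBC : U `\` A `<=` C by move=> x [/UC].
  have UBB : U `\` A `<=` B by move=> x [/UAB[]].
  have [l1 [l1C l1N l1l l1r]] := PA _ mUA UAC (fun x h => h.2).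
  have [l2 [l2C l2N l2l l2r]] := PB _ mUB UBC UBB.
  have dis : [disjoint U `&` A & U `\` A].
    by rewrite disj_set2E; apply/eqP; rewrite -subset0 => x [[_ ?] []].
  have Ueq : U = (U `&` A) `|` (U `\` A) by rewrite setUIDK.
  have split1 h : omega.-integrable U (EFin \o h) ->
      \int[omega]_(x in U) h x = \int[omega]_(x in U `&` A) h x + \int[omega]_(x in U `\` A) h x.
    by move=> hi; rewrite {1}Ueq Rintegral_setU// -Ueq.
  exists (l1 ++ l2); split.
  + by move=> a; rewrite mem_cat => /orP[/l1C|/l2C].
  + by rewrite big_cat split1; [exact: lerD|exact: ngi].
  + move=> t Ct; rewrite big_cat split1; last exact: Gi.
    rewrite split1; last exact: ngi.
    rewrite mulrDr opprD addrACA (le_trans (ler_normD _ _))// lerD//; [exact: l1l|exact: l2l].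
  + move=> t Ct; rewrite big_cat split1; last exact: Gi.
    rewrite split1; last exact: ngi.
    rewrite mulrDr opprD addrACA (le_trans (ler_normD _ _))// lerD//; [exact: l1r|exact: l2r].
- by move=> A B AB [V [mV BV PV]]; exists V; split => //; exact: subset_trans BV.
- move=> x Cx.
  have H1 := nbhs_uniform_dist x eps0 cC cG.
  have cG' : continuous (fun z : K * K => G (z.2, z.1)).
    move=> z; apply: (@continuous_comp _ _ _ (fun z : K * K => (z.2, z.1)) G); last exact: cG.
    by apply: cvg_pair; [exact: cvg_snd|exact: cvg_fst].
  have H2 := nbhs_uniform_dist x eps0 cC cG'.
  have [V [oV Vx VU]] := nbhs_open_ex (filterI H1 H2).
  exists V; first exact: open_nbhs_nbhs.
  exists V; split => //; first exact: borel_open.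
  (* On a small piece one node suffices: the whole integral of [g] is placed at [x]. *)
  move=> A mA sAC AV; exists [:: (\int[omega]_(s in A) g s, x)].
  have ni : omega.-integrable A (EFin \o (fun s => eps * `|g s|)).
    by apply: RintegrableZ => //; exact: ngi.
  split.
  + by move=> a; rewrite inE => /eqP ->.
  + by rewrite big_seq1; apply: le_normr_Rintegral => //; exact: gi.
  + move=> t Ct; rewrite big_seq1 /= mulrC -RintegralZl//; last exact: gi.
    rewrite -RintegralZl//; last exact: ngi.
    apply: Rintegral_dist => //; [exact: Gi|by apply: RintegrableZ => //; exact: gi|].
    move=> s /AV/VU[h _]; rewrite -mulrBl normrM ler_wpM2r//; exact: h.
  + move=> t Ct; rewrite big_seq1 /= mulrC -RintegralZl//; last exact: gi.
    rewrite -RintegralZl//; last exact: ngi.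
    apply: Rintegral_dist => //; [exact: Gi|by apply: RintegrableZ => //; exact: gi|].
    move=> s /AV/VU[_ h]; rewrite -mulrBl normrM ler_wpM2r//; exact: h.
Qed.

Lemma continuous_tau_invr f : continuous f -> (exists M, forall x, `|f x| <= M) ->
  continuous (fun z : K * K => tau f z.1 (inv z.2)).
Proof.
move=> cf fM z; apply: (@continuous_comp _ _ _ (fun z : K * K => (z.1, inv z.2)) (fun z : K * K => tau f z.1 z.2)).
  apply: cvg_pair; first exact: cvg_fst.
  by apply: continuous_comp; [exact: cvg_snd|exact: hinv_continuous].
exact: continuous_tau.
Qed.

(** The left side is the continuous analogue of a positive definite sum; adjointness and Fubini move
    both factors onto the correlation of [g]. *)
Lemma Rintegral_star_double (phi g : K -> R) (C : set K) : continuous phi -> Ccr g ->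
  compact C -> (forall x, g x != 0 -> C x) ->
  \int[omega]_(t in C) ((\int[omega]_(s in C) (tau phi s (inv t) * g s)) * g t) =
  \int[omega]_y (phi y * star g g y).
Proof.
move=> cphi cg cC gC; have [cg1 _] := cg; have [E cE HE] := tau_support cg cC.
have inner t : C t -> \int[omega]_(s in C) (tau phi s (inv t) * g s) =
    \int[omega]_(s in E) (tau g t s * phi s).
  move=> Ct; transitivity (\int[omega]_s (tau phi (inv t) s * g s)).
    rewrite [RHS](@Rintegral_supported _ _ _ omega C).
      by apply: eq_Rintegral => s _; rewrite tau_comm.
    by move=> s; rewrite mulf_eq0 negb_or => /andP[_ /gC].
  rewrite adjoint_continuous// hinvK (@Rintegral_supported _ _ _ omega E).
    by apply: eq_Rintegral => s _; rewrite mulrC.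
  by move=> s; rewrite mulf_eq0 negb_or => /andP[_]; exact: HE.
have cG : continuous (fun z : K * K => g z.1 * tau g z.1 z.2).
  move=> z; apply: cvgM; last exact: continuous_tau_pair.
  by apply: continuous_comp; [exact: cvg_fst|exact: cg1].
transitivity (\int[omega]_(t in C) \int[omega]_(s in E) ((g t * tau g t s) * phi s)).
  apply: eq_Rintegral => t /[!inE] Ct; rewrite inner// mulrC -RintegralZl//.
  - by apply: eq_Rintegral => s _; rewrite mulrA.
  - exact: (borel_compact hK).
  - by apply: Ccr_integrable_on => // s; apply: cvgM; [exact: continuous_tau1|exact: cphi].
rewrite (fubini_compact hK cC cE cG (omega_ltoo cC) (Ccr_integrable_on cE cphi)).
rewrite [RHS](@Rintegral_supported _ _ _ omega E).
  apply: eq_Rintegral => s _; rewrite mulrC; congr (_ * _); rewrite (star_on _ _ gC).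
  by apply: eq_Rintegral => t _ /=; rewrite mulrC tau_comm.
move=> s; rewrite mulf_eq0 negb_or => /andP[_ /star_neq0[y [h1 /gC Cy]]].
by apply: (HE y s Cy); rewrite tau_comm.
Qed.

(** A continuous positive definite function is of positive type: the double integral of phi(s * t^-)
    g(s) g(t) is approximated by positive definite sums. *)
Lemma Pb_star_ge0 (phi g : K -> R) : Pb H (fun x => (phi x)%:C%C) -> Ccr g ->
  0 <= \int[omega]_y (phi y * star g g y).
Proof.
move=> pphi cg; have [[cphi _] [M phiM] _] := pphi.
have cphi' : continuous phi by exact: cphi.
have phib : exists M, forall x, `|phi x| <= M.
  exists M => x; apply: le_trans (phiM x) => /=.
  by rewrite expr0n/= addr0 sqrtr_sqr.
have [cg1 [C cC gC]] := cg; have mC := borel_compact hK cC.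
pose G (z : K * K) := tau phi z.1 (inv z.2).
have cG : continuous G by exact: continuous_tau_invr.
rewrite -(Rintegral_star_double cphi' cg cC gC).
pose N := \int[omega]_(s in C) `|g s|.
have N0 : 0 <= N by apply: Rintegral_ge0.
have ngi := integrable_norm (Ccr_integrable_on cC cg1).
set X := \int[omega]_(t in C) _.
apply/ler_addgt0Pr => d d0.
(* Discretising one variable costs at most [eps * N ^+ 2], and there are two variables. *)
pose eps := d / (2 * N ^+ 2 + 1).
have den0 : 0 < 2 * N ^+ 2 + 1 by rewrite ltr_wpDl// mulr_ge0// sqr_ge0.
have eps0 : 0 < eps by rewrite divr_gt0.
have [l [lC lN ll lr]] := discretize_on_compact cC cg1 cG eps0.
have Z0 := Pb_real_seq l pphi.
set Z := \sum_(a <- l) _ in Z0.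
(* Halfway between the integral [X] and the sum [Z]: only the inner variable is discretised. *)
pose Y := \sum_(a <- l) a.1 * \int[omega]_(t in C) (G (a.2, t) * g t).
have cr t : continuous (fun s => G (t, s)) by exact: (continuous_pairl (x := t) cG).
have int1 a : omega.-integrable C (EFin \o (fun t => G (a, t) * g t)).
  by apply: Ccr_integrable_on => // t; apply: cvgM; [exact: cr|exact: cg1].
have YE : omega.-integrable C (EFin \o (fun t => (\sum_(a <- l) a.1 * G (a.2, t)) * g t)) /\
   Y = \int[omega]_(t in C) ((\sum_(a <- l) a.1 * G (a.2, t)) * g t).
  rewrite /Y; elim: (l) => [|a s [IH1 IH2]].
    under eq_fun do rewrite big_nil mul0r; split; first exact: (finite_integrable_cst 0 mC (omega_ltoo cC)).
    by rewrite big_nil Rintegral_cst// mul0r.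
  under eq_fun do rewrite big_cons mulrDl -mulrA; split.
    by apply: RintegrableD => //; exact: RintegrableZ.
  by rewrite big_cons IH2 -RintegralZl// -RintegralD//; exact: RintegrableZ.
have XY : `|X - Y| <= eps * N * N.
  rewrite YE.2 -RintegralZl//; apply: Rintegral_dist => //.
  - apply: Ccr_integrable_on => //.
    have cs : continuous (fun t => \int[omega]_(s in C) (tau phi s (inv t) * g s)).
      have cG' : continuous (fun z : K * K => G (z.2, z.1)).
        move=> z; apply: (@continuous_comp _ _ _ (fun z : K * K => (z.2, z.1)) G); last exact: cG.
        by apply: cvg_pair; [exact: cvg_snd|exact: cvg_fst].
      exact: (continuous_Rintegral_param mC (@subset_refl _ C) cC cG' (Ccr_integrable_on cC cg1)).
    by move=> t; apply: cvgM; [exact: cs|exact: cg1].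
  - exact: YE.1.
  - exact: RintegrableZ.
  by move=> t Ct; rewrite -mulrBl normrM ler_wpM2r//; exact: ll.
have YZ : `|Y - Z| <= eps * N * N.
  have ZE : Z = \sum_(a <- l) a.1 * \sum_(b <- l) b.1 * G (a.2, b.2).
    apply: eq_bigr => a _; rewrite big_distrr; apply: eq_bigr => b _ /=.
    by rewrite mulrA.
  rewrite ZE /Y -sumrB (le_trans (ler_norm_sum _ _ _))//.
  apply: le_trans (_ : \sum_(a <- l) `|a.1| * (eps * N) <= _).
    rewrite big_seq [leRHS]big_seq; apply: ler_sum => a al.
    by rewrite -mulrBr normrM ler_wpM2l//; apply: lr; exact: lC.
  rewrite -big_distrl /= mulrC ler_wpM2l//.
  by rewrite mulr_ge0// ltW.
have : `|X - Z| <= eps * N * N + eps * N * N.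
  by rewrite -(subrKA Y) (le_trans (ler_normD _ _))// lerD.
have epsd : eps * N * N + eps * N * N <= d.
  have -> : eps * N * N + eps * N * N = eps * (2 * N ^+ 2) by ring.
  by rewrite /eps mulrAC ler_pdivrMr// ler_pM2l// lerDl.
rewrite ler_norml => /andP[h _]; lra.
Qed.

Lemma star_2B u v y : Ccr u -> Ccr v ->
  star (fun t => 2 * u t - v t) (fun t => 2 * u t - v t) y =
  2 * (2 * star u u y - star u v y) - (2 * star v u y - star v v y).
Proof.
move=> cu cv; have mT := @measurableT _ (borel K).
have it g1 g2 : Ccr g1 -> Ccr g2 -> omega.-integrable setT (EFin \o (fun t => tau g1 y t * g2 t)).
  by move=> c1 c2; apply: omega_int; apply: CcrM => //; exact: continuous_tau1.
have iB g : Ccr g -> omega.-integrable setT (EFin \o (fun t => 2 * (tau g y t * u t) - tau g y t * v t)).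
  by move=> cg; apply: (RintegrableB mT (RintegrableZ 2 mT (it g u cg cu)) (it g v cg cv)).
have eB g : Ccr g -> 2 * star g u y - star g v y = \int[omega]_t (2 * (tau g y t * u t) - tau g y t * v t).
  move=> cg; rewrite (RintegralB mT (RintegrableZ 2 mT (it g u cg cu)) (it g v cg cv)).
  by rewrite (RintegralZl _ mT (it g u cg cu)).
rewrite !eB// -(RintegralZl _ mT (iB u cu)) -(RintegralB mT (RintegrableZ 2 mT (iB u cu)) (iB v cv)).
have [cu1 _] := cu; have [cv1 _] := cv.
apply: eq_Rintegral => t _; rewrite tauB ?tauZ//; first ring.
by move=> z; apply: cvgM; [exact: cvg_cst|exact: cu1].
Qed.

(* Let F(w) = int phi tau_w (u * u).  Testing the positivity of phi against
   2 u - tau_x u and discarding F(x^-) >= 0 gives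
   2 F(x) <= 4 int phi (u * u) + sup F; take the supremum over x. *)
Lemma Pb_tau_star_le (phi u : K -> R) (w : K) : Pb H (fun x => (phi x)%:C%C) ->
  (forall x, 0 <= phi x) -> Ccr u -> (forall x, 0 <= u x) ->
  \int[omega]_y (phi y * tau (star u u) w y) <= 4 * \int[omega]_y (phi y * star u u y).
Proof.
move=> pphi phi0 cu u0; have [[cphi _] [M phiM] _] := pphi.
have cphi' : continuous phi by exact: cphi.
have phib x : `|phi x| <= M.
  apply: le_trans (phiM x) => /=.
  by rewrite expr0n/= addr0 sqrtr_sqr.
pose k := star u u; have ck : Ccr k by exact: Ccr_star.
have k0 x : 0 <= k x by apply: Rintegral_ge0 => y _; rewrite mulr_ge0// tau_ge0.
have pint g : Ccr g -> omega.-integrable setT (EFin \o (fun y => phi y * g y)).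
  by move=> cg; apply: omega_int; exact: CcrM.
pose F x := \int[omega]_y (phi y * tau k x y).
(* This a priori bound makes the supremum finite, without which it could not be absorbed. *)
have FM x : F x <= M * \int[omega]_y k y.
  rewrite -(haar_tau x ck) -RintegralZl//; last by apply: omega_int; exact: Ccr_tau.
  apply: le_Rintegral => //; first by apply: pint; exact: Ccr_tau.
    by apply: RintegrableZ => //; apply: omega_int; exact: Ccr_tau.
  move=> y _; rewrite ler_wpM2r ?tau_ge0//.
  exact: le_trans (ler_norm _) (phib y).
pose A := range F.
have hA : has_sup A.
  split; first by exists (F e); exists e.
  by exists (M * \int[omega]_y k y) => _ [y _ <-]; exact: FM.
have FsA x : F x <= sup A by apply: ub_le_sup; [exact: hA.2|exists x].
have F0 x : 0 <= F x by apply: Rintegral_ge0 => y _; rewrite mulr_ge0// tau_ge0.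
have key x : F x <= 2 * \int[omega]_y (phi y * k y) + sup A / 2.
  pose g y := 2 * u y - tau u x y.
  have ctu : Ccr (tau u x) by exact: Ccr_tau.
  have cg : Ccr g by apply: CcrB => //; exact: CcrZ.
  have gg y : star g g y = 4 * k y - 2 * (tau k x y + tau k (inv x) y) + tau (tau k x) (inv x) y.
    have e1 : star (tau u x) u y = tau k x y by exact: esym (tau_star x y cu cu).
    have e2 : star u (tau u x) y = tau k (inv x) y.
      have uE : tau u e = u by apply/funext => t; rewrite tau_comm tau_e//; case: cu.
      have kE : tau k e = k by apply/funext => t; rewrite tau_comm tau_e//; case: ck.
      by rewrite -[X in star X _]uE star_tau2// kE.
    have e3 : star (tau u x) (tau u x) y = tau (tau k x) (inv x) y by exact: star_tau2.
    rewrite -e1 -e2 -e3 (star_2B y cu ctu) /k; ring.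
  have := Pb_star_ge0 pphi cg.
  have -> : \int[omega]_y (phi y * star g g y) =
      4 * \int[omega]_y (phi y * k y) - 2 * (F x + F (inv x)) + tau (smooth k phi) (inv x) x.
    rewrite tau_smooth ?hinvK//; last exact: locint_continuous.
    have i1 : omega.-integrable setT (EFin \o (fun y => phi y * k y)) by exact: pint.
    have i2 z : omega.-integrable setT (EFin \o (fun y => phi y * tau k z y)).
      by apply: pint; exact: Ccr_tau.
    have i3 : omega.-integrable setT (EFin \o (fun y => phi y * tau (tau k x) (inv x) y)).
      by apply: pint; do 2 apply: Ccr_tau.
    have -> : \int[omega]_t (tau (tau k x) (inv x) t * phi t) =
        \int[omega]_y (phi y * tau (tau k x) (inv x) y).
      by apply: eq_Rintegral => y _; rewrite mulrC.
    transitivity (\int[omega]_y ((4 * (phi y * k y) - 2 * (phi y * tau k x y + phi y * tau k (inv x) y)) + phi y * tau (tau k x) (inv x) y)).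
      by apply: eq_Rintegral => y _; rewrite gg; ring.
    have i4 := RintegrableD measurableT (i2 x) (i2 (inv x)).
    have i5 := RintegrableB measurableT (RintegrableZ 4 measurableT i1) (RintegrableZ 2 measurableT i4).
    rewrite (RintegralD measurableT i5 i3).
    rewrite (RintegralB measurableT (RintegrableZ 4 measurableT i1) (RintegrableZ 2 measurableT i4)).
    rewrite (RintegralZl _ measurableT i1) (RintegralZl _ measurableT i4).
    by rewrite (RintegralD measurableT (i2 x) (i2 (inv x))).
  have : tau (smooth k phi) (inv x) x <= sup A.
    apply: tau_le_cst; first by apply: smooth_continuous => //; exact: locint_continuous.
    move=> z; rewrite (_ : smooth k phi z = F (inv z))//.
    by apply: eq_Rintegral => y _; rewrite mulrC.
  by have := F0 (inv x); lra.
have sA : sup A <= 2 * \int[omega]_y (phi y * k y) + sup A / 2.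
  apply: ge_sup; first by case: hA.
  by move=> _ [y _ <-]; exact: key.
have := FsA w; rewrite -/k -/(F w); lra.
Qed.

(** * Approximation in L1 *)

Lemma locint_restrict f (D : set K) : locint f -> compact D ->
  omega.-integrable setT (EFin \o (f \_ D)).
Proof.
move=> [mf fi] cD; have mD := borel_compact hK cD.
apply: (@integrable_supported _ _ _ omega D (f \_ D) mD).
  by move=> x; rewrite patchE; case: ifPn => [/set_mem//|_]; rewrite eqxx.
by apply: eq_integrable (fi D cD) => // x xD; rewrite /= patchE xD.
Qed.

Section density.
Import HBSimple.

Let approximable (h : K -> R) := omega.-integrable setT (EFin \o h) /\
  forall eps : R, 0 < eps -> exists2 v : K -> R, Ccr v & \int[omega]_y `|h y - v y| <= eps.

Let mT := @measurableT _ (borel K).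

Let approximableZ c h : approximable h -> approximable (fun y => c * h y).
Proof.
move=> [hi ha]; split; first exact: RintegrableZ.
move=> eps eps0; have d0 : 0 < eps / (`|c| + 1) by rewrite divr_gt0// ltr_wpDl.
have [v cv hv] := ha _ d0; exists (fun y => c * v y); first exact: CcrZ.
have i1 := integrable_norm (RintegrableB mT hi (omega_int cv)).
rewrite (@eq_Rintegral _ _ _ omega setT (fun y => `|c| * `|h y - v y|)); last first.
  by move=> y _; rewrite -mulrBr normrM.
rewrite (RintegralZl _ mT i1).
apply: le_trans (_ : `|c| * (eps / (`|c| + 1)) <= _); first by rewrite ler_wpM2l.
by rewrite mulrA ler_pdivrMr ?ltr_wpDl// mulrC ler_wpM2l ?lerDl// ltW.
Qed.

Let approximableD h1 h2 : approximable h1 -> approximable h2 -> approximable (fun y => h1 y + h2 y).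
Proof.
move=> [h1i h1a] [h2i h2a]; split; first exact: RintegrableD.
move=> eps eps0; have d0 : 0 < eps / 2 by rewrite divr_gt0.
have [v cv hv] := h1a _ d0; have [w cw hw] := h2a _ d0.
exists (fun y => v y + w y); first exact: CcrD.
have i1 := integrable_norm (RintegrableB mT h1i (omega_int cv)).
have i2 := integrable_norm (RintegrableB mT h2i (omega_int cw)).
have i3 := integrable_norm (RintegrableB mT (RintegrableD mT h1i h2i) (omega_int (CcrD cv cw))).
rewrite (splitr eps); apply: le_trans (lerD hv hw).
rewrite -(RintegralD mT i1 i2); apply: (le_Rintegral mT i3 (RintegrableD mT i1 i2)).
by move=> y _ /=; rewrite opprD addrACA ler_normD.
Qed.

Let integrable_indic_fin (A : set K) : measurable (A : set (borel K)) -> (omega A < +oo)%E ->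
  omega.-integrable setT (EFin \o (\1_A : K -> R)) /\ \int[omega]_x (\1_A x : R) = fine (omega A).
Proof.
move=> mA oA; have hA x : (\1_A x : R) != 0 -> A x.
  by rewrite indicE; case: (boolP (x \in A)) => [/set_mem//|_]; rewrite eqxx.
have e1 x : x \in A -> (1 : R) = \1_A x by rewrite indicE => ->.
split.
  apply: (@integrable_supported _ _ _ omega A (\1_A : K -> R) mA hA).
  apply: eq_integrable (finite_integrable_cst 1 mA oA) => //.
  by move=> x /e1 /= <-.
rewrite (@Rintegral_supported _ _ _ omega A (\1_A : K -> R) hA).
rewrite (@eq_Rintegral _ _ _ omega A (fun=> 1)) ?Rintegral_cst ?mul1r//.
by move=> x /e1.
Qed.

Let approximable_indic (A : set K) : measurable (A : set (borel K)) -> (omega A < +oo)%E ->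
  approximable (\1_A : K -> R).
Proof.
move=> mA oA; have [iA _] := integrable_indic_fin mA oA; split => //.
have [rc ro ri] := omega_radon.
move=> eps eps0; have d0 : 0 < eps / 2 by rewrite divr_gt0.
have fA : omega A \is a fin_num by rewrite ge0_fin_numE.
(* [radon] gives inner regularity only for open sets, so [A] is first approximated from outside by
   [U], then [U] from inside by [C]. A function between the indicators of [C] and [U] differs from
   that of [A] only on [U] minus [A] and on [U] minus [C]. *)
have [U [oU AU] UA] : exists2 U : set K, open U /\ A `<=` U & (omega U < omega A + (eps / 2)%:E)%E.
  have := ro A mA => roA.
  have fi : ereal_inf [set omega U | U in [set U : set K | open U /\ A `<=` U]] \is a fin_num.
    by rewrite -roA.
  have [_ [U [oU AU] <-] h] := lb_ereal_inf_adherent d0 fi.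
  by exists U => //; rewrite roA.
have mU := borel_open oU.
have fU : omega U \is a fin_num by rewrite ge0_fin_numE// (lt_le_trans UA)// leey.
have [C [cC CU] CUe] : exists2 C : set K, compact C /\ C `<=` U & (omega U - (eps / 2)%:E < omega C)%E.
  have := ri U oU => riU.
  have fi : ereal_sup [set omega C | C in [set C : set K | compact C /\ C `<=` U]] \is a fin_num.
    by rewrite -riU.
  have [_ [C [cC CU] <-] h] := ub_ereal_sup_adherent d0 fi.
  by exists C => //; rewrite riU.
have mC := borel_compact hK cC.
have [v [cv v01 v1 [D [cD DU vD]]]] := urysohn_compact R hK lcK cC oU CU.
have cv' : Ccr v by split => //; exists D.
exists v => //.
have mUA : measurable (U `\` A : set (borel K)) by exact: measurableD.
have mUC : measurable (U `\` C : set (borel K)) by exact: measurableD.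
have fC : omega C \is a fin_num.
  by rewrite ge0_fin_numE// omega_ltoo.
have UAe : (omega (U `\` A) <= (eps / 2)%:E)%E.
  rewrite measureD//; last by rewrite -ge0_fin_numE.
  by rewrite (setIidr AU) leeBlDr// addeC ltW.
have UCe : (omega (U `\` C) <= (eps / 2)%:E)%E.
  rewrite measureD//; last by rewrite -ge0_fin_numE.
  by rewrite (setIidr CU) leeBlDr// addeC -leeBlDr// ltW.
have [iUA eUA] := integrable_indic_fin mUA (le_lt_trans UAe (ltry _)).
have [iUC eUC] := integrable_indic_fin mUC (le_lt_trans UCe (ltry _)).
apply: (@le_trans _ _ (\int[omega]_y (\1_(U `\` A) y + \1_(U `\` C) y))).
  apply: (le_Rintegral mT (integrable_norm (RintegrableB mT iA (omega_int cv'))) (RintegrableD mT iUA iUC)).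
  move=> y _ /=; rewrite !indicE.
  have [yU|nU] := pselect (U y); last first.
    have nA : y \in A = false by apply/negbTE/negP => /set_mem/AU.
    have -> : v y = 0 by apply/eqP/negPn/negP => /vD/DU.
    by rewrite nA subrr normr0 addr_ge0.
  have /andP[v0 v1'] := v01 y.
  have [yA|nA] := pselect (A y).
    rewrite (mem_set yA).
    have [yC|nC] := pselect (C y); first by rewrite v1// subrr normr0 addr_ge0.
    have -> : y \in U `\` C by rewrite inE.
    rewrite ger0_norm ?subr_ge0//.
    by rewrite -[leLHS]add0r lerD// lerBlDr lerDl.
  have -> : y \in A = false by apply/negbTE/negP => /set_mem.
  have -> : y \in U `\` A by rewrite inE.
  by rewrite sub0r normrN ger0_norm// -[leLHS]addr0 lerD.
rewrite (RintegralD mT iUA iUC) eUA eUC (splitr eps) lerD//.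
  by rewrite -lee_fin fineK// ge0_fin_numE// (le_lt_trans UAe)// ltry.
by rewrite -lee_fin fineK// ge0_fin_numE// (le_lt_trans UCe)// ltry.
Qed.

Lemma dense_Ccr (f : K -> R) (D : set K) (eps : R) : locint f -> compact D -> 0 < eps ->
  exists2 v, Ccr v & \int[omega]_y `|(f \_ D) y - v y| <= eps.
Proof.
move=> [mf fi] cD eps0; have mD := borel_compact hK cD.
have d0 : 0 < eps / 2 by rewrite divr_gt0.
have [g_ [gi _ gl]] := approximation_sfun_integrable mD (fi D cD).
have /fine_cvgP[gfin /cvgrPdist_lt/(_ _ d0) gl'] := gl.
have [n [gn fn]] := filter_ex (filterI gl' gfin).
pose g : K -> R := g_ n.
have ag : approximable (g \_ D).
  have [s gs] : exists s : seq R, forall x, g x = \sum_(r <- s) r * \1_(g_ n @^-1` [set r]) x.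
    by eexists => x; rewrite /g (fimfunE (g_ n) x) fsbig_finite.
  (* Intersecting with the compact set [D] gives every level set finite measure, that of the value 0
     included. *)
  have -> : g \_ D = fun x => \sum_(r <- s) r * \1_((g_ n @^-1` [set r]) `&` D) x.
    apply/funext => x; rewrite patchE gs; case: ifPn => xD.
      by apply: eq_bigr => r _; rewrite !indicE in_setI xD andbT.
    rewrite big1// => r _; rewrite indicE in_setI (negbTE xD) andbF.
    by rewrite mulr0.
  have as_ (l : seq R) : approximable (fun x => \sum_(r <- l) r * \1_((g_ n @^-1` [set r]) `&` D) x).
    elim: l => [|r l IH].
      have := approximableZ 0 (approximable_indic measurable0 _).
      under [in X in _ -> X]eq_fun do rewrite big_nil.
      by under [in X in (_ -> X) -> _]eq_fun do rewrite mul0r; apply; rewrite measure0.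
    under eq_fun do rewrite big_cons; apply: approximableD => //; apply: approximableZ.
    apply: approximable_indic; first by apply: measurableI.
    apply: le_lt_trans (omega_ltoo cD); apply: le_measure; rewrite ?inE//.
    by apply: measurableI.
  exact: as_.
have [v cv hv] := ag.2 _ d0.
exists v => //.
have ifD := locint_restrict (conj mf fi) cD.
have i1 := integrable_norm (RintegrableB mT ifD ag.1).
have i2 := integrable_norm (RintegrableB mT ag.1 (omega_int cv)).
have i3 := integrable_norm (RintegrableB mT ifD (omega_int cv)).
apply: le_trans (_ : \int[omega]_y `|(f \_ D) y - (g \_ D) y| + \int[omega]_y `|(g \_ D) y - v y| <= _).
  rewrite -(RintegralD mT i1 i2); apply: (le_Rintegral mT i3 (RintegrableD mT i1 i2)).
  by move=> y _ /=; rewrite -(subrKA ((g \_ D) y)) ler_normD.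
rewrite (splitr eps) lerD// ltW//.
move: gn; rewrite sub0r normrN => /(le_lt_trans (ler_norm _)).
congr (_ < _); rewrite [RHS](@Rintegral_supported _ _ _ omega D).
  by apply: eq_Rintegral => y yD; rewrite !patchE yD.
move=> y; rewrite !patchE; case: ifPn => [/set_mem//|_].
by rewrite subrr normr0 eqxx.
Qed.

End density.

Lemma le_Rintegral_subset d (T : measurableType d) (mu : {measure set T -> \bar R})
    (A B : set T) (h : T -> R) : measurable A -> measurable B -> A `<=` B ->
  (forall t, 0 <= h t) -> mu.-integrable B (EFin \o h) ->
  \int[mu]_(t in A) h t <= \int[mu]_(t in B) h t.
Proof.
move=> mA mB AB h0 hi; apply: fine_le.
- exact: integrable_fin_num (integrableS mB mA AB hi).
- exact: integrable_fin_num hi.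
- apply: ge0_subset_integral => //; first exact: measurable_int hi.
  by move=> t _; rewrite lee_fin.
Qed.

Lemma continuous_Rintegral_left (G : K * K -> R) (C : set K) : compact C -> continuous G ->
  continuous (fun y => \int[omega]_(x in C) G (x, y)).
Proof.
move=> cC cG; have mC := borel_compact hK cC.
have cG' : continuous (fun z : K * K => G (z.2, z.1)).
  move=> z; apply: (@continuous_comp _ _ _ (fun z : K * K => (z.2, z.1)) G); last exact: cG.
  by apply: cvg_pair; [exact: cvg_snd|exact: cvg_fst].
have := continuous_Rintegral_param mC (@subset_refl _ C) cC cG' (finite_integrable_cst (1 : R) mC (omega_ltoo cC)).
rewrite (_ : (fun y => _) = fun y => \int[omega]_(x in C) G (x, y))//.
by apply/funext => y; apply: eq_Rintegral => x _; rewrite mulr1.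
Qed.

(** By symmetry k(x^- * y) = k(y^- * x), whose integral over all x is that of [k] by invariance. *)
Lemma kernel_mass_le k (C : set K) y : Ccr k -> (forall x, 0 <= k x) ->
  (forall x, k (inv x) = k x) -> compact C ->
  \int[omega]_(x in C) tau k (inv x) y <= \int[omega]_x k x.
Proof.
move=> ck k0 ksym cC; have mC := borel_compact hK cC.
have kE : k \o inv = k by apply/funext => t; exact: ksym.
have cty : Ccr (tau k (inv y)) by exact: Ccr_tau.
have -> : \int[omega]_(x in C) tau k (inv x) y = \int[omega]_(x in C) tau k (inv y) x.
  apply: eq_Rintegral => x _; rewrite -[in LHS]kE tau_inv ?hinvK//.
  by case: ck.
rewrite -(haar_tau (inv y) ck) Rintegral_mkcond.
have ir := locint_restrict (locint_continuous cty.1) cC.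
apply: (le_Rintegral (@measurableT _ (borel K)) ir (omega_int cty)) => x _.
by rewrite patchE; case: ifPn => // _; exact: tau_ge0.
Qed.

(** In contrast with [tau_inv_support], the compact set is found before the kernel is chosen. *)
Lemma tau_inv_small (C V : set K) : compact C -> compact V ->
  exists2 E, compact E & forall k, Ccr k -> (forall x, k x != 0 -> V x) ->
    forall x y, C x -> tau k (inv x) y != 0 -> E y.
Proof.
move=> cC cV; have [E cE HE] := supp_compact_union cC cV.
exists E => // k [ck _] kV x y Cx /tau_neq0[//|t St /kV Vt].
exact: (HE x t Cx Vt y (supp_swap St)).
Qed.

(** A three-epsilon argument. Let [v] in C_c be close to [f] in L^1(E), where [E] contains [C] and
    every point that the smoothing sees from [C]. Smoothing f - v does not increase its L^1 norm, by
    Fubini and [kernel_mass_le], and v * k is uniformly close to [v] on [C]. *)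
Lemma smooth_L1 (f : K -> R) (C : set K) (eps : R) : locint f -> compact C -> 0 < eps ->
  exists2 V, nbhs e V & forall k, kernel_in V k ->
    \int[omega]_(x in C) `|smooth k f x - f x| <= eps.
Proof.
move=> lf cC eps0; have mC := borel_compact hK cC.
have [V0 [cV0 nV0 _]] := compact_nbhd_in R hK lcK (@filterT _ (nbhs e) _).
have [E0 cE0 HE0] := tau_inv_small cC cV0.
pose E := E0 `|` C; have cE : compact E by exact: compactU.
have mE := borel_compact hK cE.
have d0 : 0 < eps / 3 by rewrite divr_gt0.
have [v cCv hv] := dense_Ccr lf cE d0.
have [cv1 _] := cCv.
have e'0 : 0 < eps / 3 / (fine (omega C) + 1) by rewrite divr_gt0// ltr_wpDl// fine_ge0.
have [V1 nV1 HV1] := kernel_approx_int cv1 cC e'0.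
exists (V0 `&` V1); first exact: filterI.
move=> k kV; have [ck k0 ksym k1 kV'] := kV.
have kV0 := kernel_inS (@subIsetl _ _ _) kV.
have {}HV1 := HV1 k (kernel_inS (@subIsetr _ _ _) kV).
have suppE x y : C x -> tau k (inv x) y != 0 -> E y.
  by move=> Cx h; left; apply: (HE0 k ck _ x y Cx h) => z /kV'[].
have [mf fi] := lf.
pose w y := f y - v y.
have lw : locint w.
  split; first by apply: measurable_funB => //; exact: continuous_borel.
  move=> D cD; have mD := borel_compact hK cD.
  by apply: (RintegrableB mD (fi D cD) (Ccr_integrable_on cD cv1)).
have cvB x : smooth k f x = smooth k w x + smooth k v x.
  have lv := locint_continuous cv1.
  have ctk : Ccr (tau k (inv x)) by exact: Ccr_tau.
  rewrite /smooth -(RintegralD (@measurableT _ (borel K)) (locint_integrable lw ctk) (locint_integrable lv ctk)).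
  by apply: eq_Rintegral => y _; rewrite -mulrDr subrK.
have iabsw : omega.-integrable E (EFin \o (fun y => `|w y|)) by exact: integrable_norm (lw.2 E cE).
pose W x := \int[omega]_(y in E) (tau k (inv x) y * `|w y|).
have cW : continuous W.
  exact: (continuous_Rintegral_param mE (@subset_refl _ E) cE (continuous_tau_invl ck) iabsw).
have iw' : omega.-integrable C (EFin \o (fun x => `|v x - f x|)).
  exact: integrable_norm (RintegrableB mC (Ccr_integrable_on cC cv1) (fi C cC)).
have ccvf := smooth_continuous ck lf.
have hvE : \int[omega]_(y in E) `|w y| <= eps / 3.
  apply: le_trans hv; rewrite Rintegral_mkcond.
  have i1 := locint_restrict (f := fun y => `|w y|) _ cE.
  have i2 := integrable_norm (RintegrableB (@measurableT _ (borel K)) (locint_restrict lf cE) (omega_int cCv)).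
  apply: (le_Rintegral (@measurableT _ (borel K)) (i1 _) i2).
    split; last by move=> D cD; exact: integrable_norm (lw.2 D cD).
    by apply: measurableT_comp => //; exact: lw.1.
  move=> y _ /=; rewrite !patchE; case: ifPn => // _; exact: normr_ge0.
have iWc : omega.-integrable C (EFin \o W) by exact: Ccr_integrable_on.
have ic : omega.-integrable C (EFin \o (fun=> eps / 3 / (fine (omega C) + 1))).
  exact: (finite_integrable_cst _ mC (omega_ltoo cC)).
apply: le_trans (_ : \int[omega]_(x in C) ((W x + eps / 3 / (fine (omega C) + 1)) + `|v x - f x|) <= _).
  apply: le_Rintegral => //.
  - exact: integrable_norm (RintegrableB mC (Ccr_integrable_on cC ccvf) (fi C cC)).
  - exact: (RintegrableD mC (RintegrableD mC iWc ic) iw').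
  move=> x Cx; rewrite -(subrKA (v x)) (le_trans (ler_normD _ _))// lerD2r.
  rewrite cvB -addrA (le_trans (ler_normD _ _))// lerD//; last exact: HV1.
  rewrite (smooth_on w (fun y => @suppE x y Cx)).
  have iE : omega.-integrable E (EFin \o (fun y => tau k (inv x) y * w y)).
    exact: (integrableM_continuous mE (@subset_refl _ E) cE (Ccr_tau (inv x) ck).1 (lw.2 E cE)).
  apply: le_trans (le_normr_Rintegral mE iE) _.
  rewrite le_eqVlt; apply/orP; left; apply/eqP; apply: eq_Rintegral => y _.
  by rewrite normrM ger0_norm// tau_ge0.
rewrite (RintegralD mC (RintegrableD mC iWc ic) iw') (RintegralD mC iWc ic) Rintegral_cst//.
have epsE : eps = eps / 3 + eps / 3 + eps / 3 by field.
rewrite [leRHS]epsE.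
apply: lerD; first apply: lerD.
- rewrite (fubini_compact hK cC cE (continuous_tau_invl ck) (omega_ltoo cC) iabsw).
  apply: le_trans hvE; apply: le_Rintegral => //.
    have cL := continuous_Rintegral_left cC (continuous_tau_invl ck).
    exact: (integrableM_continuous mE (@subset_refl _ E) cE cL iabsw).
  move=> y Ey; rewrite ler_piMl// -k1; exact: kernel_mass_le.
- rewrite mulrAC ler_pdivrMr ?ltr_wpDl ?fine_ge0// ler_pM2l// lerDl//.
- apply: le_trans hvE; rewrite (@eq_Rintegral _ _ _ omega C (fun x => `|w x|)).
    by apply: le_Rintegral_subset => // x Cx; right.
  by move=> x _; rewrite distrC.
Qed.

(** * The translates of an indicator function *)

Lemma translate_indicE (U : set K) x y : measurable (U : set (borel K)) ->
  translate_indic H U x y = fine (P x y U).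
Proof. by move=> mU; rewrite /translate_indic /Rintegral integral_indic// setIT. Qed.

Lemma hpt_fineK x y (A : set K) : measurable (A : set (borel K)) -> ((fine (P x y A))%:E = P x y A)%E.
Proof. by move=> mA; rewrite fineK// ge0_fin_numE// hpt_ltoo. Qed.

Lemma translate_indic_le1 (U : set K) x y : measurable (U : set (borel K)) ->
  0 <= translate_indic H U x y <= 1.
Proof.
move=> mU; rewrite translate_indicE// fine_ge0//= -lee_fin hpt_fineK//.
exact: probability_le1.
Qed.

Transparent tau.

Lemma translate_indic_le_tau (U : set K) (v : K -> R) x y : measurable (U : set (borel K)) ->
  continuous v -> (forall t, \1_U t <= v t) -> translate_indic H U x y <= tau v x y.
Proof.
move=> mU cv h; apply: le_Rintegral => //; last exact: hpt_integrable.
exact: integrable_indic.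
Qed.

Lemma tau_le_translate_indic (U : set K) (v : K -> R) x y : measurable (U : set (borel K)) ->
  continuous v -> (forall t, v t <= \1_U t) -> tau v x y <= translate_indic H U x y.
Proof.
move=> mU cv h; apply: le_Rintegral => //; first exact: hpt_integrable.
exact: integrable_indic.
Qed.

Opaque tau.

Let open_of_nbhs (A : set K) : (forall y, A y -> nbhs y A) -> open A.
Proof. by rewrite openE. Qed.

(** By inner regularity and Urysohn, [P x y O] is the supremum of the continuous functions [tau v x]
    over [v] in C_c between 0 and the indicator of [O]. *)
Lemma open_hpt_gt x (O : set K) (c : R) : open O -> open [set y | (c%:E < P x y O)%E].
Proof.
move=> oO; apply: open_of_nbhs => y cO.
have [_ _ /(_ O oO) ri] := hpt_radon H x y.
have cO' : (c%:E < ereal_sup [set P x y C | C in [set C : set K | compact C /\ C `<=` O]])%E by rewrite -ri.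
have [_ [C [cC CO] <-] h] := ereal_sup_gt cO'.
have mC := borel_compact hK cC; have mO := borel_open oO.
have [v [cv v01 v1 [D [cD DO vD]]]] := urysohn_compact R hK lcK cC oO CO.
have cCv : Ccr v by split => //; exists D.
have cv' : c < tau v x y.
  apply: lt_le_trans (translate_indic_le_tau x y mC cv _).
    by rewrite translate_indicE// -lte_fin hpt_fineK.
  move=> t; rewrite indicE; have [tC|nC] := pselect (C t).
    by rewrite (mem_set tC) v1.
  have -> : t \in C = false by apply/negbTE/negP => /set_mem.
  by case/andP: (v01 t).
have oU : open [set t | c < tau v x t].
  by apply: (@open_comp _ _ (tau v x) [set r | c < r]);
    [move=> t _; exact: (Ccr_tau x cCv).1|exact: open_gt].
apply: filterS (open_nbhs_nbhs (conj oU cv')) => t /= ct.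
rewrite -hpt_fineK// lte_fin -translate_indicE//; apply: lt_le_trans ct _.
apply: tau_le_translate_indic => // s; rewrite indicE.
have [->|/vD/DO sO] := eqVneq (v s) 0; first exact: ler0n.
by rewrite (mem_set sO); case/andP: (v01 s).
Qed.

(* For open A the function is lower semicontinuous; the general case follows by
   Dynkin's pi-lambda theorem. *)
Lemma measurable_hpt x (A : set (borel K)) : measurable A ->
  measurable_fun [set: borel K] (fun y : borel K => P x y A : \bar R).
Proof.
move=> mA; apply: (@dynkin_induction _ (borel K) (@open K)
  (fun A => measurable_fun [set: borel K] (fun y : borel K => P x y A : \bar R))) => //.
- by move=> A' B oA oB; exact: openI.
- rewrite (_ : (fun y => _) = cst 1%E)//; apply/funext => y; exact: probability_setT.
- move=> O oO; apply: (measurability _ (ErealGenOInfty.measurableE R)).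
  move=> _ [_ [c ->] <-]; rewrite setTI.
  rewrite (_ : _ @^-1` _ = [set y | (c%:E < P x y O)%E]).
    by apply: borel_open; exact: open_hpt_gt.
  by apply/seteqP; split => y /=; rewrite in_itv/= andbT.
- move=> S0 mS IH; rewrite (_ : (fun y => _) = fun y => (1 - P x y S0)%E).
    exact: emeasurable_funB.
  by apply/funext => y; exact: probability_setC.
- move=> F mF tF IH.
  rewrite (_ : (fun y => _) = fun y => (\sum_(n <oo | n \in xpredT) P x y (F n))%E).
    by apply: ge0_emeasurable_sum.
  apply/funext => y; rewrite measure_bigcup//.
  by apply: eq_eseriesl => n; rewrite in_setT.
Qed.

Lemma measurable_translate_indic (U : set K) x : measurable (U : set (borel K)) ->
  measurable_fun [set: borel K] (fun y : borel K => translate_indic H U x y).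
Proof.
move=> mU; apply/measurable_EFinP.
rewrite (_ : _ \o _ = (fun y : borel K => P x y U : \bar R)); first exact: measurable_hpt.
by apply/funext => y /=; rewrite translate_indicE// hpt_fineK.
Qed.

(** * Bounds on smoothings and powers of positive definite functions *)

Local Notation normc := ComplexField.Normc.normc.

Lemma normc_real (w : R) : normc (w%:C%C) = `|w|.
Proof. by rewrite /= expr0n/= addr0 sqrtr_sqr. Qed.

Lemma normc_ge0 (z : R[i]) : 0 <= normc z.
Proof. by case: z => a b; exact: sqrtr_ge0. Qed.

Lemma normc_Re (z : R[i]) : `|complex.Re z| <= normc z.
Proof. by case: z => a b /=; rewrite -sqrtr_sqr ler_wsqrtr// lerDl sqr_ge0. Qed.

Lemma normc_Im (z : R[i]) : `|complex.Im z| <= normc z.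
Proof. by case: z => a b /=; rewrite -sqrtr_sqr ler_wsqrtr// lerDr sqr_ge0. Qed.

Lemma normc_le_ReIm (a b : R) : normc (a +i* b)%C <= `|a| + `|b|.
Proof.
rewrite /= -[leRHS]ger0_norm ?addr_ge0// -sqrtr_sqr ler_wsqrtr//.
rewrite sqrrD !real_normK ?num_real// -addrA lerD2l lerDr.
by rewrite mulrn_wge0// mulr_ge0.
Qed.

Lemma measurable_normc (f : K -> R[i]) : cmeasurable f ->
  measurable_fun [set: borel K] (fun y : borel K => normc (f y)).
Proof.
move=> [mr mi].
rewrite (_ : (fun y => _) = (fun y : borel K => Num.sqrt (complex.Re (f y) ^+ 2 + complex.Im (f y) ^+ 2))).
  apply: measurableT_comp; first by apply: continuous_measurable_fun; exact: sqrt_continuous.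
  by apply: measurable_funD; exact: measurable_funX.
by apply/funext => y; case: (f y).
Qed.

Lemma amalgam1_bound (f : K -> R[i]) (U : set K) : measurable (U : set (borel K)) ->
  (amalgam_norm H omega 1 U f < +oo)%E ->
  exists A : R, forall x, (\int[omega]_y (normc (f y) * translate_indic H U x y)%:E <= A%:E)%E.
Proof.
move=> mU fin.
have ge0 x : (0 <= \int[omega]_y (normc (f y) * translate_indic H U x y)%:E)%E.
  apply: integral_ge0 => y _; rewrite lee_fin mulr_ge0 ?normc_ge0//.
  by case/andP: (translate_indic_le1 x y mU).
have le x : (\int[omega]_y (normc (f y) * translate_indic H U x y)%:E <= amalgam_norm H omega 1 U f)%E.
  apply: ereal_sup_ubound; exists x => //.
  rewrite /Lpnorm Lnorm1; apply: eq_integral => y _ /=.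
  have [w0 _] := andP (translate_indic_le1 x y mU).
  rewrite invr1 powRr1// ComplexField.Normc.normcM normc_real (ger0_norm w0).
  by rewrite ger0_norm// mulr_ge0// normc_ge0.
have fn : amalgam_norm H omega 1 U f \is a fin_num.
  by rewrite ge0_fin_numE//; apply: le_trans (le e).
by exists (fine (amalgam_norm H omega 1 U f)) => x; rewrite fineK.
Qed.

(** Membership in (L^1, l^oo) enters here: [k] is at most [B] times the indicator of [U], so its
    translates are at most [B] times the weights of the amalgam norm. *)
Lemma smooth_bounded (f : K -> R[i]) (h : K -> R) (U : set K) (A B : R) k x : cmeasurable f -> locint h ->
  (forall y, `|h y| <= normc (f y)) -> measurable (U : set (borel K)) ->
  (\int[omega]_y (normc (f y) * translate_indic H U (inv x) y)%:E <= A%:E)%E ->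
  kernel_in U k -> 0 <= B -> (forall y, k y <= B) -> `|smooth k h x| <= B * A.
Proof.
move=> mf lh hf mU fA [ck k0 _ _ kU] B0 kB.
have ctk : Ccr (tau k (inv x)) by exact: Ccr_tau.
have ih := locint_integrable lh ctk.
apply: le_trans (le_normr_Rintegral (@measurableT _ (borel K)) ih) _.
have iah := integrable_norm ih.
rewrite -lee_fin /Rintegral fineK; last exact: integrable_fin_num iah.
have mt := measurable_translate_indic (inv x) mU.
have mprod : measurable_fun [set: borel K] (fun y : borel K => (normc (f y) * translate_indic H U (inv x) y)%:E).
  by apply/measurable_EFinP; apply: measurable_funM => //; exact: measurable_normc.
apply: (@le_trans _ _ (B%:E * \int[omega]_y (normc (f y) * translate_indic H U (inv x) y)%:E)%E); last first.
  by rewrite EFinM lee_wpmul2l.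
rewrite -ge0_integralZl_EFin//; last first.
  move=> y _; rewrite lee_fin mulr_ge0 ?normc_ge0//.
  by case/andP: (translate_indic_le1 (inv x) y mU).
apply: ge0_le_integral => //.
- by apply/measurable_EFinP; apply: measurableT_comp => //; apply/measurable_EFinP; exact: measurable_int ih.
- by apply: measurable_funeM.
move=> y _; rewrite lee_fin normrM ger0_norm ?tau_ge0// mulrC.
have tk : tau k (inv x) y <= B * translate_indic H U (inv x) y.
  (* [tau_le_translate_indic] compares with the indicator itself, so [k] is divided by [B]; if [B]
     is zero then [k] vanishes. *)
  have [B00|B1] := eqVneq B 0.
    rewrite B00 mul0r; apply: tau_le_cst; first by case: ck.
    by move=> z; rewrite -B00.
  rewrite mulrC -ler_pdivrMr ?lt_neqAle ?B0 1?eq_sym ?B1//.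
  rewrite mulrC -tauZ; last by case: ck.
  apply: tau_le_translate_indic => //.
    by move=> z; apply: cvgM; [exact: cvg_cst|case: ck => + _; exact].
  move=> t; rewrite indicE; have [tU|nU] := pselect (U t).
    rewrite (mem_set tU) mulrC ler_pdivrMr ?mul1r ?kB// lt_neqAle B0 eq_sym B1//.
  have -> : k t = 0 by apply/eqP/negPn/negP => /kU.
  by rewrite mulr0.
rewrite mulrCA; apply: ler_pM => //; exact: tau_ge0.
Qed.

Lemma csmooth_bounded (f : K -> R[i]) (U : set K) : measurable (U : set (borel K)) ->
  (amalgam_norm H omega 1 U f < +oo)%E -> loc_integrable omega f ->
  forall k, kernel_in U k -> exists M, forall x, normc (csmooth k f x) <= M.
Proof.
move=> mU fin lf k kU; have [lr li] := loc_integrable_ReIm lf; have [mf _] := lf.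
have [A HA] := amalgam1_bound mU fin.
have [ck k0 _ _ _] := kU; have [B B0 kB] := Ccr_bounded ck.
have kB' y : k y <= B by exact: le_trans (ler_norm _) (kB y).
exists (B * A + B * A) => x.
apply: le_trans (normc_le_ReIm _ _) _; rewrite lerD//.
  by apply: (smooth_bounded mf lr _ mU (HA (inv x)) kU B0 kB') => y; exact: normc_Re.
by apply: (smooth_bounded mf li _ mU (HA (inv x)) kU B0 kB') => y; exact: normc_Im.
Qed.

(* Convexity: the tangent line at A, used for Jensen's inequality. *)
Lemma tangent_expr_le (n : nat) (A t : R) : 0 <= A -> 0 <= t ->
  A ^+ n.+1 + n.+1%:R * A ^+ n * (t - A) <= t ^+ n.+1.
Proof.
move=> A0 t0; elim: n => [|n IH]; first by rewrite !expr1 expr0 mulr1 mul1r addrC subrK.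
have : 0 <= t * (t ^+ n.+1 - (A ^+ n.+1 + n.+1%:R * A ^+ n * (t - A))) + n.+1%:R * A ^+ n * (t - A) ^+ 2.
  by rewrite addr_ge0// mulr_ge0 ?subr_ge0 ?sqr_ge0// mulr_ge0// exprn_ge0.
rewrite -[in X in _ -> X]subr_ge0 => /le_trans; apply.
rewrite le_eqVlt; apply/orP; left; apply/eqP; rewrite !exprS -[n.+2]addn1 natrD.
by ring.
Qed.

(** Truncation makes the power Lipschitz, so that L^1 convergence alone carries an upper bound to
    the limit. The inequality is the tangent line at the truncation of [a], whose slope is at most
    [n.+1%:R * N ^+ n]. *)
Lemma min_expr_lipschitz (n : nat) (a b N : R) : 0 <= a -> 0 <= b -> 0 <= N ->
  Num.min a N ^+ n.+1 <= Num.min b N ^+ n.+1 + n.+1%:R * N ^+ n * `|a - b|.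
Proof.
move=> a0 b0 N0; set A := Num.min a N; set t := Num.min b N.
have A0 : 0 <= A by rewrite le_min a0.
have t0 : 0 <= t by rewrite le_min b0.
have AN : A <= N by rewrite ge_min lexx orbT.
have At : A - t <= `|a - b|.
  rewrite /A /t; case: (leP a N) => aN; case: (leP b N) => bN.
  - exact: ler_norm.
  - by rewrite (le_trans _ (normr_ge0 _))// subr_le0.
  - by rewrite (le_trans _ (ler_norm _))// lerB// ltW.
  - by rewrite subrr.
have := tangent_expr_le n A0 t0.
rewrite -lerBrDr => /le_trans; apply; rewrite lerD2l -mulrN opprB.
apply: (@le_trans _ _ (n.+1%:R * A ^+ n * `|a - b|)).
  by rewrite ler_wpM2l// mulr_ge0// exprn_ge0.
by rewrite ler_wpM2r// ler_wpM2l// lerXn2r.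
Qed.

(** The form of the conjugate function is the conjugate of the form of [F] with conjugated
    coefficients. *)
Lemma Pb_conj (F : K -> R[i]) : Pb H F -> Pb H (fun x => Num.conj (F x)).
Proof.
move=> [[cr ci] [M FM] [[mr mi] lb pd]].
have cE (w : R[i]) : Num.conj w = w^*%C by [].
have Nconj (w : R[i]) : normc (Num.conj w) = normc w by rewrite cE; case: w => a b /=; rewrite sqrrN.
have ReE x : complex.Re (Num.conj (F x)) = complex.Re (F x) by rewrite cE; case: (F x).
have ImE x : complex.Im (Num.conj (F x)) = - complex.Im (F x) by rewrite cE; case: (F x).
have tE a b : translate H (fun x => Num.conj (F x)) a b = Num.conj (translate H F a b).
  rewrite cE !translateE /=; congr (_ +i* _)%C.
    by congr (tau _ _ _); apply/funext => t; rewrite ReE.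
  rewrite -mulN1r -tauZ//; congr (tau _ _ _); apply/funext => t.
  by rewrite ImE mulN1r.
split.
- split; first by under eq_fun do rewrite ReE.
  by under eq_fun do rewrite ImE; move=> x; apply: cvgN; exact: ci.
- by exists M => x; rewrite Nconj.
split.
- split; first by under eq_fun do rewrite ReE.
  by under eq_fun do rewrite ImE; exact: measurable_funN.
- by move=> x; have [M' h] := lb x; exists M'; apply: filterS h => y; rewrite Nconj.
move=> n c x; have := pd n (fun i => Num.conj (c i)) x.
rewrite -conjC_ge0 rmorph_sum => /le_trans; apply.
rewrite le_eqVlt; apply/orP; left; apply/eqP; apply: eq_bigr => i _.
rewrite rmorph_sum; apply: eq_bigr => j _; rewrite tE !rmorphM.
by congr (_ * _ * _); exact: conjCK.
Qed.

Hypothesis HPb : forall f g : K -> R[i], Pb H f -> Pb H g -> Pb H (fun x => f x * g x).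

(** [m.+1.*2] runs over the positive even integers; parity matters because only |F|^2 = F conj(F) is
    a product of functions in [Pb]. *)
Lemma Pb_normc_even (F : K -> R[i]) (m : nat) : Pb H F ->
  Pb H (fun x => (normc (F x) ^+ (m.+1.*2))%:C%C).
Proof.
move=> pF; have pc := HPb pF (Pb_conj pF).
have E x : F x * Num.conj (F x) = (normc (F x) ^+ 2)%:C%C.
  have cE (w : R[i]) : Num.conj w = w^*%C by [].
  rewrite cE; case: (F x) => a b /=; rewrite sqr_sqrtr ?addr_ge0 ?sqr_ge0//.
  by apply/eqP; rewrite eq_complex /=; apply/andP; split; apply/eqP; ring.
elim: m => [|m IH]; first by under eq_fun do rewrite -E.
have := HPb pc IH; congr Pb; apply/funext => x.
by rewrite E -rmorphM /= -exprD doubleS.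
Qed.

(** * Covering by translates and the estimates *)

(** One translation serves the covering of [U], the other is the [x] of the amalgam norm. The left
    side is the average over eps_(z^-) * eps_(x^-) of integrals with a single translation, so it
    obeys the same bound. *)
Lemma Pb_tau2_star_le (phi u : K -> R) z x : Pb H (fun t => (phi t)%:C%C) ->
  (forall t, 0 <= phi t) -> Ccr u -> (forall t, 0 <= u t) ->
  \int[omega]_y (phi y * tau (tau (star u u) z) x y) <= 4 * \int[omega]_y (phi y * star u u y).
Proof.
move=> pphi phi0 cu u0; have [[cphi _] _ _] := pphi.
have cphi' : continuous phi by exact: cphi.
have ck := Ccr_star cu cu; have lphi := locint_continuous cphi'.
have -> : \int[omega]_y (phi y * tau (tau (star u u) z) x y) = tau (smooth (star u u) phi) (inv z) (inv x).
  rewrite (tau_smooth (inv z) (inv x) ck lphi) !hinvK.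
  by apply: eq_Rintegral => y _; rewrite mulrC.
apply: tau_le_cst; first exact: smooth_continuous.
move=> r; apply: le_trans (Pb_tau_star_le (inv r) pphi phi0 cu u0).
by rewrite le_eqVlt; apply/orP; left; apply/eqP; apply: eq_Rintegral => y _; rewrite mulrC.
Qed.

(** [g] is a sum of finitely many rescaled translates of [star u u], and [B] adds up their costs,
    which [Pb_tau2_star_le] bounds for all [phi] and [x] at once. *)
Lemma star_cover (u : K -> R) (C : set K) : Ccr u -> (forall t, 0 <= u t) -> 0 < star u u e ->
  compact C -> exists (g : K -> R) (B : R), [/\ 0 <= B, Ccr g, forall t, 0 <= g t,
    forall t, C t -> 1 <= g t &
    forall phi, Pb H (fun t => (phi t)%:C%C) -> (forall t, 0 <= phi t) ->
      forall x, \int[omega]_y (phi y * tau g x y) <= B * \int[omega]_y (phi y * star u u y)].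
Proof.
move=> cu u0 he cC; set h := star u u.
have ch : Ccr h by exact: Ccr_star.
have h0 t : 0 <= h t by apply: Rintegral_ge0 => y _; rewrite mulr_ge0// tau_ge0.
have ig (phi g : K -> R) x : continuous phi -> Ccr g -> omega.-integrable setT (EFin \o (fun y => phi y * tau g x y)).
  by move=> cphi cg; apply: omega_int; apply: CcrM => //; exact: Ccr_tau.
apply: (@compact_set_ind K C (fun A => exists (g : K -> R) (B : R), [/\ 0 <= B, Ccr g, forall t, 0 <= g t,
    forall t, A t -> 1 <= g t &
    forall phi, Pb H (fun t => (phi t)%:C%C) -> (forall t, 0 <= phi t) ->
      forall x, \int[omega]_y (phi y * tau g x y) <= B * \int[omega]_y (phi y * h y)]) cC).
- exists (fun=> 0), 0; split => //.
    split; first exact: cst_continuous.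
    by exists set0 => [|t]; [exact: compact0|rewrite eqxx].
  move=> phi _ _ x; rewrite mul0r (@eq_Rintegral _ _ _ omega setT (fun=> 0)).
    by rewrite Rintegral_cst// mul0r.
  by move=> y _; rewrite tau_cst mulr0.
- move=> A A' [g [B [B0 cg g0 g1 gB]]] [g' [B' [B'0 cg' g'0 g'1 g'B]]].
  exists (fun t => g t + g' t), (B + B'); split.
  + exact: addr_ge0.
  + exact: CcrD.
  + by move=> t; rewrite addr_ge0.
  + move=> t [/g1|/g'1] h1; first by rewrite (le_trans h1)// lerDl.
    by rewrite (le_trans h1)// lerDr.
  + move=> phi pphi phi0 x; have [[cphi _] _ _] := pphi.
    have cphi' : continuous phi by exact: cphi.
    rewrite mulrDl; apply: le_trans (lerD (gB phi pphi phi0 x) (g'B phi pphi phi0 x)).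
    rewrite -(RintegralD (@measurableT _ (borel K)) (ig phi g x cphi' cg) (ig phi g' x cphi' cg')).
    rewrite le_eqVlt; apply/orP; left; apply/eqP; apply: eq_Rintegral => y _.
    by rewrite tauD ?mulrDr//; [case: cg|case: cg'].
- move=> A A' AA [g [B [B0 cg g0 g1 gB]]]; exists g, B; split => // t /AA; exact: g1.
- move=> z _.
  have [w [cw wz w0 wB]] : exists w, [/\ Ccr w, 0 < w z, forall t, 0 <= w t &
      forall phi, Pb H (fun t => (phi t)%:C%C) -> (forall t, 0 <= phi t) ->
      forall x, \int[omega]_y (phi y * tau w x y) <= 4 * \int[omega]_y (phi y * h y)].
    (* This translate is positive at [z], since [h] is positive at [e] and [e] lies in the support
       of eps_(z^-) * eps_z. *)
    exists (tau h (inv z)); split.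
    - exact: Ccr_tau.
    - by apply: (@tau_gt0 h (inv z) z e); [case: ch|exact: h0|exact: supp_invl|exact: he].
    - by move=> t; exact: (tau_ge0 _ _ h0).
    - by move=> phi pphi phi0 x; exact: (Pb_tau2_star_le (inv z) x pphi phi0 cu u0).
  exists [set t | w z / 2 < w t].
    apply: open_nbhs_nbhs; split => /=; last by rewrite ltr_pdivrMr// ltr_pMr// ltr1n.
    by apply: (@open_comp _ _ w [set r | w z / 2 < r]);
      [move=> t _; case: cw => + _; exact|exact: open_gt].
  pose c := (w z / 2)^-1; have c0 : 0 < c by rewrite invr_gt0 divr_gt0.
  exists (fun t => c * w t), (c * 4); split.
  + by rewrite mulr_ge0// ltW.
  + exact: CcrZ.
  + by move=> t; rewrite mulr_ge0// ltW.
  + by move=> t /= /ltW h1; rewrite mulrC ler_pdivlMr ?mul1r// divr_gt0.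
  + move=> phi pphi phi0 x; have [[cphi _] _ _] := pphi.
    have cphi' : continuous phi by exact: cphi.
    rewrite (@eq_Rintegral _ _ _ omega setT (fun y => c * (phi y * tau w x y))); last first.
      by move=> y _; rewrite (tauZ c x y cw.1) mulrCA.
    rewrite (RintegralZl _ (@measurableT _ (borel K)) (ig phi w x cphi' cw)) -mulrA.
    by rewrite (ler_pM2l c0); exact: wB.
Qed.

(** The triangle inequality for integrals defined by real and imaginary parts. With a + ib the value
    and n its modulus, n^2 is the integral of a Re f + b Im f against the kernel, and Cauchy-Schwarz
    bounds this integrand by n |f|. *)
Lemma normc_csmooth_le (f : K -> R[i]) k (D : set K) x : loc_integrable omega f -> Ccr k ->
  (forall t, 0 <= k t) -> compact D -> (forall y, tau k (inv x) y != 0 -> D y) ->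
  normc (csmooth k f x) <= \int[omega]_(y in D) (tau k (inv x) y * normc (f y)).
Proof.
move=> lf ck k0 cD xD; have [lr li] := loc_integrable_ReIm lf; have [mf fi] := lf.
have mD := borel_compact hK cD; have [ctk _] := Ccr_tau (inv x) ck.
have ir : omega.-integrable D (EFin \o (fun y => tau k (inv x) y * complex.Re (f y))).
  exact: (integrableM_continuous mD (@subset_refl _ D) cD ctk (lr.2 D cD)).
have ii : omega.-integrable D (EFin \o (fun y => tau k (inv x) y * complex.Im (f y))).
  exact: (integrableM_continuous mD (@subset_refl _ D) cD ctk (li.2 D cD)).
have ia : omega.-integrable D (EFin \o (fun y => tau k (inv x) y * normc (f y))).
  exact: (integrableM_continuous mD (@subset_refl _ D) cD ctk (fi D cD)).
set I := \int[omega]_(y in D) _.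
have I0 : 0 <= I by apply: Rintegral_ge0 => y _; rewrite mulr_ge0 ?tau_ge0 ?normc_ge0.
rewrite /csmooth (smooth_on _ xD) (smooth_on _ xD).
set a := \int[omega]_(y in D) _; set b := \int[omega]_(y in D) (_ * complex.Im _).
set n := normc _.
have n0 : 0 <= n by exact: normc_ge0.
have n2 : n ^+ 2 = a ^+ 2 + b ^+ 2 by rewrite /n /= sqr_sqrtr// addr_ge0// sqr_ge0.
suff : n * n <= n * I.
  have [->|nn0] := eqVneq n 0; first by [].
  by rewrite ler_pM2l// lt_neqAle eq_sym nn0.
rewrite -expr2 n2 !expr2 -(RintegralZl a mD ir) -(RintegralZl b mD ii) -(RintegralZl n mD ia).
rewrite -(RintegralD mD (RintegrableZ a mD ir) (RintegrableZ b mD ii)).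
apply: (le_Rintegral mD (RintegrableD mD (RintegrableZ a mD ir) (RintegrableZ b mD ii)) (RintegrableZ n mD ia)).
move=> y _; rewrite !(mulrCA _ (tau k (inv x) y)) -mulrDr ler_wpM2l ?tau_ge0//.
rewrite /n; case: (f y) => p q /=.
apply: le_trans (ler_norm _) _; rewrite -sqrtrM ?addr_ge0 ?sqr_ge0// -sqrtr_sqr ler_wsqrtr//.
have -> : (a ^+ 2 + b ^+ 2) * (p ^+ 2 + q ^+ 2) = (a * p + b * q) ^+ 2 + (a * q - b * p) ^+ 2 by ring.
by rewrite lerDl sqr_ge0.
Qed.

(** Jensen's inequality for the probability density [tau k (inv x)], obtained by integrating the
    tangent line at the mean of |f|. *)
Lemma normc_csmooth_expr_le (f : K -> R[i]) k (D : set K) x (n : nat) : loc_integrable omega f -> Ccr k ->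
  (forall t, 0 <= k t) -> \int[omega]_y k y = 1 -> compact D -> (forall y, tau k (inv x) y != 0 -> D y) ->
  omega.-integrable D (EFin \o (fun y => normc (f y) ^+ n.+1)) ->
  normc (csmooth k f x) ^+ n.+1 <= \int[omega]_(y in D) (tau k (inv x) y * normc (f y) ^+ n.+1).
Proof.
move=> lf ck k0 k1 cD xD ip; have [mf fi] := lf.
have mD := borel_compact hK cD; have [ctk _] := Ccr_tau (inv x) ck.
have it : omega.-integrable D (EFin \o tau k (inv x)) by exact: Ccr_integrable_on.
have t1 : \int[omega]_(y in D) tau k (inv x) y = 1.
  by rewrite -k1 -(haar_tau (inv x) ck) [RHS](@Rintegral_supported _ _ _ omega D).
have ia : omega.-integrable D (EFin \o (fun y => tau k (inv x) y * normc (f y))).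
  exact: (integrableM_continuous mD (@subset_refl _ D) cD ctk (fi D cD)).
have iq : omega.-integrable D (EFin \o (fun y => tau k (inv x) y * normc (f y) ^+ n.+1)).
  exact: (integrableM_continuous mD (@subset_refl _ D) cD ctk ip).
have le1 := normc_csmooth_le lf ck k0 cD xD.
set A := \int[omega]_(y in D) _ in le1.
have A0 : 0 <= A by apply: le_trans le1; exact: normc_ge0.
apply: le_trans (_ : A ^+ n.+1 <= _).
  by rewrite lerXn2r// nnegrE; exact: normc_ge0.
(* Intercept and slope of the tangent at [A]. As [A] is the mean of |f|, the tangent line integrates
   to exactly [A ^+ n.+1]. *)
pose c := A ^+ n.+1 - n.+1%:R * A ^+ n * A; pose d := n.+1%:R * A ^+ n.
have -> : A ^+ n.+1 = \int[omega]_(y in D) (c * tau k (inv x) y + d * (tau k (inv x) y * normc (f y))).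
  rewrite (RintegralD mD (RintegrableZ c mD it) (RintegrableZ d mD ia)).
  by rewrite (RintegralZl _ mD it) (RintegralZl _ mD ia) t1 -/A /c /d mulr1 subrK.
apply: (le_Rintegral mD (RintegrableD mD (RintegrableZ c mD it) (RintegrableZ d mD ia)) iq).
move=> y _; have := tangent_expr_le n A0 (normc_ge0 (f y)); have := tau_ge0 (inv x) y k0.
rewrite -/d; have -> : c = A ^+ n.+1 - d * A by [].
move: (tau k (inv x) y) (normc (f y)) => t r t0 /(ler_wpM2l t0); apply: le_trans.
by rewrite le_eqVlt; apply/orP; left; apply/eqP; ring.
Qed.

Lemma continuous_normc (F : K -> R[i]) : ccontinuous F -> continuous (fun x => normc (F x)).
Proof.
move=> [cr ci] x.
rewrite (_ : (fun x => _) = fun x => Num.sqrt (complex.Re (F x) * complex.Re (F x) + complex.Im (F x) * complex.Im (F x))); last first.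
  by apply/funext => y; case: (F y) => a b /=; rewrite -!expr2.
apply: (@continuous_comp _ _ _ (fun x => complex.Re (F x) * complex.Re (F x) + complex.Im (F x) * complex.Im (F x)) (@Num.sqrt R)); last exact: sqrt_continuous.
by apply: cvgD; apply: cvgM; (exact: cr || exact: ci).
Qed.

Lemma continuous_expr (f : K -> R) (n : nat) : continuous f -> continuous (fun x => f x ^+ n).
Proof.
move=> cf; elim: n => [|n IH] x.
  by under eq_fun do rewrite expr0; exact: cst_continuous.
by under eq_fun do rewrite exprS; apply: cvgM; [exact: cf|exact: IH].
Qed.

(** With [h] and [k] both supported in [W], the smoothing at a point where [h] is nonzero sees [f]
    only on [D]. After Jensen and Fubini, [h] is bounded by [B] and the remaining mass of the kernel
    by 1. *)
Lemma Rintegral_normc_csmooth_le (f : K -> R[i]) k (D W : set K) (n : nat) (h : K -> R) (B : R) :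
  loc_integrable omega f -> kernel_in W k -> Ccr h -> (forall t, 0 <= h t <= B) ->
  (forall t, h t != 0 -> W t) -> compact D -> (forall a b, W a -> W b -> S a b `<=` D) ->
  omega.-integrable D (EFin \o (fun y => normc (f y) ^+ n.+1)) ->
  \int[omega]_x (normc (csmooth k f x) ^+ n.+1 * h x) <= B * \int[omega]_(y in D) (normc (f y) ^+ n.+1).
Proof.
move=> lf [ck k0 ksym k1 kW] ch h0B hW cD HW ip.
have [ch1 [C cC hC]] := ch; have mC := borel_compact hK cC; have mD := borel_compact hK cD.
have xD x y : h x != 0 -> tau k (inv x) y != 0 -> D y.
  move=> /hW Wx /tau_neq0[|t /supp_swap St /kW Wt]; first by case: ck.
  exact: (HW x t Wx Wt).
have cG : continuous (fun z : K * K => h z.1 * tau k (inv z.1) z.2).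
  move=> z; apply: cvgM; last exact: continuous_tau_invl.
  by apply: continuous_comp; [exact: cvg_fst|exact: ch1].
have cn := continuous_expr (n := n.+1) (continuous_normc (continuous_csmooth ck lf)).
rewrite (@Rintegral_supported _ _ _ omega C); last first.
  by move=> x; rewrite mulf_eq0 negb_or => /andP[_ /hC].
pose W1 x := \int[omega]_(y in D) (h x * tau k (inv x) y * normc (f y) ^+ n.+1).
apply: (@le_trans _ _ (\int[omega]_(x in C) W1 x)).
  apply: le_Rintegral => //.
  - by apply: Ccr_integrable_on => // x; apply: cvgM; [exact: cn|exact: ch1].
  - apply: Ccr_integrable_on => //.
    exact: (continuous_Rintegral_param mD (@subset_refl _ D) cD cG ip).
  move=> x _; have [hx0|hx] := eqVneq (h x) 0.
    rewrite hx0 mulr0; apply: Rintegral_ge0 => y _.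
    by rewrite hx0 !mul0r.
  have [h0 hB] := andP (h0B x).
  have [ctk _] := Ccr_tau (inv x) ck.
  have iq : omega.-integrable D (EFin \o (fun y => tau k (inv x) y * normc (f y) ^+ n.+1)).
    exact: (integrableM_continuous mD (@subset_refl _ D) cD ctk ip).
  have -> : W1 x = h x * \int[omega]_(y in D) (tau k (inv x) y * normc (f y) ^+ n.+1).
    by rewrite -(RintegralZl _ mD iq); apply: eq_Rintegral => y _; rewrite mulrA.
  rewrite mulrC ler_wpM2l//; apply: normc_csmooth_expr_le => // y; exact: xD.
rewrite (fubini_compact hK cC cD cG (omega_ltoo cC) ip).
have cL := continuous_Rintegral_left cC cG.
have i1 : omega.-integrable D (EFin \o (fun y => (\int[omega]_(x in C) (h x * tau k (inv x) y)) * normc (f y) ^+ n.+1)).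
  exact: (integrableM_continuous mD (@subset_refl _ D) cD cL ip).
rewrite -(RintegralZl _ mD ip); apply: (le_Rintegral mD i1 (RintegrableZ B mD ip)).
move=> y Dy; rewrite ler_wpM2r ?exprn_ge0 ?normc_ge0//.
have B0 : 0 <= B by case/andP: (h0B e) => h0 hB; exact: le_trans hB.
have cty : continuous (fun x => tau k (inv x) y).
  by have := continuous_pairr (x := y) (continuous_tau_invl ck).
have ity : omega.-integrable C (EFin \o (fun x => tau k (inv x) y)) by exact: Ccr_integrable_on.
apply: (@le_trans _ _ (\int[omega]_(x in C) (B * tau k (inv x) y))).
  apply: (le_Rintegral mC _ (RintegrableZ B mC ity)).
    by apply: Ccr_integrable_on => // x; apply: cvgM; [exact: ch1|exact: cty].
  by move=> x _; rewrite ler_wpM2r ?tau_ge0//; case/andP: (h0B x).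
rewrite (RintegralZl _ mC ity) -[leRHS]mulr1 ler_wpM2l// -k1.
exact: kernel_mass_le.
Qed.

Lemma normc_dist (z w : R[i]) :
  `|normc z - normc w| <= `|complex.Re z - complex.Re w| + `|complex.Im z - complex.Im w|.
Proof.
have le_sub (a b : R[i]) : normc a - normc b <= `|complex.Re a - complex.Re b| + `|complex.Im a - complex.Im b|.
  rewrite lerBlDl; apply: (@le_trans _ _ (normc b + normc (a - b))).
    by rewrite -{1}(subrKC b a); exact: le_normcD.
  by rewrite lerD2l; case: a b => a1 a2 [b1 b2]; exact: normc_le_ReIm.
rewrite ler_norml le_sub andbT lerNl opprB.
by apply: le_trans (le_sub w z) _; rewrite distrC (distrC (complex.Im w)).
Qed.

Lemma loc_integrable_normc_dist (f : K -> R[i]) k (C : set K) : loc_integrable omega f -> Ccr k ->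
  compact C -> omega.-integrable C (EFin \o (fun x => `|normc (csmooth k f x) - normc (f x)|)).
Proof.
move=> lf ck cC; have [mf fi] := lf; have mC := borel_compact hK cC.
have cn := continuous_normc (continuous_csmooth ck lf).
exact: integrable_norm (RintegrableB mC (Ccr_integrable_on cC cn) (fi C cC)).
Qed.

Lemma csmooth_L1 (f : K -> R[i]) (C : set K) (eps : R) : loc_integrable omega f -> compact C -> 0 < eps ->
  exists2 V, nbhs e V & forall k, kernel_in V k ->
    \int[omega]_(x in C) `|normc (csmooth k f x) - normc (f x)| <= eps.
Proof.
move=> lf cC eps0; have [lr li] := loc_integrable_ReIm lf; have mC := borel_compact hK cC.
have eps2 : 0 < eps / 2 by rewrite divr_gt0.
have [V nV HV] := smooth_L1 lr cC eps2; have [V' nV' HV'] := smooth_L1 li cC eps2.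
exists (V `&` V') => [|k kV]; first exact: filterI.
have ck : Ccr k by case: kV.
have ir := integrable_norm (RintegrableB mC (Ccr_integrable_on cC (smooth_continuous ck lr)) (lr.2 C cC)).
have ii := integrable_norm (RintegrableB mC (Ccr_integrable_on cC (smooth_continuous ck li)) (li.2 C cC)).
apply: (@le_trans _ _ (\int[omega]_(x in C) (`|smooth k (fun t => complex.Re (f t)) x - complex.Re (f x)| +
  `|smooth k (fun t => complex.Im (f t)) x - complex.Im (f x)|))).
  apply: (le_Rintegral mC (loc_integrable_normc_dist lf ck cC) (RintegrableD mC ir ii)) => x _.
  exact: normc_dist.
rewrite (RintegralD mC ir ii) (splitr eps) lerD//.
  exact: (HV k (kernel_inS (@subIsetl _ _ _) kV)).
exact: (HV' k (kernel_inS (@subIsetr _ _ _) kV)).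
Qed.

(** * Passage to the limit *)

Lemma measurable_truncated (f : K -> R[i]) (w : K -> R) N n : cmeasurable f -> continuous w ->
  measurable_fun [set: borel K] (fun y : borel K => Num.min (normc (f y)) N ^+ n * w y).
Proof.
move=> mf cw; apply: measurable_funM; last exact: continuous_borel.
apply: (@measurable_funX _ _ _ setT (fun y : borel K => Num.min (normc (f y)) N) n).
by apply: measurable_minr => //; exact: measurable_normc.
Qed.

Lemma integrable_truncated (f : K -> R[i]) (w : K -> R) N n : cmeasurable f -> Ccr w ->
  (forall y, 0 <= w y) -> 0 <= N ->
  omega.-integrable setT (EFin \o (fun y => Num.min (normc (f y)) N ^+ n * w y)).
Proof.
move=> mf cw w0 N0; apply: (le_integrable _ _ _ (omega_int (CcrZ (N ^+ n) cw))) => //.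
  by apply/measurable_EFinP; apply: measurable_truncated => //; case: cw.
have m0 y : 0 <= Num.min (normc (f y)) N by rewrite le_min normc_ge0.
move=> y _ /=; rewrite lee_fin !ger0_norm ?mulr_ge0 ?exprn_ge0//.
by rewrite ler_wpM2r// lerXn2r ?nnegrE// ge_min lexx orbT.
Qed.

Lemma truncated_estimate (f : K -> R[i]) (U0 D W : set K) (g h : K -> R) (B Bh N : R) (m : nat) x :
  measurable (U0 : set (borel K)) -> nbhs e U0 ->
  (amalgam_norm H omega 1 U0 f < +oo)%E -> positive_type H omega f ->
  Ccr h -> (forall t, 0 <= h t <= Bh) -> (forall t, h t != 0 -> W t) -> nbhs e W ->
  compact D -> (forall a b, W a -> W b -> S a b `<=` D) ->
  omega.-integrable D (EFin \o (fun y => normc (f y) ^+ m.+1.*2)) ->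
  0 <= B -> Ccr g -> (forall t, 0 <= g t) ->
  (forall phi, Pb H (fun t => (phi t)%:C%C) -> (forall t, 0 <= phi t) ->
      forall x, \int[omega]_y (phi y * tau g x y) <= B * \int[omega]_y (phi y * h y)) ->
  0 <= N ->
  \int[omega]_y (Num.min (normc (f y)) N ^+ m.+1.*2 * tau g x y) <=
    B * (Bh * \int[omega]_(y in D) (normc (f y) ^+ m.+1.*2)).
Proof.
move=> mU0 nU0 finf ptf ch hB hW nW cD HW ip B0 cg g0 gB N0; have [lf _] := ptf.
set n := m.+1.*2; have [mf fi] := lf.
have [ctg [E cE tgE]] := Ccr_tau x cg; have [Mg Mg0 gM] := Ccr_bounded (Ccr_tau x cg).
have mE := borel_compact hK cE.
apply/ler_addgt0Pr => eps eps0.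
(* The Lipschitz constant of the truncated power; [Mg * c] multiplies the L^1 error on [E]. *)
pose c := n%:R * N ^+ n.-1; have c0 : 0 <= c by rewrite mulr_ge0// exprn_ge0.
have cM0 : 0 <= Mg * c by rewrite mulr_ge0.
have d0 : 0 < eps / (Mg * c + 1) by rewrite divr_gt0// ltr_wpDl.
have [V nV HV] := csmooth_L1 lf cE d0.
(* [W] confines the smoothing to [D], [U0] makes it bounded, and [V] makes it close to [f] in
   L^1(E). *)
have [u [[cu u0 usym u1 _] ku _]] := kernel_star (filterI nW (filterI nU0 nV)).
set k := star u u in ku.
have kW : kernel_in W k := kernel_inS (@subIsetl _ _ _) ku.
have kU0 : kernel_in U0 k by apply: kernel_inS ku => t [_ []].
have kV : kernel_in V k by apply: kernel_inS ku => t [_ []].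
have ck : Ccr k by case: ku.
have [M HM] := csmooth_bounded mU0 finf lf kU0.
have pF : Pb H (csmooth k f) := Pb_csmooth ptf cu HM.
have pphi := Pb_normc_even m pF.
have phi0 t : 0 <= normc (csmooth k f t) ^+ n by rewrite exprn_ge0// normc_ge0.
have cn := continuous_normc (continuous_csmooth ck lf).
have iphi : omega.-integrable E (EFin \o (fun y => normc (csmooth k f y) ^+ n * tau g x y)).
  apply: (Ccr_integrable_on cE) => y; apply: cvgM; last exact: ctg.
  exact: (continuous_expr (n := n) cn).
have idist := loc_integrable_normc_dist lf ck cE.
have pt y : Num.min (normc (f y)) N ^+ n * tau g x y <=
    normc (csmooth k f y) ^+ n * tau g x y + Mg * c * `|normc (csmooth k f y) - normc (f y)|.
  have := min_expr_lipschitz m.*2.+1 (normc_ge0 (f y)) (normc_ge0 (csmooth k f y)) N0.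
  rewrite -[m.*2.+2]/n -/c; have := normc_ge0 (csmooth k f y).
  have t0 := tau_ge0 x y g0; have tM : tau g x y <= Mg := le_trans (ler_norm _) (gM y).
  move: (tau g x y) (normc (csmooth k f y)) (normc (f y)) t0 tM => t a b t0 tM a0.
  rewrite distrC => le1.
  have le2 : Num.min a N ^+ n <= a ^+ n.
    by apply: lerXn2r; rewrite ?nnegrE ?le_min ?a0 ?N0// ge_min lexx.
  apply: (@le_trans _ _ ((a ^+ n + c * `|a - b|) * t)).
    by apply: ler_wpM2r => //; apply: le_trans le1 _; rewrite lerD2r.
  by rewrite mulrDl lerD2l -[leRHS]mulrA [leRHS]mulrC ler_wpM2l// mulr_ge0.
rewrite (@Rintegral_supported _ _ _ omega E); last first.
  by move=> y; rewrite mulf_eq0 negb_or => /andP[_ /tgE].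
have isum := RintegrableD mE iphi (RintegrableZ (Mg * c) mE idist).
have imin := integrableS (@measurableT _ (borel K)) mE (@subsetT _ E)
  (integrable_truncated n mf (Ccr_tau x cg) (fun y => tau_ge0 x y g0) N0).
apply: le_trans (le_Rintegral mE imin isum (fun y _ => pt y)) _.
rewrite (RintegralD mE iphi (RintegrableZ (Mg * c) mE idist)) (RintegralZl _ mE idist) lerD//.
  rewrite -(@Rintegral_supported _ _ _ omega E); last first.
    by move=> y; rewrite mulf_eq0 negb_or => /andP[_ /tgE].
  apply: le_trans (gB _ pphi phi0 x) _; rewrite ler_wpM2l//.
  exact: (Rintegral_normc_csmooth_le lf kW ch hB hW cD HW ip).
apply: (@le_trans _ _ (Mg * c * (eps / (Mg * c + 1)))).
  by rewrite ler_wpM2l//; exact: HV.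
by rewrite mulrA ler_pdivrMr ?ltr_wpDl// mulrC mulrDr mulr1 lerDl ltW.
Qed.

Lemma weighted_estimate (f : K -> R[i]) (w : K -> R) (c : R) n : cmeasurable f -> Ccr w ->
  (forall y, 0 <= w y) ->
  (forall N : R, 0 <= N -> \int[omega]_y (Num.min (normc (f y)) N ^+ n * w y) <= c) ->
  (\int[omega]_y (normc (f y) ^+ n * w y)%:E <= c%:E)%E.
Proof.
move=> mf cw w0 Hc.
pose F (i : nat) (y : borel K) := (Num.min (normc (f y)) i%:R ^+ n * w y)%:E.
have lim y : limn (F ^~ y) = (normc (f y) ^+ n * w y)%:E.
  apply: lim_near_cst => //; near=> i; rewrite /F; congr (_ ^+ n * _)%:E.
  by apply/min_idPl; near: i; exact: nbhs_infty_ger.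
have F0 i y : (0 <= F i y)%E.
  by rewrite lee_fin mulr_ge0// exprn_ge0// le_min normc_ge0 ler0n.
have mF i : measurable_fun [set: borel K] (F i).
  by apply/measurable_EFinP; apply: measurable_truncated => //; case: cw.
have ndF y : nondecreasing_seq (F ^~ y).
  move=> i j ij; rewrite lee_fin ler_wpM2r//.
  apply: lerXn2r; rewrite ?nnegrE ?le_min ?normc_ge0 ?ler0n//.
  by rewrite ge_min lexx /= ge_min ler_nat ij orbT.
rewrite (_ : \int[omega]_y _ = \int[omega]_y (limn (F ^~ y)))%E; last first.
  by apply: eq_integral => y _; rewrite lim.
rewrite (@monotone_convergence _ _ _ omega setT (@measurableT _ (borel K)) F)//.
apply: lime_le; last first.
  apply: nearW => i; have it := integrable_truncated n mf cw w0 (ler0n R i).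
  by have := Hc i%:R (ler0n _ i); rewrite -lee_fin /Rintegral fineK//; exact: integrable_fin_num it.
apply: ereal_nondecreasing_is_cvgn => i j ij.
by apply: ge0_le_integral => // y _; exact: ndF.
Unshelve. all: by end_near. Qed.

(** All of these data come from [U] alone, hence so does the final constant. The inclusion of [D] in
    [U] is what leads back to the norm of f 1_U. *)
Lemma rc_nbhd_cover (U : set K) : rc_nbhd H U -> exists (D W : set K) (g h : K -> R) (B Bh : R),
  [/\ [/\ compact D, D `<=` U, nbhs e W & forall a b, W a -> W b -> S a b `<=` D],
      [/\ Ccr h, forall t, 0 <= h t <= Bh & forall t, h t != 0 -> W t],
      [/\ 0 <= B, Ccr g, forall t, 0 <= g t & forall t, U t -> 1 <= g t] &
      forall phi, Pb H (fun t => (phi t)%:C%C) -> (forall t, 0 <= phi t) ->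
      forall x, \int[omega]_y (phi y * tau g x y) <= B * \int[omega]_y (phi y * h y)].
Proof.
case=> nU mU; rewrite precompactE => cU.
have [D [cD nD DU]] := compact_nbhd_in R hK lcK nU.
have [W nW HW] := supp_small nD.
have [u [[cu u0 _ _ _] [ch h0 _ _ hW] he]] := kernel_star nW.
have [Bh Bh0 hB] := Ccr_bounded ch.
have [g [B [B0 cg g0 g1 gB]]] := star_cover cu u0 he cU.
exists D, W, g, (star u u), B, Bh; split => //; split => //.
- by move=> t; rewrite h0 (le_trans (ler_norm _))//.
- by move=> t Ut; apply: g1; exact: subset_closure.
Qed.

(** * Even exponents *)

Lemma normc_restr (U : set K) (f : K -> R[i]) y : normc (restr U f y) = normc (f y) * \1_U y.
Proof.
rewrite /restr !indicE.
by case: (y \in U); rewrite ?mulr1// !mulr0 ComplexField.Normc.normc0.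
Qed.

Lemma measurable_normc_restr (U : set K) (f : K -> R[i]) : measurable (U : set (borel K)) ->
  cmeasurable f -> measurable_fun [set: borel K] (fun y : borel K => normc (restr U f y)).
Proof.
move=> mU mf; under eq_fun do rewrite normc_restr.
by apply: measurable_funM; [exact: measurable_normc|exact: measurable_indic].
Qed.

Lemma even_estimate (U : set K) : rc_nbhd H U -> exists2 C : R, 0 < C & forall (f : K -> R[i]) m,
  amalgam H omega 1%E f -> positive_type H omega f ->
  (\int[omega]_y (normc (restr U f y) ^+ m.+1.*2)%:E < +oo)%E ->
  forall x, (\int[omega]_y (normc (f y) ^+ m.+1.*2 * translate_indic H U x y)%:E <=
    C%:E * \int[omega]_y (normc (restr U f y) ^+ m.+1.*2)%:E)%E.
Proof.
move=> rU; have [nU mU _] := rU.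
have [D [W [g [h [B [Bh [[cD DU nW HW] [ch hB hW] [B0 cg g0 g1] gB]]]]]]] := rc_nbhd_cover rU.
have Bh0 : 0 <= Bh by case/andP: (hB e) => h0 hB'; exact: le_trans hB'.
(* The added 1 only makes the constant strictly positive. *)
exists (B * Bh + 1); first by rewrite ltr_wpDl// mulr_ge0.
move=> f m [mf [U0 [nU0 mU0 _] fin0]] ptf fin x.
set n := m.+1.*2; have [lf _] := ptf; have mD := borel_compact hK cD.
have mn : measurable_fun [set: borel K] (fun y : borel K => (normc (f y) ^+ n)%:E).
  by apply/measurable_EFinP; apply: measurable_funX; exact: measurable_normc.
have nD y : D y -> normc (f y) = normc (restr U f y).
  by move=> /DU Uy; rewrite normc_restr indicE (mem_set Uy) mulr1.
have mr : measurable_fun [set: borel K] (fun y : borel K => (normc (restr U f y) ^+ n)%:E).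
  by apply/measurable_EFinP; apply: measurable_funX; exact: measurable_normc_restr.
set J := (\int[omega]_y (normc (restr U f y) ^+ n)%:E)%E in fin *.
have J0 : (0 <= J)%E by apply: integral_ge0 => y _; rewrite lee_fin exprn_ge0// normc_ge0.
have leJ : (\int[omega]_(y in D) (normc (f y) ^+ n)%:E <= J)%E.
  rewrite (_ : \int[omega]_(y in D) _ = \int[omega]_(y in D) (normc (restr U f y) ^+ n)%:E)%E; last first.
    by apply: eq_integral => y; rewrite inE => Dy; rewrite nD.
  by apply: ge0_subset_integral => // y _; rewrite lee_fin exprn_ge0// normc_ge0.
have ip : omega.-integrable D (EFin \o (fun y => normc (f y) ^+ n)).
  apply/integrableP; split; first exact: measurable_funTS.
  under eq_integral do rewrite /= ger0_norm ?exprn_ge0 ?normc_ge0//.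
  exact: le_lt_trans leJ fin.
have {leJ}Ile : \int[omega]_(y in D) (normc (f y) ^+ n) <= fine J.
  by apply: fine_le; [exact: integrable_fin_num ip|rewrite ge0_fin_numE|exact: leJ].
have ctg := Ccr_tau x cg.
have tg0 y : 0 <= tau g x y by exact: tau_ge0.
apply: (@le_trans _ _ (\int[omega]_y (normc (f y) ^+ n * tau g x y)%:E)%E).
  apply: ge0_le_integral => //.
  - move=> y _; rewrite lee_fin mulr_ge0 ?exprn_ge0 ?normc_ge0//.
    by case/andP: (translate_indic_le1 x y mU).
  - apply/measurable_EFinP; apply: measurable_funM; last exact: measurable_translate_indic.
    by apply: measurable_funX; exact: measurable_normc.
  - apply/measurable_EFinP; apply: measurable_funM; last by apply: continuous_borel; case: ctg.
    by apply: measurable_funX; exact: measurable_normc.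
  - move=> y _; rewrite lee_fin ler_wpM2l ?exprn_ge0 ?normc_ge0//.
    apply: (translate_indic_le_tau x y mU cg.1) => t; rewrite indicE.
    by case: (boolP (t \in U)) => [|_]; [rewrite inE; exact: g1|exact: g0].
have -> : ((B * Bh + 1)%:E * J = ((B * Bh + 1) * fine J)%:E)%E.
  by rewrite EFinM fineK// ge0_fin_numE.
apply: (weighted_estimate mf ctg tg0) => N N0.
have := truncated_estimate x mU0 nU0 fin0 ptf ch hB hW nW cD HW ip B0 cg g0 gB N0.
move=> /le_trans; apply; rewrite mulrA.
apply: (@le_trans _ _ (B * Bh * fine J)); first by rewrite ler_wpM2l// mulr_ge0.
by rewrite ler_wpM2r ?fine_ge0// lerDl.
Qed.

Lemma Lpnorm_expr n (f : K -> R[i]) : (0 < n)%N ->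
  Lpnorm omega n%:R%:E f = ((\int[omega]_y (normc (f y) ^+ n)%:E) `^ n%:R^-1)%E.
Proof.
move=> n0; rewrite /Lpnorm unlock; congr (_ `^ _)%E.
apply: eq_integral => y _ /=.
by rewrite ger0_norm ?normc_ge0// powR_mulrn// normc_ge0.
Qed.

(** The power in the norm undoes the root in the weight. *)
Lemma Lpnorm_amalgam_weight n (U : set K) (f : K -> R[i]) x : (0 < n)%N -> measurable (U : set (borel K)) ->
  Lpnorm omega n%:R%:E (fun y => f y * (amalgam_weight H n%:R%:E U x y)%:C%C) =
  ((\int[omega]_y (normc (f y) ^+ n * translate_indic H U x y)%:E) `^ n%:R^-1)%E.
Proof.
move=> n0 mU; rewrite Lpnorm_expr//; congr (_ `^ _)%E.
apply: eq_integral => y _; rewrite ComplexField.Normc.normcM normc_real exprMn; congr (_ * _)%:E.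
have [t0 _] := andP (translate_indic_le1 x y mU).
rewrite /= ger0_norm ?powR_ge0// -powR_mulrn ?powR_ge0// -powRrM mulVf ?powRr1//.
by rewrite pnatr_eq0 -lt0n.
Qed.

Lemma amalgam_norm_even (U : set K) : rc_nbhd H U -> exists2 C : R, 0 < C & forall (f : K -> R[i]) m,
  amalgam H omega 1%E f -> positive_type H omega f ->
  (Lpnorm omega (m.+1.*2)%:R%:E (restr U f) < +oo)%E ->
  (amalgam_norm H omega (m.+1.*2)%:R%:E U f <=
    (C `^ (m.+1.*2)%:R^-1)%:E * Lpnorm omega (m.+1.*2)%:R%:E (restr U f))%E.
Proof.
move=> rU; have [C C0 HC] := even_estimate rU; have [_ mU _] := rU.
exists C => // f m af ptf; set n := m.+1.*2; have n0 : (0 < n)%N by [].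
have nR0 : (n%:R : R) != 0 by rewrite pnatr_eq0 -lt0n.
rewrite Lpnorm_expr// => fin.
have {}fin : (\int[omega]_y (normc (restr U f y) ^+ n)%:E < +oo)%E.
  by apply: lty_poweRy fin; rewrite invr_neq0.
apply: ge_ereal_sup => _ [x _ <-]; rewrite Lpnorm_amalgam_weight// -poweR_EFin -poweRM; last 2 first.
- by rewrite lee_fin ltW.
- by apply: integral_ge0 => y _; rewrite lee_fin exprn_ge0// normc_ge0.
have i0 : (0 <= \int[omega]_y (normc (f y) ^+ n * translate_indic H U x y)%:E)%E.
  apply: integral_ge0 => y _; rewrite lee_fin mulr_ge0 ?exprn_ge0 ?normc_ge0//.
  by case/andP: (translate_indic_le1 x y mU).
apply: gt0_ler_poweR => //; last exact: HC.
- by rewrite in_itv /= leey andbT.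
- rewrite in_itv /= leey andbT; apply: le_trans i0 _; exact: HC.
Qed.

(** * The case p = oo *)

Lemma measurable_gt (F : borel K -> R) c : measurable_fun [set: borel K] F ->
  measurable ([set y | c < F y] : set (borel K)).
Proof.
move=> mF; rewrite (_ : [set y | _] = setT `&` F @^-1` `]c, +oo[%classic); last first.
  by rewrite setTI; apply/seteqP; split => y /=; rewrite in_itv/= andbT.
by apply: mF.
Qed.

(** At [e] the smoothing is a mean of [f] over [U] with weight [k]. The compact support of [k] turns
    the locally null exceptional set into a null one. *)
Lemma ccv_e_le (f : K -> R[i]) (U : set K) k (c : R) : measurable (U : set (borel K)) ->
  loc_integrable omega f -> kernel_in U k ->
  locally_null omega [set y | c < normc (restr U f y)] -> complex.Re (csmooth k f e) <= c.
Proof.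
move=> mU lf [ck k0 ksym k1 kU] nullc; have [lr _] := loc_integrable_ReIm lf; have [mf _] := lf.
have [_ [C cC kC]] := ck; have mC := borel_compact hK cC.
have -> : complex.Re (csmooth k f e) = \int[omega]_y (k y * complex.Re (f y)).
  by apply: eq_Rintegral => y _; rewrite inv_e tau_comm tau_e//; case: ck.
pose N : set (borel K) := [set y | c < normc (restr U f y)] `&` C.
have mN : measurable N by apply: measurableI => //; apply: measurable_gt; exact: measurable_normc_restr.
have N0 : omega N = 0%E by exact: nullc.
have ik : omega.-integrable setT (EFin \o (fun y => k y * complex.Re (f y))) := locint_integrable lr ck.
have ic : omega.-integrable setT (EFin \o (fun y => c * k y)) by apply: omega_int; exact: CcrZ.
have mT := @measurableT _ (borel K); have mTN := measurableD mT mN.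
rewrite -[leRHS]mulr1 -k1 -(RintegralZl c mT (omega_int ck)) /Rintegral.
rewrite (negligible_integral mN mT ik N0) (negligible_integral mN mT ic N0).
apply: (le_Rintegral mTN (integrableS mT mTN (@subsetT _ _) ik) (integrableS mT mTN (@subsetT _ _) ic)).
move=> y [_ nNy]; have [->|kn] := eqVneq (k y) 0; first by rewrite mul0r mulr0.
rewrite mulrC ler_wpM2r//; apply: le_trans (ler_norm _) (le_trans (normc_Re _) _).
have := nNy; apply: contra_notT; rewrite -ltNge => cf; split; last exact: kC.
by rewrite /= normc_restr indicE (mem_set (kU y kn)) mulr1.
Qed.

(** Since smoothings are bounded everywhere by [c], the excess of |f| over [c] is at most the
    distance from |f| to the modulus of the smoothing. Its integral over [C] is therefore
    arbitrarily small, so the excess vanishes almost everywhere on [C]. *)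
Lemma locally_null_gt (f : K -> R[i]) (U : set K) (c : R) : rc_nbhd H U -> amalgam H omega 1%E f ->
  positive_type H omega f -> locally_null omega [set y | c < normc (restr U f y)] ->
  locally_null omega [set y | c < normc (f y)].
Proof.
move=> [nU mU _] [mf [U0 [nU0 mU0 _] fin0]] ptf nullc C cC; have [lf _] := ptf; have [_ fi] := lf.
have mC := borel_compact hK cC.
pose F (y : borel K) := Num.max (normc (f y) - c) 0.
have F0 y : 0 <= F y by rewrite le_max lexx orbT.
have mF : measurable_fun [set: borel K] F.
  by apply: measurable_maxr => //; apply: measurable_funB => //; exact: measurable_normc.
have step eps : 0 < eps -> exists2 G : K -> R, omega.-integrable C (EFin \o G) &
    \int[omega]_(y in C) G y <= eps /\ forall y, F y <= G y.
  move=> eps0; have [V nV HV] := csmooth_L1 lf cC eps0.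
  have [u [[cu u0 _ _ _] ku _]] := kernel_star (filterI nU (filterI nU0 nV)).
  set k := star u u in ku.
  have kU : kernel_in U k := kernel_inS (@subIsetl _ _ _) ku.
  have kU0 : kernel_in U0 k by apply: kernel_inS ku => t [_ []].
  have kV : kernel_in V k by apply: kernel_inS ku => t [_ []].
  have ck : Ccr k by case: ku.
  have [M HM] := csmooth_bounded mU0 fin0 lf kU0.
  have pF : Pb H (csmooth k f) := Pb_csmooth ptf cu HM.
  exists (fun y => `|normc (csmooth k f y) - normc (f y)|); first exact: loc_integrable_normc_dist.
  split=> [|y]; first exact: HV.
  rewrite /F ge_max normr_ge0 andbT distrC; apply: le_trans (ler_norm _).
  by rewrite lerD2l lerN2; apply: le_trans (Pb_le y pF) _; exact: ccv_e_le nullc.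
have iF : omega.-integrable C (EFin \o F).
  have [G iG [_ FG]] := step 1 ltr01.
  apply: (le_integrable mC _ _ iG); first by apply/measurable_EFinP; exact: measurable_funTS.
  by move=> y _ /=; rewrite lee_fin (ger0_norm (F0 y)); exact: le_trans (FG y) (ler_norm _).
have iF0 : \int[omega]_(y in C) F y <= 0.
  apply/ler_addgt0Pr => eps eps0; rewrite add0r; have [G iG [Ge FG]] := step eps eps0.
  by apply: le_trans Ge; apply: (le_Rintegral mC iF iG).
have eF0 : (\int[omega]_(y in C) `|(F y)%:E| = 0)%E.
  under eq_integral do rewrite abse_EFin (ger0_norm (F0 _)).
  apply/eqP; rewrite eq_le; apply/andP; split; last by apply: integral_ge0 => y _; rewrite lee_fin.
  by move: iF0; rewrite -lee_fin /Rintegral fineK//; exact: integrable_fin_num iF.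
have mFC : measurable_fun (C : set (borel K)) (EFin \o F).
  by apply/measurable_EFinP; exact: measurable_funTS.
have [N [mN N0 HN]] := (ae_eq_integral_abs omega mC mFC).1 eF0.
apply: measure_negligible; first by apply: measurableI => //; apply: measurable_gt; exact: measurable_normc.
exists N; split => // y [cy Cy]; apply: HN => /= /(_ Cy)/(congr1 fine)/= Fy.
by move: cy => /=; rewrite -subr_gt0 => /lt_geF; rewrite -Fy /F le_max lexx.
Qed.

Lemma amalgam_norm_infty (U : set K) (f : K -> R[i]) : rc_nbhd H U -> amalgam H omega 1%E f ->
  positive_type H omega f ->
  (amalgam_norm H omega +oo U f <= Lpnorm omega +oo (restr U f))%E.
Proof.
move=> rU af ptf; have [_ mU _] := rU; have [mf _] := af.
apply: ge_ereal_sup => _ [x _ <-]; rewrite /Lpnorm; apply: ereal_inf_le_tmp => _ [c [c0 nullc] <-].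
pose A : set K := [set z | 0 < translate_indic H U x z].
have mA : measurable (A : set (borel K)) by apply: measurable_gt; exact: measurable_translate_indic.
have nE y : normc (f y * (amalgam_weight H +oo U x y)%:C%C) = normc (restr A f y).
  by rewrite normc_restr ComplexField.Normc.normcM normc_real ger0_norm.
exists c => //; split => //= C cC; have mC := borel_compact hK cC.
apply: (subset_measure0 _ _ _ (locally_null_gt rU af ptf nullc cC)).
- apply: measurableI => //.
  rewrite (_ : [set y | _] = [set y | c < normc (restr A f y)]); last first.
    by apply/seteqP; split => y /=; rewrite nE.
  by apply: measurable_gt; exact: measurable_normc_restr.
- by apply: measurableI => //; apply: measurable_gt; exact: measurable_normc.
- move=> y [+ Cy]; rewrite /= nE normc_restr indicE => cf; split => //=.
  move: cf; case: (y \in A); rewrite ?mulr1// mulr0 => /(le_lt_trans c0).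
  by rewrite ltxx.
Qed.

(** * Assembly of the two cases *)

Lemma Lp1_amalgam1 (U : set K) (f : K -> R[i]) : rc_nbhd H U -> Lp omega 1%E f ->
  amalgam H omega 1%E f.
Proof.
move=> rU [mf fin]; split => //; exists U => //; have [_ mU _] := rU.
apply: le_lt_trans fin; apply: ge_ereal_sup => _ [x _ <-].
have mn := measurable_normc mf.
rewrite (@Lpnorm_amalgam_weight 1%N U f x (ltnSn 0) mU) (@Lpnorm_expr 1%N f (ltnSn 0)) invr1.
have i0 : (0 <= \int[omega]_y (normc (f y) ^+ 1 * translate_indic H U x y)%:E)%E.
  apply: integral_ge0 => y _; rewrite lee_fin mulr_ge0 ?normc_ge0//.
  by case/andP: (translate_indic_le1 x y mU).
rewrite !poweRe1//; last by apply: integral_ge0 => y _; rewrite lee_fin normc_ge0.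
apply: ge0_le_integral => //.
- move=> y _; rewrite lee_fin mulr_ge0 ?normc_ge0//.
  by case/andP: (translate_indic_le1 x y mU).
- by apply/measurable_EFinP; apply: measurable_funM => //; exact: measurable_translate_indic.
- exact/measurable_EFinP.
- move=> y _; have /andP[_ t1] := translate_indic_le1 x y mU.
  by rewrite lee_fin ler_piMr// normc_ge0.
Qed.

Lemma amalgam_norm_le (p : \bar R) (U : set K) : even_or_infty p -> rc_nbhd H U ->
  exists C : R, 0 < C /\ forall f : K -> R[i],
    amalgam H omega 1%E f -> positive_type H omega f -> Lp omega p (restr U f) ->
    amalgam H omega p f /\
    (amalgam_norm H omega p U f <= (root_const p C)%:E * Lpnorm omega p (restr U f))%E.
Proof.
move=> evp rU.
suff [C C0 HC] : exists2 C : R, 0 < C & forall f : K -> R[i],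
    amalgam H omega 1%E f -> positive_type H omega f -> (Lpnorm omega p (restr U f) < +oo)%E ->
    (amalgam_norm H omega p U f <= (root_const p C)%:E * Lpnorm omega p (restr U f))%E.
  exists C; split => // f af ptf [_ fin]; have le := HC f af ptf fin; split => //.
  split; first by case: af.
  exists U => //; apply: le_lt_trans le _; apply: lte_mul_pinfty => //.
  by rewrite lee_fin /root_const; case: (p) => // r; rewrite powR_ge0.
case: evp => [[n [n0 evn ->]]|->]; last first.
  (* Any positive witness would do, since [root_const] is 1 at infinity. *)
  exists 1 => // f af ptf _; rewrite mul1e; exact: amalgam_norm_infty.
have [C C0 HC] := amalgam_norm_even rU; exists C => // f.
have -> : n = (n./2.-1.+1).*2.
  by rewrite prednK ?half_gt0 -?[LHS](odd_double_half n) ?(negbTE evn)//; case: (n) n0 evn => [|[]].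
exact: HC.
Qed.

End hypergroup_calculus.

Theorem corollary14 (R : realType) (K : ptopologicalType) (H : hypergroup R K)
    (omega : {measure set (borel K) -> \bar R}) (p : \bar R)
    (Hcomm : hcommutative H) (Homega : haar H omega)
    (HPb : forall f g : K -> R[i], Pb H f -> Pb H g -> Pb H (fun x => f x * g x))
    (Hp : even_or_infty p) :
  [/\ forall U : set K, rc_nbhd H U ->
        exists C : R, 0 < C /\
          forall f : K -> R[i],
            amalgam H omega 1%E f -> positive_type H omega f ->
            Lp omega p (restr U f) ->
            amalgam H omega p f /\
            (amalgam_norm H omega p U f <=
               (root_const p C)%:E * Lpnorm omega p (restr U f))%E,
      forall f : K -> R[i],
        amalgam H omega 1%E f -> positive_type H omega f ->
        (exists U : set K, rc_nbhd H U /\ Lp omega p (restr U f)) ->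
        amalgam H omega p f
    & forall f : K -> R[i],
        Lp omega 1%E f -> positive_type H omega f ->
        (exists U : set K, rc_nbhd H U /\ Lp omega p (restr U f)) ->
        amalgam H omega p f].
Proof.
have le U (rU : rc_nbhd H U) := amalgam_norm_le Hcomm Homega HPb Hp rU.
split => [U|f af ptf [U [rU fU]]|f f1 ptf [U [rU fU]]]; first exact: le.
  by have [C [_ HC]] := le U rU; have [] := HC f af ptf fU.
have af := Lp1_amalgam1 Hcomm rU f1.
by have [C [_ HC]] := le U rU; have [] := HC f af ptf fU.
Qed.
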